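(* Let $A\colon(\mathbb{C}^n,0)\to\mathbb{C}^n$ be a germ of a holomorphic map of generic rank $n$. Then there exist an integer $\ell_0$ and, for every integer $\ell>0$, a polynomial mapping $$p_\ell\colon\mathbb{C}^n\times\mathsf{GL}_n(\mathbb{C})\times J_0^{\ell_0+\ell}(\mathbb{C}^n)\to\mathbb{C}^n,$$ homogeneous of degree $\ell$ in its first variable, and an integer $\kappa(\ell)$, such that for every germ of a holomorphic map $b\colon(\mathbb{C}^n,0)\to\mathbb{C}^n$, if $u\colon(\mathbb{C}^n,0)\to(\mathbb{C}^n,0)$ is a germ of a biholomorphism satisfying $A(u(z))=b(z)$, then necessarily $$u_\ell(z)=\frac{1}{(\det u'(0))^{\kappa(\ell)}}\,p_\ell(z,u'(0),j_0^{\ell_0+\ell}b),$$ where $u(z)=\sum_{\ell\ge1}u_\ell(z)$ is the decomposition of $u$ into homogeneous $\mathbb{C}^n$-valued polynomial terms. Furthermore, the polynomial maps $p_\ell$ and the integers $\kappa(\ell)$ can be chosen with the following two properties: (i) for every germ of a holomorphic map $b\colon(\mathbb{C}^n,0)\to\mathbb{C}^n$ and for every $\lambda\in\mathsf{GL}_n(\mathbb{C})$, $$p_1(z,\lambda,j_0^{\ell_0+1}b)=\lambda z,\quad\text{and}\quad\kappa(1)=0;$$ (ii) there exists a polydisc $\Delta\subset\mathbb{C}^n$ centered at the origin such that for every $C>0$ and every compact subset $L\subset\mathsf{GL}_n(\mathbb{C})$ there exists $K>0$ such that for every $\lambda\in L$ and every germ of a holomorphic map $b\colon(\mathbb{C}^n,0)\to\mathbb{C}^n$,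 written into homogeneous terms $b(z)=\sum_{k\ge0}b_k(z)$, satisfying $\|b_k\|_\Delta\le C^k$ for all $k\in\mathbb{N}$, we have for all $\ell\ge1$ $$\left\|\frac{p_\ell(\cdot,\lambda,j_0^{\ell_0+\ell}b)}{(\det\lambda)^{\kappa(\ell)}}\right\|_\Delta\le K^\ell.$$
   Context: $\mathbb{N}=\{0,1,2,\dots\}$. A germ $b\colon(\mathbb{C}^n,0)\to\mathbb{C}^n$ is not required to fix $0$. $J_0^l(\mathbb{C}^n)$ is the space of jets of order $l$ at the origin of holomorphic mappings from $\mathbb{C}^n$ to $\mathbb{C}^n$ (constant terms included) and $j_0^lb$ is the $l$-jet of $b$ at $0$. $\mathsf{GL}_n(\mathbb{C})$ is the group of invertible $n\times n$ complex matrices. For a polynomial map $f=(f^1,\dots,f^k)\colon\mathbb{C}^n\to\mathbb{C}^k$ and a bounded set $F\subset\mathbb{C}^n$, $\|f\|_F:=\max_{1\le j\le k}\sup_{z\in F}|f^j(z)|$. *)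

(* Defs.v *)
From HB Require Import structures.
From mathcomp Require Import all_boot all_order all_algebra.
From mathcomp Require Import complex.
From mathcomp Require Import all_classical all_reals all_analysis.
(* The notations of mpoly clash with those of the analysis library. *)
From mathcomp Require Import -(notations) mpoly.

Set Implicit Arguments.
Unset Strict Implicit.
Unset Printing Implicit Defensive.

Import Order.TTheory GRing.Theory Num.Theory.
Import numFieldNormedType.Exports.

Local Open Scope classical_set_scope.
Local Open Scope ring_scope.

(* The library equips an abstract numFieldType with its norm topology, but not
   the concrete type R[i]; here R[i] receives that same structure. *)
HB.instance Definition _ (R : rcfType) := NormedModule.copy R[i] R[i]^o.

Notation normc := ComplexField.Normc.normc.

Section Germs.
Variables (R : realType) (n : nat).
Local Notation C := R[i].
Local Notation V := 'cV[C]_n.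

Definition polydisc (r : 'I_n -> R) : set V :=
  [set z | forall i, normc (z i 0) < r i].

Definition supnorm (F : set V) (f : V -> V) : R :=
  \big[Num.max/0]_(i < n) sup [set normc (f z i 0) | z in F].

Definition monomial (z : V) (m : multinom n) : C :=
  \prod_(i < n) z i 0 ^+ m i.

Definition homog_part (a : multinom n -> V) (k : nat) (z : V) : V :=
  \sum_(m : bmultinom n k.+1 | mdeg m == k) monomial z m *: a m.

(* f is, near 0, the sum of the power series with coefficients a, which
   converges absolutely on the closed polydisc of radius r. *)
Definition has_power_series (f : V -> V) (a : multinom n -> V) : Prop :=
  exists2 r : R, 0 < r &
    (forall i, exists M : R, forall N : nat,
       \sum_(m : bmultinom n N) normc (a m i 0) * r ^+ mdeg m <= M) /\
    (forall z, polydisc (fun=> r) z ->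
       series (fun k => homog_part a k z) @ \oo --> f z).

(* Germs at 0 are represented by everywhere defined functions, of which only
   the values near 0 matter. *)
Definition holomorphic_germ (f : V -> V) : Prop :=
  exists a, has_power_series f a.

(* Coefficients of f at 0; they are unique when f is a holomorphic germ. *)
Definition taylor_coef (f : V -> V) : multinom n -> V :=
  get [set a | has_power_series f a].

Definition homog_term (f : V -> V) (k : nat) : V -> V :=
  homog_part (taylor_coef f) k.

(* J_0^k(C^n), in the coordinates given by the Taylor coefficients *)
Definition jet (k : nat) := {ffun bmultinom n k.+1 -> V}.

Definition jet_at0 (k : nat) (f : V -> V) : jet k :=
  [ffun m : bmultinom n k.+1 => taylor_coef f m].

Definition jacobian_mx (f : V -> V) (z : V) : 'M[C]_n :=
  \matrix_(i, j) ('D_(delta_mx j 0) f z) i 0.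

(* the largest rank of the Jacobian matrix attained arbitrarily close to 0 *)
Definition generic_rank (f : V -> V) (r : nat) : Prop :=
  (\forall z \near (0 : V), (\rank (jacobian_mx f z) <= r)%N) /\
  (forall U : set V, nbhs (0 : V) U ->
     exists2 z, U z & \rank (jacobian_mx f z) = r).

Definition biholomorphic_germ (u : V -> V) : Prop :=
  [/\ holomorphic_germ u, u 0 = 0 &
      exists v : V -> V,
        [/\ holomorphic_germ v, v 0 = 0,
            (\forall z \near (0 : V), v (u z) = z) &
            (\forall z \near (0 : V), u (v z) = z)]].

(* Coordinates of C^n x M_n(C) x J_0^k(C^n). *)
Definition coord_idx (k : nat) : finType :=
  ('I_n + 'I_n * 'I_n + bmultinom n k.+1 * 'I_n)%type.

Definition coord (k : nat) (z : V) (l : 'M[C]_n) (j : jet k)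
    (x : coord_idx k) : C :=
  match x with
  | inl (inl i) => z i 0
  | inl (inr (i, i')) => l i i'
  | inr (m, i) => j m i 0
  end.

(* polynomial mappings C^n x GL_n(C) x J_0^k(C^n) -> C^n *)
Definition polymap (k : nat) := 'I_n -> mpoly #|coord_idx k| C.

Definition polymap_eval (k : nat) (p : polymap k) (z : V) (l : 'M[C]_n)
    (j : jet k) : V :=
  \col_i meval (fun x => coord z l j (enum_val x)) (p i).

Definition homogeneous_in_z (k d : nat) (p : polymap k) : Prop :=
  forall (t : C) (z : V) (l : 'M[C]_n) (j : jet k), l \in unitmx ->
    polymap_eval p (t *: z) l j = t ^+ d *: polymap_eval p z l j.

End Germs.

(* Main.v *)
(* Choose polynomials P_i in n variables such that the lowest homogeneous parts
   f_i of P_i o A have a Jacobian determinant D = det Jac f that does not vanish.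
   They exist because A has generic rank n: an algebraic relation G between the
   current lowest parts lets one replace some P_i by G(P), which brings the sum
   of the degrees of the f_i closer to the bound given by the order of
   det Jac (P o A).  With S = u o lambda^-1, lambda = u'(0), the equation
   A o u = b becomes (P o A)(S) = P o b o lambda^-1, where S = id + O(|z|^2).
   The part of degree l of S enters the part of degree deg f_i + l - 1 of this
   equation linearly, through Jac f, with coefficients that do not depend on S.
   Multiplying by the adjugate of Jac f and dividing by D by means of a linear
   operator that is defined on all polynomials therefore determines S
   recursively, as a rational function of lambda and of the jet of b; this
   produces the p_l whether or not a solution u exists.  The division operator is
   bounded for weighted l^1 norms on small polydiscs, which turns the recursion
   into the geometric estimates. *)

Require Import Defs.
From HB Require Import structures.
From mathcomp Require Import all_boot all_order all_algebra.
From mathcomp Require Import complex.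
From mathcomp Require Import all_classical all_reals all_analysis.
From mathcomp Require Import -(notations) mpoly.
From mathcomp Require Import perm.
From mathcomp Require ssrcomplements cyclic separable cyclotomic.
From mathcomp Require Import ring lra zify.

Set Implicit Arguments.
Unset Strict Implicit.
Unset Printing Implicit Defensive.

Import Order.TTheory GRing.Theory Num.Theory.
Import numFieldNormedType.Exports.

Local Open Scope classical_set_scope.
Local Open Scope ring_scope.

(** * Substitution, order and homogeneous parts of polynomials *)

(** The obstacle is that the lowest homogeneous parts of the components of A may be algebraically
    dependent: their Jacobian determinant then vanishes and the recursion has nothing to divide by.
    Composing with P removes exactly this degeneracy. Power series are never composed or inverted.
    All algebra takes place on truncations, and [approx] (agreement up to O(|z|^(N+1))) transfers an
    identity between germs to their truncations. Normalizing the linear part to the identity lets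
    the same Jacobian matrix and the same division operator serve for every lambda. This operator
    must act on each coefficient by a finite sum, so that polynomial dependence on the jet survives,
    and its bound must not depend on the degree. Estimating the stages of the recursion one after
    the other would accumulate constants. Instead, all residuals up to a given stage are homogeneous
    parts of a single remainder, quadratic in S - id up to terms that gain a power of the radius,
    and in an l^1 norm the parts of a polynomial together cost no more than the polynomial. *)

Lemma mulrB_telescope (T : pzRingType) (a b c d : T) :
  a * b - c * d = (a - c) * b + c * (b - d).
Proof. by rewrite mulrBl mulrBr addrA subrK. Qed.

Section PolySubst.
Variable K : comNzRingType.

Definition msubst n k (s : 'I_n -> mpoly k K) : mpoly n K -> mpoly k K :=
  mmap (@mpolyC k K) s.

HB.instance Definition _ n k (s : 'I_n -> mpoly k K) :=
  GRing.RMorphism.copy (msubst s) (mmap (@mpolyC k K) s).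

Definition var n (i : 'I_n) : mpoly n K := mpolyX K (mnm1 i).

Lemma mpolyX_prod_var n (m : multinom n) :
  mpolyX K m = \prod_(i < n) var i ^+ m i.
Proof. exact: mpolyXE_id. Qed.

Lemma msubst_var n k (s : 'I_n -> mpoly k K) i : msubst s (var i) = s i.
Proof. by rewrite /msubst mmapX mmap1U. Qed.

Lemma msubstC n k (s : 'I_n -> mpoly k K) c :
  msubst s (mpolyC n c) = mpolyC k c.
Proof. exact: mmapC. Qed.

Lemma msubstX n k (s : 'I_n -> mpoly k K) m :
  msubst s (mpolyX K m) = \prod_(i < n) s i ^+ m i.
Proof. exact: mmapX. Qed.

Lemma msubstZ n k (s : 'I_n -> mpoly k K) c p :
  msubst s (c *: p) = c *: msubst s p.
Proof. by rewrite /msubst mmapZ mul_mpolyC. Qed.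

Lemma msubstD n k (s : 'I_n -> mpoly k K) p q :
  msubst s (p + q) = msubst s p + msubst s q.
Proof. exact: rmorphD. Qed.

Lemma msubstM n k (s : 'I_n -> mpoly k K) p q :
  msubst s (p * q) = msubst s p * msubst s q.
Proof. exact: rmorphM. Qed.

Lemma msubstB n k (s : 'I_n -> mpoly k K) p q :
  msubst s (p - q) = msubst s p - msubst s q.
Proof. exact: rmorphB. Qed.

Lemma mpoly_ring_ind n (P : mpoly n K -> Prop) :
  (forall c, P (mpolyC n c)) -> (forall i, P (var i)) ->
  (forall p q, P p -> P q -> P (p + q)) ->
  (forall p q, P p -> P q -> P (p * q)) ->
  forall p, P p.
Proof.
move=> PC PX PD PM p.
have PXm m : P (mpolyX K m).
  rewrite mpolyX_prod_var; apply: big_ind => //.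
  - by rewrite -mpolyC1.
  - move=> i _; elim: (m i) => [|k IH].
      by rewrite expr0 -mpolyC1.
    by rewrite exprS; apply: PM.
rewrite [p]mpolyE; apply: big_ind => //.
  by rewrite -(mpolyC0 n K).
by move=> m _; rewrite -mul_mpolyC; apply: PM.
Qed.

Lemma eq_msubst n k (s t : 'I_n -> mpoly k K) p :
  s =1 t -> msubst s p = msubst t p.
Proof. by move=> st; congr (msubst _ p); apply/funext. Qed.

Lemma msubst_comp n k l (s : 'I_k -> mpoly l K) (r : 'I_n -> mpoly k K) p :
  msubst s (msubst r p) = msubst (fun i => msubst s (r i)) p.
Proof.
elim/mpoly_ring_ind: p => [c|i|p q IHp IHq|p q IHp IHq].
- by rewrite !msubstC.
- by rewrite !msubst_var.
- by rewrite !rmorphD /= IHp IHq.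
- by rewrite !rmorphM /= IHp IHq.
Qed.

Lemma mderiv_var n (i j : 'I_n) : mderiv j (var i) = (i == j)%:R.
Proof.
rewrite /var mderivX mnm1E; case: eqP => [->|_]; last by rewrite scale0r.
rewrite scale1r (_ : mnm_sub _ _ = mnm0) ?mpolyX0 //.
by apply/mnmP=> l; rewrite mnmBE mnm0E subnn.
Qed.

Lemma mderiv_msubst n k (s : 'I_n -> mpoly k K) j p :
  mderiv j (msubst s p) = \sum_i msubst s (mderiv i p) * mderiv j (s i).
Proof.
elim/mpoly_ring_ind: p => [c|i|p q IHp IHq|p q IHp IHq].
- rewrite msubstC mderivC big1 // => i _.
  by rewrite mderivC rmorph0 mul0r.
- rewrite msubst_var (bigD1 i) //= mderiv_var eqxx rmorph1 mul1r.
  rewrite big1 ?addr0 // => l li.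
  by rewrite mderiv_var eq_sym (negbTE li) rmorph0 mul0r.
- rewrite rmorphD !mderivD /= IHp IHq -big_split /=.
  by apply: eq_bigr => i _; rewrite mderivD rmorphD mulrDl.
- rewrite rmorphM /= mderivM IHp IHq mulr_suml mulr_sumr -big_split /=.
  apply: eq_bigr => i _; rewrite mderivM rmorphD !rmorphM /=; ring.
Qed.

End PolySubst.

Section Order.
Variables (K : idomainType) (n : nat).
Implicit Types (p q f g : mpoly n K) (d e : nat).

Definition low d p := forall m : multinom n, (mdeg m < d)%N -> mcoeff m p = 0.

Definition homog d p := forall m : multinom n, mdeg m != d -> mcoeff m p = 0.

(** [f] may be 0, and then [p] merely has order greater than [d]. This makes [init] stable under
    sums and products with no condition on cancellation. *)
Definition init d f p := homog d f /\ low d.+1 (p - f).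

Lemma low0 d : low d 0. Proof. by move=> m _; rewrite mcoeff0. Qed.

Lemma lowD d p q : low d p -> low d q -> low d (p + q).
Proof. by move=> lp lq m md; rewrite mcoeffD lp // lq // addr0. Qed.

Lemma lowN d p : low d p -> low d (- p).
Proof. by move=> lp m md; rewrite mcoeffN lp // oppr0. Qed.

Lemma lowB d p q : low d p -> low d q -> low d (p - q).
Proof. by move=> lp lq; apply: lowD => //; apply: lowN. Qed.

Lemma lowW d e p : (d <= e)%N -> low e p -> low d p.
Proof. by move=> de lp m md; apply: lp; apply: leq_trans de. Qed.

Lemma low_sum (I : Type) (r : seq I) (P : pred I) (F : I -> mpoly n K) d :
  (forall i, P i -> low d (F i)) -> low d (\sum_(i <- r | P i) F i).
Proof.
move=> lF; apply: big_ind => //; first exact: low0.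
by move=> *; apply: lowD.
Qed.

Lemma lowM d e p q : low d p -> low e q -> low (d + e) (p * q).
Proof.
move=> lp lq m md; rewrite mcoeffM big1 // => -[k l] /= /eqP mE.
have [/lp ->|dk] := ltnP (mdeg k) d; first by rewrite mul0r.
rewrite [mcoeff l q]lq ?mulr0 //.
have := congr1 (@mdeg n) mE; rewrite mdegD; lia.
Qed.

Lemma lowMl d p q : low d q -> low d (p * q).
Proof. by move=> lq; rewrite -[d]add0n; apply: lowM. Qed.

Lemma lowMr d p q : low d p -> low d (p * q).
Proof. by move=> lp; rewrite -[d]addn0; apply: lowM. Qed.

Lemma lowZ d c p : low d p -> low d (c *: p).
Proof. by move=> lp m md; rewrite mcoeffZ lp // mulr0. Qed.

Lemma low_deriv d p i : low d.+1 p -> low d (mderiv i p).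
Proof.
by move=> lp m md; rewrite mcoeff_deriv lp ?mul0rn // mdegD mdeg1; lia.
Qed.

Lemma low_prod (I : Type) (r : seq I) (P : pred I) (F : I -> mpoly n K)
    (d : I -> nat) :
  (forall i, P i -> low (d i) (F i)) ->
  low (\sum_(i <- r | P i) d i)%N (\prod_(i <- r | P i) F i).
Proof.
move=> lF; apply: (big_ind2 (fun d p => low d p)) => //.
by move=> *; apply: lowM.
Qed.

Lemma low_exp d p k : low d p -> low (d * k) (p ^+ k).
Proof.
move=> lp; elim: k => [|k IH]; first by rewrite muln0.
by rewrite exprS mulnS; apply: lowM.
Qed.

Lemma homog0 d : homog d 0. Proof. by move=> m _; rewrite mcoeff0. Qed.

Lemma homogD d p q : homog d p -> homog d q -> homog d (p + q).
Proof. by move=> hp hq m md; rewrite mcoeffD hp // hq // addr0. Qed.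

Lemma homogN d p : homog d p -> homog d (- p).
Proof. by move=> hp m md; rewrite mcoeffN hp // oppr0. Qed.

Lemma homogB d p q : homog d p -> homog d q -> homog d (p - q).
Proof. by move=> lp lq; apply: homogD => //; apply: homogN. Qed.

Lemma homogZ d c p : homog d p -> homog d (c *: p).
Proof. by move=> hp m md; rewrite mcoeffZ hp // mulr0. Qed.

Lemma homog_sum (I : Type) (r : seq I) (P : pred I) (F : I -> mpoly n K) d :
  (forall i, P i -> homog d (F i)) -> homog d (\sum_(i <- r | P i) F i).
Proof.
move=> hF; apply: big_ind => //; first exact: homog0.
by move=> *; apply: homogD.
Qed.

Lemma homogM d e p q : homog d p -> homog e q -> homog (d + e) (p * q).
Proof.
move=> hp hq m md; rewrite mcoeffM big1 // => -[k l] /= /eqP mE.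
have [kd|/hp ->] := eqVneq (mdeg k) d; last by rewrite mul0r.
rewrite [mcoeff l q]hq ?mulr0 //.
by apply: contraNneq md => le; rewrite (congr1 (@mdeg n) mE) mdegD kd le.
Qed.

Lemma homogC c : homog 0 (mpolyC n c).
Proof. by move=> m m0; rewrite mcoeffC -mdeg_eq0 (negbTE m0) mulr0. Qed.

Lemma homog1 : homog 0 1.
Proof. by rewrite -mpolyC1; apply: homogC. Qed.

Lemma homogX (m : multinom n) : homog (mdeg m) (mpolyX K m).
Proof. by move=> k; rewrite mcoeffX; case: (m =P k) => [->|//]; rewrite eqxx. Qed.

Lemma homog_var (i : 'I_n) : homog 1 (var K i).
Proof. by have := @homogX (mnm1 i); rewrite mdeg1. Qed.

Lemma homog_exp d p k : homog d p -> homog (d * k) (p ^+ k).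
Proof.
move=> hp; elim: k => [|k IH]; first by rewrite muln0; apply: homog1.
by rewrite exprS mulnS; apply: homogM.
Qed.

Lemma homog_prod (I : Type) (r : seq I) (P : pred I) (F : I -> mpoly n K)
    (d : I -> nat) :
  (forall i, P i -> homog (d i) (F i)) ->
  homog (\sum_(i <- r | P i) d i)%N (\prod_(i <- r | P i) F i).
Proof.
move=> hF; apply: (big_ind2 (fun d p => homog d p)) => //.
  exact: homog1.
by move=> *; apply: homogM.
Qed.

Lemma homog_low d p : homog d p -> low d p.
Proof. by move=> hp m md; apply: hp; rewrite neq_ltn md. Qed.

Lemma homog_low_eq0 d p : homog d p -> low d.+1 p -> p = 0.
Proof.
move=> hp lp; apply/mpolyP => m; rewrite mcoeff0.
by have [md|/hp //] := eqVneq (mdeg m) d; rewrite lp // md.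
Qed.

Lemma homog_deriv d p i : homog d.+1 p -> homog d (mderiv i p).
Proof.
move=> hp m md; rewrite mcoeff_deriv hp ?mul0rn // mdegD mdeg1 addn1.
by apply: contraNneq md => -[->].
Qed.

Definition hpart d p : mpoly n K := pihomog mdeg d p.

Lemma mcoeff_hpart d p m :
  mcoeff m (hpart d p) = if mdeg m == d then mcoeff m p else 0.
Proof.
rewrite /hpart pihomogE raddf_sum /=.
have [md|mNd] := eqVneq.
  have [mp|/memN_msupp_eq0 p0] := boolP (m \in msupp p).
    rewrite big_mkcond (bigD1_seq m) ?msupp_uniq //= md eqxx.
    rewrite mcoeffZ mcoeffX eqxx mulr1 big1 ?addr0 // => k km.
    by case: ifP => // _; rewrite mcoeffZ mcoeffX (negbTE km) mulr0.
  rewrite p0 big1_seq // => k /andP[_ kp].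
  rewrite mcoeffZ mcoeffX; case: eqP => [km|]; last by rewrite mulr0.
  by rewrite km p0 mul0r.
rewrite big1 // => k kd; rewrite mcoeffZ mcoeffX; case: eqP => [km|].
  by move: mNd; rewrite -km kd.
by rewrite mulr0.
Qed.

HB.instance Definition _ d := GRing.Linear.copy (hpart d) (pihomog mdeg d).

Lemma homog_hpart d p : homog d (hpart d p).
Proof. by move=> m md; rewrite mcoeff_hpart (negbTE md). Qed.

Lemma hpart_homog d p : homog d p -> hpart d p = p.
Proof.
move=> hp; apply/mpolyP => m; rewrite mcoeff_hpart.
by have [//|/hp ->] := eqVneq.
Qed.

Lemma hpart_homog_neq d e p : homog d p -> d != e -> hpart e p = 0.
Proof.
move=> hp de; apply/mpolyP => m; rewrite mcoeff_hpart mcoeff0.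
by case: eqP => // me; apply: hp; rewrite me eq_sym.
Qed.

Lemma hpart_low d e p : (e < d)%N -> low d p -> hpart e p = 0.
Proof.
move=> ed lp; apply/mpolyP => m; rewrite mcoeff_hpart mcoeff0.
by case: eqP => // me; apply: lp; rewrite me.
Qed.

Lemma low_hpart d p : low d p -> low d.+1 (p - hpart d p).
Proof.
move=> lp m md; rewrite mcoeffB mcoeff_hpart; case: eqP => [_|mNd].
  by rewrite subrr.
by rewrite subr0 lp //; lia.
Qed.

Lemma init_hpart d p : low d p -> init d (hpart d p) p.
Proof. by move=> lp; split; [apply: homog_hpart | apply: low_hpart]. Qed.

Lemma init_low d f p : init d f p -> low d p.
Proof.
by case=> hf /(lowW (leqnSn d)) lpf; rewrite -[p](subrK f); apply: lowD => //; apply: homog_low.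
Qed.

Lemma init_homog d f : homog d f -> init d f f.
Proof. by move=> hf; split=> //; rewrite subrr; apply: low0. Qed.

Lemma init0_low d p : init d 0 p -> low d.+1 p.
Proof. by case=> _; rewrite subr0. Qed.

Lemma low_init0 d p : low d.+1 p -> init d 0 p.
Proof. by move=> lp; split; [apply: homog0 | rewrite subr0]. Qed.

Lemma initD d f g p q : init d f p -> init d g q -> init d (f + g) (p + q).
Proof.
move=> [hf lp] [hg lq]; split; first exact: homogD.
by rewrite opprD addrACA; apply: lowD.
Qed.

Lemma initZ d c f p : init d f p -> init d (c *: f) (c *: p).
Proof.
by move=> [hf lp]; split; [apply: homogZ | rewrite -scalerBr; apply: lowZ].
Qed.

Lemma initM d e f g p q :
  init d f p -> init e g q -> init (d + e) (f * g) (p * q).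
Proof.
move=> ifp igq; have [hf lp] := ifp; have [hg lq] := igq.
split; first exact: homogM.
rewrite (_ : p * q - f * g = (p - f) * q + f * (q - g)); last by ring.
apply: lowD.
  by rewrite -addSn; apply: lowM => //; apply: init_low igq.
by rewrite -addnS; apply: lowM => //; apply: homog_low.
Qed.

Lemma init_sum (I : Type) (r : seq I) (P : pred I) (F G : I -> mpoly n K) d :
  (forall i, P i -> init d (F i) (G i)) ->
  init d (\sum_(i <- r | P i) F i) (\sum_(i <- r | P i) G i).
Proof.
move=> iF; apply: (big_ind2 (fun f p => init d f p)) => //.
  by apply: init_homog; apply: homog0.
by move=> *; apply: initD.
Qed.

Lemma init_exp d f p k : init d f p -> init (d * k) (f ^+ k) (p ^+ k).
Proof.
move=> ip; elim: k => [|k IH].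
  by rewrite muln0 !expr0; apply: init_homog; apply: homog1.
by rewrite !exprS mulnS; apply: initM.
Qed.

Lemma init_prod (I : Type) (r : seq I) (P : pred I) (F G : I -> mpoly n K)
    (d : I -> nat) :
  (forall i, P i -> init (d i) (F i) (G i)) ->
  init (\sum_(i <- r | P i) d i)%N
    (\prod_(i <- r | P i) F i) (\prod_(i <- r | P i) G i).
Proof.
move=> iF.
elim/big_rec3: _ => [|i f d' p Pi IH]; first by apply: init_homog; apply: homog1.
by apply: initM => //; apply: iF.
Qed.

Lemma init_deriv d f p i : init d.+1 f p -> init d (mderiv i f) (mderiv i p).
Proof.
move=> [hf lp]; split; first exact: homog_deriv.
by rewrite -mderivB; apply: low_deriv.
Qed.

Lemma init_uniq d f g p : init d f p -> init d g p -> f = g.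
Proof.
move=> [hf lf] [hg lg]; apply/eqP; rewrite -subr_eq0; apply/eqP.
apply: (homog_low_eq0 (homogB hf hg)).
by rewrite (_ : f - g = (p - g) - (p - f)); [apply: lowB|ring].
Qed.

Lemma init_le_low d f p e : f != 0 -> init d f p -> low e p -> (e <= d)%N.
Proof.
move=> f0 ip lp; rewrite leqNgt; apply: contra f0 => de; apply/eqP.
apply: (init_uniq ip); apply: low_init0; exact: lowW lp.
Qed.

Lemma low_msubst_congr k d (s t : 'I_k -> mpoly n K) P :
  (forall i, low d (s i - t i)) -> low d (msubst s P - msubst t P).
Proof.
move=> st; elim/mpoly_ring_ind: P => [c|i|p q IHp IHq|p q IHp IHq].
- by rewrite !msubstC subrr; apply: low0.
- by rewrite !msubst_var.
- rewrite !msubstD opprD addrACA; apply: lowD; [exact: IHp | exact: IHq].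
- rewrite !msubstM.
  rewrite mulrB_telescope.
  by apply: lowD; [apply: lowMr; exact: IHp | apply: lowMl; exact: IHq].
Qed.

Lemma init_exists p : p != 0 -> exists d, low d p /\ hpart d p != 0.
Proof.
move=> p0; have [m mp] : exists m, mcoeff m p != 0.
  by exists (mlead p); rewrite -mcoeff_msupp mlead_supp.
pose Q d := `[< exists2 m : multinom n, mdeg m = d & mcoeff m p != 0 >].
have exQ : exists d, Q d by exists (mdeg m); apply/asboolP; exists m.
case: (ex_minnP exQ) => d /asboolP[k kd kp] dmin; exists d; split.
  move=> l ld; apply/eqP/negPn/negP => lp.
  by have /dmin : Q (mdeg l) by [apply/asboolP; exists l]; rewrite leqNgt ld.
by apply: contraNneq kp => /(congr1 (mcoeff k)); rewrite mcoeff_hpart kd eqxx mcoeff0 => ->.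
Qed.

Lemma hpart_sum p N : (msize p <= N)%N -> p = \sum_(d < N) hpart d p.
Proof.
move=> pN; apply/mpolyP => m; rewrite raddf_sum /=.
have [mN|Nm] := ltnP (mdeg m) N.
  rewrite (bigD1 (Ordinal mN)) //= mcoeff_hpart eqxx big1 ?addr0 // => i.
  by rewrite mcoeff_hpart -val_eqE /= eq_sym => /negbTE ->.
rewrite big1 => [|i _].
  by apply: memN_msupp_eq0; apply: msize_mdeg_ge; apply: leq_trans Nm.
by rewrite mcoeff_hpart; case: eqP => // mi; move: Nm; rewrite mi leqNgt ltn_ord.
Qed.

End Order.

Arguments homog_hpart {K n} d p.
Arguments homog_var K {n} i.

(** * Algebraic dependence and the Jacobian criterion *)

Section AlgebraicDependence.
Variable K : idomainType.

Definition deg_le n d (p : mpoly n K) :=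
  forall m : multinom n, (d < mdeg m)%N -> mcoeff m p = 0.

Lemma deg_leM n d e (p q : mpoly n K) :
  deg_le d p -> deg_le e q -> deg_le (d + e) (p * q).
Proof.
move=> lp lq m md; rewrite mcoeffM big1 // => -[k l] /= /eqP mE.
have [/lp ->|dk] := ltnP d (mdeg k); first by rewrite mul0r.
rewrite [mcoeff l q]lq ?mulr0 //.
by have := congr1 (@mdeg n) mE; rewrite mdegD; lia.
Qed.

Lemma deg_leC n c : deg_le 0 (mpolyC n c : mpoly n K).
Proof. by move=> m m0; rewrite mcoeffC -mdeg_eq0 gtn_eqF // mulr0. Qed.

Lemma deg_le1 n : deg_le 0 (1 : mpoly n K).
Proof. by rewrite -mpolyC1; apply: deg_leC. Qed.

Lemma deg_le_exp n d (p : mpoly n K) k : deg_le d p -> deg_le (k * d) (p ^+ k).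
Proof.
move=> lp; elim: k => [|k IH]; first exact: deg_le1.
by rewrite exprS mulSn; apply: deg_leM.
Qed.

Lemma deg_le_prod n (I : Type) (r : seq I) (F : I -> mpoly n K) (d : I -> nat) :
  (forall i, deg_le (d i) (F i)) ->
  deg_le (\sum_(i <- r) d i)%N (\prod_(i <- r) F i).
Proof.
move=> hF; apply: (big_ind2 (fun d p => deg_le d p)) => //.
  exact: deg_le1.
by move=> *; apply: deg_leM.
Qed.

Lemma deg_le_msize n (p : mpoly n K) : deg_le (msize p) p.
Proof.
by move=> m pm; apply: memN_msupp_eq0; apply: msize_mdeg_ge; apply: ltnW.
Qed.

Lemma deg_leW n d e (p : mpoly n K) : (d <= e)%N -> deg_le d p -> deg_le e p.
Proof. by move=> de lp m me; apply: lp; apply: leq_ltn_trans me. Qed.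

End AlgebraicDependence.

Section JacobianCriterion.
Variable K : numFieldType.

(* There are N^k monomials in the g_i with exponents below N, and they lie in
   a space of dimension O(N^n). *)
Lemma algebraic_relation n k (g : 'I_k -> mpoly n K) :
  (n < k)%N -> exists2 G : mpoly k K, G != 0 & msubst g G = 0.
Proof.
move=> nk.
pose D := \max_(i < k) msize (g i).
(* [N] exceeds [(k * D).+1 ^ n], so that the number of columns is at most (N (kD + 1))^n < N^(n+1)
   <= N^k, the number of rows. *)
pose N := ((k * D).+1 ^ n).+1.
pose Q := (k * (N * D)).+1.
pose row := {ffun 'I_k -> 'I_N}; pose col := {ffun 'I_n -> 'I_Q}.
pose rmon (r : row) : multinom k := Multinom [tuple (r i : nat) | i < k].
pose cmon (c : col) : multinom n := Multinom [tuple (c i : nat) | i < n].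
have rmonE r i : rmon r i = r i by rewrite /rmon mnmE.
have cmonE r i : cmon r i = r i by rewrite /cmon mnmE.
pose gp (r : row) := \prod_i g i ^+ r i.
have gpdeg r : deg_le (k * (N * D)) (gp r).
  have -> : (k * (N * D) = \sum_(i < k) N * D)%N by rewrite sum_nat_const card_ord.
  apply: deg_le_prod => i; apply: (@deg_leW _ _ (r i * D)).
    by rewrite leq_mul2r ltnW ?orbT.
  apply: deg_le_exp; apply: deg_leW (@deg_le_msize _ _ _).
  exact: (leq_bigmax i).
pose M : 'M[K]_(#|row|, #|col|) :=
  \matrix_(r, c) mcoeff (cmon (enum_val c)) (gp (enum_val r)).
have lt_card : (#|col| < #|row|)%N.
  rewrite !card_ffun !card_ord.
  have QN : (Q <= N * (k * D).+1)%N by rewrite /Q; nia.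
  apply: leq_ltn_trans (_ : N ^ n * (k * D).+1 ^ n < _)%N.
    by rewrite -expnMn; case: (n) => [|n']; rewrite ?expn0 // leq_exp2r.
  apply: leq_trans (_ : N ^ n.+1 <= _)%N; last by rewrite leq_pexp2l.
  by rewrite expnSr ltn_pmul2l ?expn_gt0.
have : (0 < \rank (kermx M))%N.
  by rewrite mxrank_ker subn_gt0; apply: leq_ltn_trans (rank_leq_col M) lt_card.
rewrite lt0n mxrank_eq0 => /rowV0Pn[v /sub_kermxP vM v0].
pose G : mpoly k K := \sum_r v 0 r *: mpolyX K (rmon (enum_val r)).
exists G.
  apply: contraNneq v0 => G0; apply/eqP/rowP => r; rewrite mxE.
  have := congr1 (mcoeff (rmon (enum_val r))) G0.
  rewrite mcoeff0 raddf_sum /= (bigD1 r) //= mcoeffZ mcoeffX eqxx mulr1.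
  rewrite big1 ?addr0 // => s sr; rewrite mcoeffZ mcoeffX.
  case: eqP => [rs|]; last by rewrite mulr0.
  case/eqP: sr; apply: enum_val_inj; apply/ffunP => i; apply: val_inj.
  by rewrite /= -!rmonE rs.
have GE : msubst g G = \sum_r v 0 r *: gp (enum_val r).
  rewrite /G raddf_sum /=; apply: eq_bigr => r _; rewrite msubstZ msubstX.
  by congr (_ *: _); apply: eq_bigr => i _; rewrite rmonE.
rewrite GE; apply/mpolyP => m; rewrite mcoeff0 raddf_sum /=.
have [mQ|Qm] := ltnP (mdeg m) Q; last first.
  by rewrite big1 // => r _; rewrite mcoeffZ gpdeg ?mulr0.
have mi i : (m i < Q)%N.
  apply: leq_ltn_trans mQ; rewrite mdegE (bigD1 i) //=; exact: leq_addr.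
pose c : col := [ffun i => Ordinal (mi i)].
have cE : cmon c = m by apply/mnmP => i; rewrite cmonE ffunE.
move/rowP/(_ (enum_rank c)): vM; rewrite !mxE => vM0; rewrite -[RHS]vM0.
by apply: eq_bigr => r _; rewrite mcoeffZ mxE enum_rankK cE.
Qed.

Lemma msize_deriv n i (p : mpoly n K) : mderiv i p != 0 ->
  (msize (mderiv i p) < msize p)%N.
Proof.
move=> dp0; rewrite -mlead_deg //.
have := mlead_supp dp0; rewrite mcoeff_msupp mcoeff_deriv => lp.
have : mnm_add (mlead (mderiv i p)) (mnm1 i) \in msupp p.
  by rewrite mcoeff_msupp; apply: contraNneq lp => ->; rewrite mul0rn.
by move/msize_mdeg_lt; rewrite mdegD mdeg1 addn1.
Qed.

Definition jac n (f : 'I_n -> mpoly n K) : 'M[mpoly n K]_n :=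
  \matrix_(i, j) mderiv j (f i).

(** Characteristic 0 enters here: the factor [m i] produced by the derivative can be cancelled. *)
Lemma mderiv_eq0_coeff n i (p : mpoly n K) (m : multinom n) :
  mderiv i p = 0 -> m i != 0%N -> mcoeff m p = 0.
Proof.
move=> dp mi; have := congr1 (mcoeff (mnm_sub m (mnm1 i))) dp.
rewrite mcoeff_deriv mcoeff0 submK; last by rewrite lep1mP.
by move/eqP; rewrite mulrn_eq0 /= => /eqP.
Qed.

(* Differentiating a relation of minimal degree between z_j and f expresses a
   nonzero multiple of the j-th unit vector through the gradients of f. *)
Lemma jacobian_criterion n (f : 'I_n -> mpoly n K) :
  \det (jac f) = 0 -> exists2 G : mpoly n K, G != 0 & msubst f G = 0.
Proof.
move=> det0; have [//|indep] := pselect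
  (exists2 G : mpoly n K, G != 0 & msubst f G = 0).
have fK (G : mpoly n K) : msubst f G = 0 -> G = 0.
  by move=> fG; apply/eqP/negPn/negP => G0; apply: indep; exists G.
(* Such combinations for all [j] form a matrix whose product with [jac f] is diagonal with nonzero
   entries, which [\det (jac f) = 0] forbids. *)
suff ex j : exists ca : mpoly n K * ('I_n -> mpoly n K), ca.1 != 0 /\
    forall k, ca.1 * (j == k)%:R = \sum_i ca.2 i * mderiv k (f i).
  have /choice[ca caP] := ex.
  pose A : 'M[mpoly n K]_n := \matrix_(j, i) (ca j).2 i.
  have : A *m jac f = diag_mx (\row_j (ca j).1).
    apply/matrixP => j k; rewrite !mxE -mulr_natr.
    have [_ ->] := caP j.
    by apply: eq_bigr => i _; rewrite !mxE.
  move/(congr1 determinant); rewrite det_mulmx det0 mulr0 det_diag => /esym/eqP.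
  rewrite prodf_seq_eq0 => /hasP[j _ /=]; rewrite mxE => /eqP ca0.
  by have [] := caP j; rewrite ca0 eqxx.
pose g (i : 'I_n.+1) := if unlift ord0 i is Some i' then f i' else var K j.
have g0 : g ord0 = var K j by rewrite /g unlift_none.
have gS i : g (lift ord0 i) = f i by rewrite /g liftK.
pose Q d := `[< exists2 H : mpoly n.+1 K, H != 0 /\ msubst g H = 0 & msize H = d >].
have exQ : exists d, Q d.
  have [H H0 gH] := algebraic_relation g (ltnSn n).
  by exists (msize H); apply/asboolP; exists H.
case: (ex_minnP exQ) => d /asboolP[H [H0 gH] Hd] dmin.
exists (msubst g (mderiv ord0 H), fun i => - msubst g (mderiv (lift ord0 i) H)).
split=> /= [|k].
  apply/eqP => gdH.
  (* As the size of [H] is minimal, its derivative in the slot of z_j can be a relation only if it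
     is 0. Then [H] does not involve z_j, and [drop0] turns it into a relation between the [f i]
     alone. *)
  have dH : mderiv ord0 H = 0.
    apply/eqP/negPn/negP => dH0; have := msize_deriv dH0.
    rewrite Hd ltnNge dmin //; apply/asboolP; exists (mderiv ord0 H) => //.
  pose drop0 (i : 'I_n.+1) := if unlift ord0 i is Some i' then var K i' else 0.
  have HE : msubst (fun i => var K (lift ord0 i)) (msubst drop0 H) = H.
    rewrite msubst_comp [in RHS](mpolyE H) [in LHS](mpolyE H) raddf_sum /=.
    apply: eq_big_seq => m mH; rewrite msubstZ msubstX; congr (_ *: _).
    have m0 : m ord0 = 0%N.
      apply/eqP/negPn/negP => /(mderiv_eq0_coeff dH) Hm.
      by move: mH; rewrite mcoeff_msupp Hm eqxx.
    rewrite mpolyX_prod_var !big_ord_recl m0 !expr0 !mul1r.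
    by apply: eq_bigr => i _; rewrite /drop0 liftK msubst_var.
  have : msubst f (msubst drop0 H) = 0.
    rewrite -gH -[in RHS]HE msubst_comp; apply: eq_msubst => i.
    by rewrite msubst_var gS.
  by move/fK => drop_H; move: H0; rewrite -HE drop_H rmorph0 eqxx.
have := congr1 (mderiv k) gH; rewrite mderiv_msubst mderiv0 big_ord_recl g0.
rewrite mderiv_var => /eqP; rewrite addr_eq0 => /eqP ->.
by rewrite -sumrN; apply: eq_bigr => i _; rewrite gS mulNr.
Qed.

(** * Weighted homogeneous relations *)

Section Weights.
Variables (n : nat) (d : 'I_n -> nat).

Definition weight (m : multinom n) := (\sum_i m i * d i)%N.

Definition whomog w (p : mpoly n K) :=
  forall m, weight m != w -> mcoeff m p = 0.

Lemma weightD m1 m2 : weight (mnm_add m1 m2) = (weight m1 + weight m2)%N.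
Proof.
by rewrite -big_split; apply: eq_bigr => i _; rewrite mnmDE mulnDl.
Qed.

Lemma weight1 i : weight (mnm1 i) = d i.
Proof.
rewrite /weight (bigD1 i) //= mnm1E eqxx mul1n big1 ?addn0 // => j ji.
by rewrite mnm1E eq_sym (negbTE ji).
Qed.

Lemma whomog_supp w p m : whomog w p -> m \in msupp p -> weight m = w.
Proof.
rewrite mcoeff_msupp => hp; apply: contraNeq => mw.
by apply/eqP; apply: hp; exact: mw.
Qed.

Lemma init_msubst w (f p : 'I_n -> mpoly n K) G :
  (forall i, init (d i) (f i) (p i)) -> whomog w G ->
  init w (msubst f G) (msubst p G).
Proof.
move=> ifp wG; rewrite (mpolyE G) !raddf_sum /= !big_seq.
apply: init_sum => m mG; rewrite !msubstZ; apply: initZ.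
rewrite -(whomog_supp wG mG) !msubstX.
by apply: init_prod => i _; rewrite mulnC; apply: init_exp.
Qed.

(** As each [f i] is homogeneous of degree [d i], the weighted homogeneous components of a relation
    are again relations. One of minimal weight is chosen: its nonzero partial derivatives have
    smaller weight, hence are not relations. The nonvanishing of [msubst f (mderiv i G)] keeps the
    Jacobian determinant nonzero when G(P) replaces one of the P_i. *)
Lemma minimal_weighted_relation (f : 'I_n -> mpoly n K) :
  (forall i, (0 < d i)%N) -> (forall i, homog (d i) (f i)) ->
  (exists2 G : mpoly n K, G != 0 & msubst f G = 0) ->
  exists (G : mpoly n K) (w : nat) (i : 'I_n),
    [/\ whomog w G, msubst f G = 0, (d i <= w)%N, whomog (w - d i)%N (mderiv i G)
      & msubst f (mderiv i G) != 0].
Proof.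
move=> d_gt0 hf [G0 G00 fG0].
pose Q w := `[< exists2 G : mpoly n K, G != 0 /\ whomog w G & msubst f G = 0 >].
have exQ : exists w, Q w.
  pose w := weight (mlead G0); exists w; apply/asboolP.
  pose part w (G : mpoly n K) : mpoly n K :=
    \sum_(m <- msupp G | weight m == w) mcoeff m G *: mpolyX K m.
  have coef_part m : mcoeff m (part w G0) = if weight m == w then mcoeff m G0 else 0.
    rewrite raddf_sum /=; have [mw|mw] := eqVneq; last first.
      rewrite big1 // => k kw; rewrite mcoeffZ mcoeffX.
      by case: eqP => [km|]; [move: mw; rewrite -km kw|rewrite mulr0].
    have [mp|/memN_msupp_eq0 p0] := boolP (m \in msupp G0).
      rewrite big_mkcond (bigD1_seq m) ?msupp_uniq //= mw eqxx.
      rewrite mcoeffZ mcoeffX eqxx mulr1 big1 ?addr0 // => k km.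
      by case: ifP => // _; rewrite mcoeffZ mcoeffX (negbTE km) mulr0.
    rewrite p0 big1_seq // => k /andP[_ kp].
    rewrite mcoeffZ mcoeffX; case: eqP => [km|]; last by rewrite mulr0.
    by rewrite km p0 mul0r.
  exists (part w G0); first split.
  - apply: contraNneq G00 => /(congr1 (mcoeff (mlead G0))).
    by rewrite coef_part eqxx mcoeff0 => /eqP; rewrite mleadc_eq0.
  - by move=> m mw; rewrite coef_part (negbTE mw).
  (* Substituting the forms [f] sends the component of weight [w] to the part of degree [w]. *)
  transitivity (hpart w (msubst f G0)); last by rewrite fG0 raddf0.
  have hprod m : homog (weight m) (\prod_i f i ^+ m i).
    by apply: homog_prod => i _; rewrite mulnC; apply: homog_exp.
  have fG0E : msubst f G0 = \sum_(m <- msupp G0) mcoeff m G0 *: \prod_i f i ^+ m i.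
    rewrite [in LHS](mpolyE G0) raddf_sum /=.
    by apply: eq_bigr => m _; rewrite msubstZ msubstX.
  rewrite fG0E /part !raddf_sum /= big_mkcond /=; apply: eq_bigr => m _.
  rewrite msubstZ msubstX linearZ /=; have [<-|mw] := eqVneq (weight m) w.
    by rewrite hpart_homog.
  by rewrite (hpart_homog_neq (hprod m)) // scaler0.
case: (ex_minnP exQ) => w /asboolP[G [nzG wG] fG] wmin.
(* If all derivatives vanish, the polynomial is a constant, and a nonzero constant is not a
   relation. *)
have [i dG0] : exists i, mderiv i G != 0.
  apply: contrapT => dG.
  have {}dG i : mderiv i G = 0.
    by apply/eqP/negPn/negP => ?; apply: dG; exists i.
  have GC : G = mpolyC n (mcoeff (mnm0) G).
    apply/mpolyP => m; rewrite mcoeffC; case: eqP => [->|m0].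
      by rewrite mulr1.
    have [i mi] : exists i, m i != 0%N.
      apply: contrapT => m_0; apply: m0; apply/mnmP => i; rewrite mnm0E.
      by apply/eqP/negPn/negP => ?; apply: m_0; exists i.
    by rewrite mulr0 (mderiv_eq0_coeff (dG i)).
  move: fG; rewrite GC msubstC => /eqP; rewrite mpolyC_eq0 => /eqP G_0.
  by move: nzG; rewrite GC G_0 mpolyC0 eqxx.
have [diw wdG] : (d i <= w)%N /\ whomog (w - d i)%N (mderiv i G).
  have wE m : mcoeff m (mderiv i G) != 0 -> (weight m + d i)%N = w.
    rewrite mcoeff_deriv => Gm; rewrite -(weight1 i) -weightD.
    apply: (whomog_supp wG); rewrite mcoeff_msupp.
    by apply: contraNneq Gm => ->; rewrite mul0rn.
  split.
    have := mlead_supp dG0; rewrite mcoeff_msupp => /wE <-; exact: leq_addl.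
  by move=> m; apply: contraNeq => /wE <-; rewrite addnK.
exists G, w, i; split => //.
apply/negP => /eqP fdG.
have : (w <= w - d i)%N by apply: wmin; apply/asboolP; exists (mderiv i G).
by have := d_gt0 i; lia.
Qed.

End Weights.

End JacobianCriterion.

(** * Initial forms with nonvanishing Jacobian *)

Section InitialForms.
Variables (K : numFieldType) (n : nat).

Lemma init_det_jac (e : 'I_n -> nat) (f p : 'I_n -> mpoly n K) :
  (forall i, init (e i).+1 (f i) (p i)) ->
  init (\sum_i e i)%N (\det (jac f)) (\det (jac p)).
Proof.
move=> ifp; rewrite /determinant; apply: init_sum => s _.
rewrite -[X in init X]add0n; apply: initM.
  apply: init_homog; rewrite -[X in homog X](mul0n (perm.odd_perm s)).
  by apply: homog_exp; apply: homogN; apply: homog1.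
by apply: init_prod => i _; rewrite !mxE; apply: init_deriv.
Qed.

Lemma low_det_jac i0 k (p : 'I_n -> mpoly n K) :
  low k.+1 (p i0) -> low k (\det (jac p)).
Proof.
move=> lp; rewrite (expand_det_row _ i0); apply: low_sum => j _.
by apply: lowMr; rewrite mxE; apply: low_deriv.
Qed.

Definition replace (p : 'I_n -> mpoly n K) i0 q :=
  fun i => if i == i0 then q else p i.

(** By the chain rule the new row is the combination of the rows of [jac p] with coefficients
    [msubst p (mderiv k G)]. The rows with [k] different from [i0] already occur elsewhere in the
    matrix and contribute nothing. *)
Lemma det_jac_replace (p : 'I_n -> mpoly n K) i0 G :
  \det (jac (replace p i0 (msubst p G))) =
  msubst p (mderiv i0 G) * \det (jac p).
Proof.
rewrite (expand_det_row _ i0).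
have cofE j : cofactor (jac (replace p i0 (msubst p G))) i0 j
    = cofactor (jac p) i0 j.
  rewrite /cofactor; congr (_ * \det _); apply/matrixP => x y.
  by rewrite !mxE /replace eq_sym (negbTE (neq_lift _ _)).
under eq_bigr => j _ do
  rewrite cofE mxE /replace eqxx mderiv_msubst mulr_suml.
rewrite exchange_big /= (bigD1 i0) //= [X in _ + X]big1 ?addr0 => [|k ki0].
  rewrite (expand_det_row _ i0) mulr_sumr; apply: eq_bigr => j _.
  rewrite mxE -mulrA; reflexivity.
have /matrixP/(_ k i0) := mul_mx_adj (jac p); rewrite !mxE (negbTE ki0) mulr0n.
move=> adj0; transitivity (msubst p (mderiv k G) * 0); last by rewrite mulr0.
rewrite -[in RHS]adj0 mulr_sumr; apply: eq_bigr => j _.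
rewrite !mxE -mulrA; reflexivity.
Qed.

(** [q] plays the part of the truncations of a power series: a bound [D] on their order forces a
    common lowest part from some index on. *)
Lemma stable_order (q : nat -> mpoly n K) N0 D :
  (forall N M, (N <= M)%N -> low N.+1 (q M - q N)) ->
  (forall N, (N0 <= N)%N -> ~ low D.+1 (q N)) ->
  exists d f N1, [/\ f != 0, (d <= D)%N &
    forall N, (N1 <= N)%N -> init d f (q N)].
Proof.
(* Beyond [D] all terms of [q] agree in the degrees up to [D], and the order [d] is one of these. *)
move=> compat qD; pose N1 := maxn N0 D.
have qN1 : ~ low D.+1 (q N1) by apply: qD; rewrite leq_maxl.
have /init_exists[d [ld fd]] : q N1 != 0.
  by apply/eqP => q0; apply: qN1; rewrite q0; apply: low0.
have dD : (d <= D)%N.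
  by rewrite leqNgt; apply/negP => /lowW/(_ ld); apply: qN1.
exists d, (hpart d (q N1)), N1; split=> // N N1N.
rewrite -[q N](subrKC (q N1)) -[hpart _ _]addr0; apply: initD.
  exact: init_hpart.
apply: low_init0; apply: lowW (compat _ _ N1N).
by rewrite ltnS (leq_trans dD) // leq_maxr.
Qed.

Variable a : nat -> 'I_n -> mpoly n K.
Hypothesis compat :
  forall N M i, (N <= M)%N -> low N.+1 (a M i - a N i).

Let compat_msubst P N M : (N <= M)%N ->
  low N.+1 (msubst (a M) P - msubst (a N) P).
Proof. by move=> NM; apply: low_msubst_congr => i; apply: compat. Qed.

(* Each replacement of P_i0 by a relation G between the initial forms lowers
   ord det Jac (P o a) - sum_i e_i, which is never negative. *)
Lemma independent_initial_forms_descent (mu : nat) (P : 'I_n -> mpoly n K)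
    (e : 'I_n -> nat) (f : 'I_n -> mpoly n K) (E N0 : nat) :
  (forall N, (N0 <= N)%N -> forall i, init (e i).+1 (f i) (msubst (a N) (P i))) ->
  (forall N, (N0 <= N)%N -> exists2 g, g != 0 &
     init E g (\det (jac (fun i => msubst (a N) (P i))))) ->
  (E <= mu + \sum_i e i)%N ->
  exists P' e' f' N1,
    [/\ forall N, (N1 <= N)%N -> forall i,
          init (e' i).+1 (f' i) (msubst (a N) (P' i))
      & \det (jac f') != 0].
Proof.
elim: mu P e f E N0 => [|mu IH] P e f E N0 initP detP Emu.
all: have [det0|detN0] := eqVneq (\det (jac f)) 0;
     last by exists P, e, f, N0.
(* If the determinant of the initial forms vanishes, the determinant of the full Jacobian starts in
   a degree larger than the expected one. *)
all: have eE : (\sum_i e i < E)%N by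
  have [g g0 ig] := detP _ (leqnn N0);
  have := init_det_jac (initP _ (leqnn N0)); rewrite det0 => /init0_low;
  apply: init_le_low ig.
  by move: Emu; rewrite add0n leqNgt eE.
have hf i : homog (e i).+1 (f i) by have [] := initP _ (leqnn N0) i.
have [G [w [i0 [wG fG dw wdG fdG]]]] :=
  minimal_weighted_relation (fun i => ltn0Sn (e i)) hf (jacobian_criterion det0).
pose q N := msubst (fun i => msubst (a N) (P i)) G.
pose P' := replace P i0 (msubst P G).
have P'E N i : msubst (a N) (P' i) =
    replace (fun i => msubst (a N) (P i)) i0 (q N) i.
  by rewrite /P' /replace; case: eqP => _; [exact: msubst_comp | reflexivity].
(* The factor [msubst f (mderiv i0 G)] that comes from [det_jac_replace] has degree [w - (e i0).+1],
   so the new determinant has order exactly [E']. *)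
pose E' := ((w - (e i0).+1) + E)%N.
have detP' N : (N0 <= N)%N -> exists2 g, g != 0 &
    init E' g (\det (jac (fun i => msubst (a N) (P' i)))).
  move=> N0N; have [g g0 ig] := detP _ N0N.
  exists (msubst f (mderiv i0 G) * g); first by rewrite mulf_neq0.
  rewrite (_ : jac _ = jac (replace (fun i => msubst (a N) (P i)) i0 (q N))).
    rewrite det_jac_replace; apply: initM => //.
    by apply: (@init_msubst _ _ (fun i => (e i).+1)) => // i; apply: initP.
  by congr (jac _); apply/funext => i; rewrite P'E.
have lowq N : (N0 <= N)%N -> low w.+1 (q N).
  move=> /initP /(@init_msubst _ _ (fun i => (e i).+1))/(_ wG).
  by rewrite fG => /init0_low.
(* The order of [q] is finite: a row of derivatives of order above [E'] would push the determinant
   beyond its order [E']. *)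
have [d [h [N1 [h0 dD initq]]]] : exists d h N1, [/\ h != 0, (d <= E'.+1)%N &
    forall N, (N1 <= N)%N -> init d h (q N)].
  apply: (@stable_order _ N0) => [N M NM|N N0N lq].
    by rewrite /q -!msubst_comp; apply: compat_msubst.
  have [g g0 ig] := detP' _ N0N.
  suff : low E'.+1 (\det (jac (fun i => msubst (a N) (P' i)))).
    by move/(init_le_low g0 ig); rewrite ltnn.
  by apply: (@low_det_jac i0); rewrite P'E /replace eqxx.
have wd : (w < d)%N.
  apply: (init_le_low h0 (initq (maxn N0 N1) (leq_maxr _ _))).
  by apply: lowq; exact: leq_maxl.
apply: (IH P' (fun i => if i == i0 then d.-1 else e i) (replace f i0 h)
          E' (maxn N0 N1)) => [N|N|].
- rewrite geq_max => /andP[N0N N1N] i; rewrite P'E /replace.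
  case: eqP => _; last exact: initP.
  by rewrite prednK ?(leq_ltn_trans _ wd) //; apply: initq.
- by rewrite geq_max => /andP[N0N _]; apply: detP'.
(* The gap drops by [d - w], which is positive: the order grows by [w - (e i0).+1] and the sum of
   the exponents by [d.-1 - e i0]. *)
rewrite (bigD1 i0) //= eqxx (eq_bigr e) => [|i /negbTE -> //].
move: Emu; rewrite (bigD1 i0) //= /E'; lia.
Qed.

Lemma independent_initial_forms :
  (exists E N0, forall N, (N0 <= N)%N ->
     exists2 g, g != 0 & init E g (\det (jac (a N)))) ->
  exists P e f N1,
    [/\ forall N, (N1 <= N)%N -> forall i,
          init (e i).+1 (f i) (msubst (a N) (P i))
      & \det (jac f) != 0].
Proof.
move=> [E [N0 detE]].
(* Removing the constant terms gives every component positive order, as the degrees [(e i).+1]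
   require, and leaves the Jacobian matrix unchanged. *)
pose P i := var K i - mpolyC n (mcoeff mnm0 (a 0 i)).
have PE N i : msubst (a N) (P i) = a N i - mpolyC n (mcoeff mnm0 (a 0 i)).
  by rewrite rmorphB /= msubst_var msubstC.
have jacE N : jac (fun i => msubst (a N) (P i)) = jac (a N).
  by apply/matrixP => i j; rewrite !mxE PE mderivB mderivC subr0.
have low1 N i : low 1 (msubst (a N) (P i)).
  move=> m; rewrite ltnS leqn0 mdeg_eq0 => /eqP ->.
  rewrite PE mcoeffB mcoeffC eqxx mulr1 -mcoeffB.
  by apply: (compat i (leq0n N)); rewrite mdeg0.
have ex i : exists dfN : nat * mpoly n K * nat, [/\ dfN.1.2 != 0 &
    forall N, (dfN.2 <= N)%N -> init dfN.1.1.+1 dfN.1.2 (msubst (a N) (P i))].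
  have [d [f [N1 [f0 _ initf]]]] : exists d f N1, [/\ f != 0, (d <= E.+1)%N &
      forall N, (N1 <= N)%N -> init d f (msubst (a N) (P i))].
    apply: (@stable_order _ N0) => [N M|N N0N lP]; first exact: compat_msubst.
    have [g g0 ig] := detE _ N0N.
    have := @low_det_jac i E.+1 (fun i => msubst (a N) (P i)) lP.
    by rewrite jacE => /(init_le_low g0 ig); rewrite ltnn.
  have d_gt0 : (0 < d)%N by apply: (init_le_low f0 (initf _ (leqnn N1))).
  exists (d.-1, f, N1); split=> //= N N1N.
  by rewrite prednK //; apply: initf.
have [dfN dfNP] := choice ex.
pose N1 := maxn N0 (\max_i (dfN i).2).
apply: (@independent_initial_forms_descent E P (fun i => (dfN i).1.1)
  (fun i => (dfN i).1.2) E N1) => [N N1N i|N N1N|]; last exact: leq_addr.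
  have [_] := dfNP i; apply; apply: leq_trans N1N.
  by rewrite leq_max (leq_bigmax i) orbT.
have [|g g0 ig] := detE N; first by apply: leq_trans N1N; exact: leq_maxl.
by exists g; rewrite ?jacE.
Qed.

End InitialForms.

(** * Weighted norms *)

Section WeightedNorm.
Variable R : realType.
Local Notation C := R[i].

Lemma normc_ge0 (x : C) : 0 <= normc x.
Proof. by case: x => a b; exact: sqrtr_ge0. Qed.

Lemma ler_normcD (x y : C) : normc (x + y) <= normc x + normc y.
Proof. exact: le_normcD. Qed.

Lemma normcNE (x : C) : normc (- x) = normc x.
Proof. exact: normcN. Qed.

Lemma ler_normc_sum (I : Type) (s : seq I) (P : pred I) (F : I -> C) :
  normc (\sum_(i <- s | P i) F i) <= \sum_(i <- s | P i) normc (F i).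
Proof.
apply: (big_ind2 (fun x y => normc x <= y)) => //.
  by rewrite ComplexField.Normc.normc0.
by move=> x1 x2 y1 y2 h1 h2; apply: le_trans (ler_normcD _ _) (lerD _ _).
Qed.

Lemma normcX (x : C) k : normc (x ^+ k) = normc x ^+ k.
Proof.
elim: k => [|k IH]; first by rewrite !expr0 ComplexField.Normc.normc1.
by rewrite !exprS ComplexField.Normc.normcM IH.
Qed.

Lemma normc_prod (I : Type) (s : seq I) (P : pred I) (F : I -> C) :
  normc (\prod_(i <- s | P i) F i) = \prod_(i <- s | P i) normc (F i).
Proof.
apply: (big_ind2 (fun x y => normc x = y)) => //.
  exact: ComplexField.Normc.normc1.
by move=> x1 x2 y1 y2 h1 h2; rewrite ComplexField.Normc.normcM h1 h2.
Qed.

Variable n : nat.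
Implicit Types (r : 'I_n -> R) (p q : mpoly n C).

Definition rmon r (m : multinom n) : R := \prod_i r i ^+ m i.

Lemma rmon_ge0 r m : (forall i, 0 <= r i) -> 0 <= rmon r m.
Proof. by move=> r0; apply: prodr_ge0 => i _; apply: exprn_ge0. Qed.

Lemma rmon_gt0 r m : (forall i, 0 < r i) -> 0 < rmon r m.
Proof. by move=> r0; apply: prodr_gt0 => i _; apply: exprn_gt0. Qed.

Lemma rmonD r m1 m2 : rmon r (mnm_add m1 m2) = rmon r m1 * rmon r m2.
Proof.
by rewrite /rmon -big_split; apply: eq_bigr => i _; rewrite mnmDE exprD.
Qed.

Lemma ler_rmon r r' m : (forall i, 0 <= r i <= r' i) -> rmon r m <= rmon r' m.
Proof.
move=> rr'; apply: ler_prod => i _; have /andP[ri ri'] := rr' i.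
by rewrite exprn_ge0 //= lerXn2r // nnegrE // (le_trans ri).
Qed.

Lemma rmonZ r t m : rmon (fun i => t * r i) m = t ^+ mdeg m * rmon r m.
Proof.
rewrite /rmon mdegE -prodrXr -big_split.
by apply: eq_bigr => i _; rewrite exprMn.
Qed.

(** An l^1 norm of the coefficients at polyradius [r] instead of a supremum: it is
    submultiplicative, dominates the values on the polydisc, and is additive over disjoint sets of
    monomials. *)
Definition wnorm r p : R :=
  \sum_(m <- msupp p) normc (mcoeff m p) * rmon r m.

Lemma wnormE N r p : (msize p <= N)%N ->
  wnorm r p = \sum_(m : bmultinom n N) normc (mcoeff m p) * rmon r m.
Proof.
pose I : subFinType _ := bmultinom n N.
move=> pN; rewrite /wnorm (ssrcomplements.big_mksub I) //=; first last.
- by move=> m /msize_mdeg_lt /leq_trans; apply.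
- by rewrite msupp_uniq.
rewrite big_rmcond //= => m /memN_msupp_eq0 ->.
by rewrite ComplexField.Normc.normc0 mul0r.
Qed.

Variable r : 'I_n -> R.
Hypothesis r_ge0 : forall i, 0 <= r i.

Lemma wnorm_ge0 p : 0 <= wnorm r p.
Proof.
apply: sumr_ge0 => m _; apply: mulr_ge0; first exact: normc_ge0.
exact: rmon_ge0.
Qed.

Lemma wnorm0 : wnorm r 0 = 0.
Proof. by rewrite /wnorm msupp0 big_nil. Qed.

Lemma wnormN p : wnorm r (- p) = wnorm r p.
Proof.
rewrite (@wnormE (msize p)) ?msizeN // (@wnormE (msize p) r p) //.
by apply: eq_bigr => m _; rewrite mcoeffN normcNE.
Qed.

Lemma wnormD p q : wnorm r (p + q) <= wnorm r p + wnorm r q.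
Proof.
pose N := maxn (msize p) (msize q).
rewrite (@wnormE N _ (p + q)) ?msizeD_le // (@wnormE N _ p) ?leq_maxl //.
rewrite (@wnormE N _ q) ?leq_maxr // -big_split; apply: ler_sum => m _ /=.
by rewrite mcoeffD -mulrDl ler_wpM2r ?ler_normcD // rmon_ge0.
Qed.

Lemma wnormB p q : wnorm r (p - q) <= wnorm r p + wnorm r q.
Proof. by rewrite -[wnorm r q]wnormN; apply: wnormD. Qed.

Lemma wnorm_sum (I : Type) (s : seq I) (P : pred I) (F : I -> mpoly n C) :
  wnorm r (\sum_(i <- s | P i) F i) <= \sum_(i <- s | P i) wnorm r (F i).
Proof.
apply: (big_ind2 (fun x y => wnorm r x <= y)) => //; first by rewrite wnorm0.
by move=> x1 x2 y1 y2 h1 h2; apply: le_trans (wnormD _ _) (lerD h1 h2).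
Qed.

Lemma wnormZ c p : wnorm r (c *: p) = normc c * wnorm r p.
Proof.
rewrite (@wnormE (msize p)) ?msizeZ_le // (@wnormE (msize p) r p) // mulr_sumr.
apply: eq_bigr => m _.
by rewrite mcoeffZ ComplexField.Normc.normcM mulrA.
Qed.

Lemma wnormX m : wnorm r (mpolyX C m) = rmon r m.
Proof.
by rewrite /wnorm msuppX big_seq1 mcoeffX eqxx ComplexField.Normc.normc1 mul1r.
Qed.

Lemma wnorm_var i : wnorm r (var C i) = r i.
Proof.
rewrite wnormX /rmon (bigD1 i) //= mnm1E eqxx expr1 big1 ?mulr1 // => j ji.
by rewrite mnm1E eq_sym (negbTE ji).
Qed.

Lemma wnorm1 : wnorm r 1 = 1.
Proof.
rewrite -(mpolyX0 n C) wnormX /rmon big1 // => i _.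
by rewrite mnm0E.
Qed.

Lemma wnormM p q : wnorm r (p * q) <= wnorm r p * wnorm r q.
Proof.
rewrite mpolyME; apply: le_trans (wnorm_sum _ _ _) _.
rewrite [X in X * _]/wnorm [X in _ * X]/wnorm mulr_suml.
rewrite big_allpairs; apply: ler_sum => k _; rewrite mulr_sumr.
apply: ler_sum => l _ /=.
by rewrite wnormZ wnormX rmonD ComplexField.Normc.normcM mulrACA.
Qed.

Lemma wnorm_exp p k : wnorm r (p ^+ k) <= wnorm r p ^+ k.
Proof.
elim: k => [|k IH]; first by rewrite !expr0 wnorm1.
rewrite !exprS; apply: le_trans (wnormM _ _) _.
by apply: ler_wpM2l => //; apply: wnorm_ge0.
Qed.

Lemma wnorm_prod (I : Type) (s : seq I) (P : pred I) (F : I -> mpoly n C) :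
  wnorm r (\prod_(i <- s | P i) F i) <= \prod_(i <- s | P i) wnorm r (F i).
Proof.
suff [] : wnorm r (\prod_(i <- s | P i) F i) <= \prod_(i <- s | P i) wnorm r (F i)
  /\ 0 <= \prod_(i <- s | P i) wnorm r (F i) by [].
apply: (big_ind2 (fun x y => wnorm r x <= y /\ 0 <= y)).
- by rewrite wnorm1 ler01.
- move=> x1 x2 y1 y2 [h1 p1] [h2 p2]; split; last exact: mulr_ge0.
  apply: le_trans (wnormM _ _) _; apply: ler_pM => //; exact: wnorm_ge0.
- by move=> i _; split => //; exact: wnorm_ge0.
Qed.

Lemma wnorm_hpart d p : wnorm r (hpart d p) <= wnorm r p.
Proof.
pose N := maxn (msize p) (msize (hpart d p)).
rewrite (@wnormE N _ (hpart d p)) ?leq_maxr // (@wnormE N _ p) ?leq_maxl //.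
apply: ler_sum => m _; rewrite mcoeff_hpart; case: ifP => // _.
by rewrite ComplexField.Normc.normc0 mul0r mulr_ge0 ?normc_ge0 ?rmon_ge0.
Qed.

(** Parts of different degrees have disjoint supports. A bound on one polynomial thus controls a sum
    over all stages of the recursion, without a factor [N]. *)
Lemma wnorm_hpart_sum N p :
  \sum_(d < N) wnorm r (hpart d p) <= wnorm r p.
Proof.
pose M := maxn (msize p) (\max_(d < N) msize (hpart d p)).
rewrite (@wnormE M r p) ?leq_maxl //.
under eq_bigr => d _.
  rewrite (@wnormE M); last by rewrite leq_max (leq_bigmax d) orbT.
  over.
rewrite exchange_big /=; apply: ler_sum => m _.
rewrite -mulr_suml ler_wpM2r ?rmon_ge0 //.
have [mN|Nm] := ltnP (mdeg m) N.
  rewrite (bigD1 (Ordinal mN)) //= mcoeff_hpart eqxx big1 ?addr0 // => d.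
  rewrite mcoeff_hpart -val_eqE /= eq_sym => /negbTE ->.
  exact: ComplexField.Normc.normc0.
rewrite big1 ?normc_ge0 // => d _; rewrite mcoeff_hpart.
case: eqP => [md|_]; last exact: ComplexField.Normc.normc0.
by move: Nm; rewrite md leqNgt ltn_ord.
Qed.

Lemma wnorm_homogZ t d p : homog d p ->
  wnorm (fun i => t * r i) p = t ^+ d * wnorm r p.
Proof.
move=> hp; rewrite /wnorm mulr_sumr; apply: eq_big_seq => m.
rewrite mcoeff_msupp => pm.
have -> : d = mdeg m by apply/eqP; apply: contraNT pm => /negP dm; apply/eqP/hp; apply/negP => /eqP md; apply: dm; rewrite md.
by rewrite rmonZ mulrCA.
Qed.

Lemma normc_meval (z : 'I_n -> C) p : (forall i, normc (z i) <= r i) ->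
  normc (meval z p) <= wnorm r p.
Proof.
move=> zr; rewrite mevalE; apply: le_trans (ler_normc_sum _ _ _) _.
apply: ler_sum => m _; rewrite ComplexField.Normc.normcM.
apply: ler_wpM2l; first exact: normc_ge0.
rewrite normc_prod; apply: ler_prod => i _; rewrite normc_ge0 normcX /=.
by rewrite lerXn2r ?nnegrE ?normc_ge0 ?r_ge0.
Qed.

End WeightedNorm.

Section WeightedNormSubst.
Variables (R : realType) (n k : nat).
Local Notation C := R[i].

Lemma ler_wnorm (r r' : 'I_n -> R) (p : mpoly n C) :
  (forall i, 0 <= r i <= r' i) -> wnorm r p <= wnorm r' p.
Proof.
by move=> rr'; apply: ler_sum => m _; rewrite ler_wpM2l ?normc_ge0 ?ler_rmon.
Qed.

(** The coefficientwise counterpart of the Schwarz lemma. *)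
Lemma wnorm_low (r : 'I_n -> R) t d (p : mpoly n C) : (forall i, 0 <= r i) ->
  0 <= t <= 1 -> low d p -> wnorm (fun i => t * r i) p <= t ^+ d * wnorm r p.
Proof.
move=> r0 /andP[t0 t1] lp; rewrite /wnorm mulr_sumr !big_seq.
apply: ler_sum => m; rewrite mcoeff_msupp => pm.
have dm : (d <= mdeg m)%N.
  by rewrite leqNgt; apply: contraNN pm => /lp ->.
rewrite rmonZ mulrCA ler_wpM2r ?mulr_ge0 ?normc_ge0 ?rmon_ge0 //.
exact: ler_wiXn2l.
Qed.

Lemma wnorm_msubst (r : 'I_k -> R) (rho : 'I_n -> R)
    (s : 'I_n -> mpoly k C) (p : mpoly n C) :
  (forall i, 0 <= r i) -> (forall j, wnorm r (s j) <= rho j) ->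
  wnorm r (msubst s p) <= wnorm rho p.
Proof.
move=> r0 srho; rewrite [in msubst s p](mpolyE p) raddf_sum /=.
apply: le_trans (wnorm_sum r0 _ _ _) _; apply: ler_sum => m _.
rewrite msubstZ wnormZ msubstX ler_wpM2l ?normc_ge0 //.
apply: le_trans (wnorm_prod r0 _ _ _) _; apply: ler_prod => j _.
rewrite wnorm_ge0 //=; apply: le_trans (wnorm_exp r0 _ _) _.
rewrite lerXn2r ?nnegrE ?wnorm_ge0 //.
exact: le_trans (wnorm_ge0 r0 _) (srho j).
Qed.

End WeightedNormSubst.

(** * Bounded division by a homogeneous polynomial *)

Section FiniteLinear.
Variables (K : idomainType) (n : nat).

(* Such maps preserve rational dependence of the coefficients on parameters. *)
Definition finlin (F : mpoly n K -> mpoly n K) :=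
  forall m, exists s : seq (K * multinom n), forall q,
    mcoeff m (F q) = \sum_(x <- s) x.1 * mcoeff x.2 q.

Lemma finlin_comp F G : finlin F -> finlin G -> finlin (F \o G).
Proof.
move=> lF lG m; have [s Fs] := lF m; have [t Gt] := choice lG.
exists [seq (x.1 * y.1, y.2) | x <- s, y <- t x.2] => q.
rewrite Fs big_allpairs_dep; apply: eq_bigr => x _.
by rewrite Gt mulr_sumr; apply: eq_bigr => y _; rewrite mulrA.
Qed.

Lemma finlin_id : finlin id.
Proof. by move=> m; exists [:: (1, m)] => q; rewrite big_seq1 mul1r. Qed.

Lemma finlin_scale c F : finlin F -> finlin (fun q => c *: F q).
Proof.
move=> lF m; have [s Fs] := lF m; exists [seq (c * x.1, x.2) | x <- s] => q.
rewrite mcoeffZ Fs mulr_sumr big_map.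
by apply: eq_bigr => x _; rewrite mulrA.
Qed.

Lemma finlinD F G : finlin F -> finlin G -> finlin (fun q => F q + G q).
Proof.
move=> lF lG m; have [s Fs] := lF m; have [t Gt] := lG m.
by exists (s ++ t) => q; rewrite mcoeffD Fs Gt big_cat.
Qed.

Lemma finlin0 : finlin (fun=> 0).
Proof. by move=> m; exists [::] => q; rewrite mcoeff0 big_nil. Qed.

Lemma finlin_sum (I : Type) (r : seq I) (F : I -> mpoly n K -> mpoly n K) :
  (forall i, finlin (F i)) -> finlin (fun q => \sum_(i <- r) F i q).
Proof.
move=> lF; elim: r => [|i r IH].
  by under eq_fun do rewrite big_nil; apply: finlin0.
under eq_fun do rewrite big_cons; apply: finlinD => //.
Qed.

Lemma finlin_iter F k : finlin F -> finlin (iter k F).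
Proof.
move=> lF; elim: k => [|k IH]; first exact: finlin_id.
exact: (finlin_comp lF IH).
Qed.

Lemma finlin_mul p : finlin (fun q => p * q).
Proof.
move=> m; pose I : finType := (bmultinom n (mdeg m).+1 * bmultinom n (mdeg m).+1)%type.
exists (map (fun k : I => (mcoeff k.1 p, bmnm k.2))
  (seq.filter (fun k : I => m == mnm_add k.1 k.2) (index_enum I))).
by move=> q; rewrite mcoeffM big_map big_filter.
Qed.

Lemma finlin_hpart d : finlin (hpart d).
Proof.
move=> m; exists (if mdeg m == d then [:: (1, m)] else [::]) => q.
by rewrite mcoeff_hpart; case: ifP => _; rewrite ?big_seq1 ?mul1r ?big_nil.
Qed.

(** Division by the monomial with exponent [a]; the monomials that it does not divide are
    discarded. *)
Definition shift (a : multinom n) (q : mpoly n K) : mpoly n K :=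
  \sum_(m : bmultinom n (msize q)) mcoeff (mnm_add m a) q *: mpolyX K m.

Lemma mcoeff_shift a q m : mcoeff m (shift a q) = mcoeff (mnm_add m a) q.
Proof.
have [mq|qm] := ltnP (mdeg m) (msize q).
  by rewrite (mcoeff_mpoly (fun m => mcoeff (mnm_add m a) q)).
rewrite raddf_sum /= big1 => [|k _].
  apply/esym/memN_msupp_eq0/msize_mdeg_ge.
  by apply: leq_trans qm _; rewrite mdegD leq_addr.
rewrite mcoeffZ mcoeffX; case: eqP => [km|]; last by rewrite mulr0.
by move: qm; rewrite -km leqNgt bmdeg.
Qed.

Lemma finlin_shift a : finlin (shift a).
Proof.
by move=> m; exists [:: (1, mnm_add m a)] => q; rewrite mcoeff_shift big_seq1 mul1r.
Qed.

Lemma finlin_additive F : finlin F -> forall p q, F (p - q) = F p - F q.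
Proof.
move=> lF p q; apply/mpolyP => m; have [s Fs] := lF m.
rewrite mcoeffB !Fs -sumrB; apply: eq_bigr => x _.
by rewrite mcoeffB mulrBr.
Qed.

End FiniteLinear.

(** Uniqueness of the expansion in base [B]. It makes the weights [B ^ i] separate the monomials
    with exponents below [B], so that a least weight is attained only once. *)
Lemma weight_digits_inj n B (m m' : 'I_n -> nat) :
  (forall i, (m i < B)%N) -> (forall i, (m' i < B)%N) ->
  (\sum_i m i * B ^ i = \sum_i m' i * B ^ i)%N -> m =1 m'.
Proof.
elim: n m m' => [|n IH] m m' mB m'B; first by move=> _ [].
have split (k : 'I_n.+1 -> nat) :
    (\sum_i k i * B ^ i = (\sum_i k (lift ord0 i) * B ^ i) * B + k ord0)%N.
  rewrite big_ord_recl muln1 addnC big_distrl; congr (_ + _)%N.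
  by apply: eq_bigr => i _; rewrite /= -mulnA -expnSr.
rewrite !split => E.
have B0 : (0 < B)%N by apply: leq_ltn_trans (mB ord0).
have E0 : m ord0 = m' ord0.
  by have := congr1 (modn^~ B) E; rewrite !modnMDl !modn_small.
have ES : m \o lift ord0 =1 m' \o lift ord0.
  apply: IH => [i|i|]; [exact: mB|exact: m'B|].
  have := congr1 (divn^~ B) E; rewrite !divnMDl // !divn_small // !addn0; exact.
move=> i; have [j|] := unliftP ord0 i; last by move->.
by move->; apply: ES.
Qed.

Lemma neumann_telescope (V : zmodType) (F : V -> V) (x : V) k :
  (forall x y, F (x - y) = F x - F y) ->
  \sum_(i < k) iter i F (x - F x) = x - iter k F x.
Proof.
move=> FB; have iterB i y z : iter i F (y - z) = iter i F y - iter i F z.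
  by elim: i => //= i ->.
elim: k => [|k IH]; first by rewrite big_ord0 subrr.
by rewrite big_ord_recr /= IH iterB -iterSr addrA subrK.
Qed.

Lemma geometric_iter (R : realType) (T : Type) (N : T -> R) (F : T -> T) k x :
  (forall x, 0 <= N x) -> (forall x, N (F x) <= N x / 2) ->
  \sum_(i < k) N (iter i F x) <= 2 * N x.
Proof.
move=> N0 NF; elim: k x => [|k IH] x; first by rewrite big_ord0 mulr_ge0.
rewrite big_ord_recl /=; under eq_bigr => i _ do rewrite -iterS iterSr.
have := IH (F x); have := NF x; have := N0 x; lra.
Qed.

Section Division.
Variables (R : realType) (n : nat).
Local Notation C := R[i].

Lemma wnorm_mulX (r : 'I_n -> R) (p : mpoly n C) a :
  wnorm r (p * mpolyX C a) = wnorm r p * rmon r a.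
Proof.
rewrite /wnorm (perm_big _ (msuppMX p a)) big_map mulr_suml.
by apply: eq_bigr => m _; rewrite mcoeffMX rmonD mulrCA mulrC.
Qed.

Lemma wnorm_dominated (r : 'I_n -> R) (p q : mpoly n C) :
  (forall i, 0 <= r i) ->
  (forall m, normc (mcoeff m p) <= normc (mcoeff m q)) ->
  wnorm r p <= wnorm r q.
Proof.
move=> r0 pq; pose N := maxn (msize p) (msize q).
rewrite (@wnormE _ _ N r p) ?leq_maxl // (@wnormE _ _ N r q) ?leq_maxr //.
by apply: ler_sum => m _; rewrite ler_wpM2r ?rmon_ge0.
Qed.

Lemma wnorm_shift (r : 'I_n -> R) a (q : mpoly n C) : (forall i, 0 <= r i) ->
  wnorm r (shift a q) * rmon r a <= wnorm r q.
Proof.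
move=> r0; rewrite -wnorm_mulX; apply: wnorm_dominated => // m.
have [am|am] := boolP (lem a m).
  by rewrite -(submK am) addmC mcoeffMX mcoeff_shift addmC.
rewrite memN_msupp_eq0 ?ComplexField.Normc.normc0 ?normc_ge0 //.
rewrite (perm_mem (msuppMX _ _)); apply: contra am => /mapP[k _ ->].
exact: lem_addr.
Qed.

(** At the polyradius eps^theta a monomial has size eps to the power of its weight, so that the
    monomial of least weight dominates when eps is small. The weights are returned as well, since
    they make the Neumann series of the division terminate. *)
Lemma dominant_monomial (D : mpoly n C) : D != 0 ->
  exists (a : multinom n) (theta : 'I_n -> nat) (r : 'I_n -> R),
    [/\ forall i, 0 < r i, mcoeff a D != 0,
        forall b, b \in msupp D -> b != a -> (weight theta a < weight theta b)%N
      & wnorm r (D - mcoeff a D *: mpolyX C a)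
          <= normc (mcoeff a D) * rmon r a / 2].
Proof.
move=> D0; pose B := msize D; pose theta (i : 'I_n) := (B ^ i)%N.
pose Q w := has (fun b => weight theta b == w) (msupp D).
have exQ : exists w, Q w.
  by exists (weight theta (mlead D)); apply/hasP; exists (mlead D); rewrite ?mlead_supp.
case: (ex_minnP exQ) => w /hasP[a aD /eqP aw] wmin.
have a_min b : b \in msupp D -> b != a -> (weight theta a < weight theta b)%N.
  move=> bD; apply: contraNT; rewrite -leqNgt => ba.
  have E : weight theta b = weight theta a.
    apply/eqP; rewrite eqn_leq ba aw; apply: wmin; apply/hasP; by exists b.
  have lt m (mD : m \in msupp D) i : (m i < B)%N.
    apply: leq_ltn_trans (msize_mdeg_lt mD).
    by rewrite mdegE (bigD1 i) //= leq_addr.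
  by apply/eqP/mnmP; apply: (weight_digits_inj (lt b bD) (lt a aD) E).
pose c := normc (mcoeff a D); pose S := \sum_(b <- msupp D) normc (mcoeff b D).
have c0 : 0 < c.
  rewrite lt0r normc_ge0 andbT; move: aD; rewrite mcoeff_msupp.
  by apply: contraNneq => /ComplexField.Normc.eq0_normc ->.
have S0 : 0 <= S by apply: sumr_ge0 => b _; exact: normc_ge0.
(* Every other monomial carries at least one more factor [eps], and [eps * S <= c / 2]. *)
pose eps : R := c / (2 * (c + S)).
have cS : 0 < c + S by apply: ltr_pwDl.
have eps0 : 0 < eps by apply: divr_gt0 => //; apply: mulr_gt0.
have eps1 : eps <= 1.
  by rewrite /eps ler_pdivrMr ?mul1r ?mulr_gt0 //; lra.
pose r (i : 'I_n) := eps ^+ theta i.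
have rmonE m : rmon r m = eps ^+ weight theta m.
  by rewrite /rmon /weight -prodrXr; apply: eq_bigr => i _; rewrite -exprM mulnC.
have r0 i : 0 < r i by apply: exprn_gt0.
exists a, theta, r; split=> //; first by rewrite -mcoeff_msupp.
have -> : D - mcoeff a D *: mpolyX C a =
    \sum_(b <- msupp D | b != a) mcoeff b D *: mpolyX C b.
  rewrite [X in X - _]mpolyE (bigD1_seq a) ?msupp_uniq //=.
  by rewrite addrAC subrr add0r.
apply: le_trans (wnorm_sum (fun i => ltW (r0 i)) _ _ _) _.
apply: le_trans (_ : \sum_(b <- msupp D) normc (mcoeff b D) * (eps * rmon r a) <= _).
  rewrite big_mkcond !big_seq; apply: ler_sum => b bD.
  have e0 : 0 <= normc (mcoeff b D) * (eps * rmon r a).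
    by rewrite mulr_ge0 ?normc_ge0 // mulr_ge0 ?ltW // rmon_gt0.
  case: eqP => //= /eqP ba; rewrite wnormZ wnormX ler_wpM2l ?normc_ge0 //.
  rewrite !rmonE -exprS; apply: ler_wiXn2l => //; first exact: ltW.
  exact: a_min.
rewrite -mulr_suml -/S -/c mulrA [leRHS]mulrAC.
rewrite ler_wpM2r ?(ltW (rmon_gt0 _ r0)) // /eps mulrA ler_pdivrMr ?mulr_gt0 //.
have -> : c / 2 * (2 * (c + S)) = c * c + S * c by field.
by rewrite lerDr mulr_ge0 // ltW.
Qed.

(* T inverts multiplication by D by a Neumann series around the division by a
   monomial that dominates D on the polydisc of radius r; the series is finite
   on homogeneous polynomials, since each term raises a weight. *)
Lemma bounded_division (D : mpoly n C) e : D != 0 -> homog e D ->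
  exists (r : 'I_n -> R) (T : nat -> mpoly n C -> mpoly n C) (M : R),
  [/\ forall i, 0 < r i, 0 < M,
      forall l g, homog l g -> T l (D * g) = g,
      (forall l q, homog l (T l q)) /\ (forall l, finlin (T l))
    & forall l t q, 0 < t -> wnorm (fun i => t * r i) (T l q) <=
        M / t ^+ e * wnorm (fun i => t * r i) q].
Proof.
move=> D0 hD; have [a [theta [r [r0 ca0 amin Dle]]]] := dominant_monomial D0.
pose c := mcoeff a D; pose D' := D - c *: mpolyX C a.
have nc0 : 0 < normc c.
  rewrite lt0r normc_ge0 andbT; apply: contraNneq ca0.
  by move/ComplexField.Normc.eq0_normc => c0; apply/eqP.
have ae : mdeg a = e by apply: contraNeq ca0 => ae; apply/eqP/hD.
(* [base] divides by the dominant monomial and keeps degree [l]. For [g] homogeneous of degree [l],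
   [base l (D * g) = g - F l g], and summing the iterates of [F l] inverts this. *)
pose base l q := c^-1 *: hpart l (shift a q).
pose F l g := - base l (D' * g).
(* One more than the largest possible weight of a monomial of degree [l]. *)
pose wmax l := (l * \sum_i theta i).+1.
pose T l q := \sum_(k < wmax l) iter k (F l) (base l q).
have finlin_base l : finlin (base l).
  apply: finlin_scale; exact: (finlin_comp (@finlin_hpart _ _ l) (@finlin_shift _ _ a)).
have finlin_F l : finlin (F l).
  rewrite (_ : F l = fun q => -1 *: base l (D' * q)).
    apply: finlin_scale; exact: (finlin_comp (finlin_base l) (finlin_mul D')).
  by apply/funext => q; rewrite scaleN1r.
have homog_base l q : homog l (base l q).
  by apply: homogZ; apply: homog_hpart.
have homog_iter l k q : homog l (iter k (F l) (base l q)).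
  case: k => [|k] /=; first exact: homog_base.
  by apply: homogN; apply: homog_base.
exists r, T, (2 / (normc c * rmon r a)); split.
- exact: r0.
- by rewrite divr_gt0 ?mulr_gt0 ?rmon_gt0.
- move=> l g hg.
  have baseE : base l (D * g) = g - F l g.
    rewrite /F opprK -[D](subrK (c *: mpolyX C a)) -/D' mulrDl addrC.
    rewrite -[in LHS](opprK (D' * g)) (finlin_additive (finlin_base l)).
    congr (_ + _).
      apply/mpolyP => m; rewrite mcoeffZ mcoeff_hpart mcoeff_shift.
      have -> : mcoeff (mnm_add m a) (c *: mpolyX C a * g) = c * mcoeff m g.
        by rewrite -scalerAl mcoeffZ mulrC [mpolyX C a * g]mulrC addmC mcoeffMX mulrC.
      by case: ifP => [_|/negbT/hg ->]; rewrite ?mulr0 // mulKf.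
    rewrite -[- (D' * g)]sub0r (finlin_additive (finlin_base l)).
    rewrite (_ : base l 0 = 0) ?sub0r ?opprK //.
    by apply/mpolyP => m; have [s ->] := finlin_base l m;
      rewrite mcoeff0 big1 // => x _; rewrite mcoeff0 mulr0.
  have FB x y : F l (x - y) = F l x - F l y by apply: finlin_additive.
  rewrite /T baseE (neumann_telescope _ _ FB).
  suff -> : iter (wmax l) (F l) g = 0 by rewrite subr0.
  (* All monomials of [D'] have larger weight than [a], so each application of [F l] raises the
     least weight by at least 1. *)
  have high k m : (weight theta m < k)%N -> mcoeff m (iter k (F l) g) = 0.
    elim: k m => // k IH m mk.
    rewrite [iter k.+1 _ _]/= mcoeffN mcoeffZ mcoeff_hpart mcoeff_shift.
    case: ifP => _; last by rewrite mulr0 oppr0.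
    rewrite mcoeffM big1 ?mulr0 ?oppr0 // => -[k1 k2] /= /eqP E.
    have wE : (weight theta m + weight theta a = weight theta k1 + weight theta k2)%N.
      by rewrite -!weightD (congr1 (weight theta) E).
    have [k2k|kk2] := ltnP (weight theta k2) k.
      by rewrite (IH _ k2k) mulr0.
    rewrite [mcoeff k1 D'](_ : _ = 0) ?mul0r // mcoeffB mcoeffZ mcoeffX.
    have [ak1|ak1] := eqVneq a k1; first by rewrite -ak1 mulr1 subrr.
    rewrite mulr0 subr0; apply: memN_msupp_eq0; apply/negP => k1D.
    by have := amin _ k1D; rewrite eq_sym ak1 => /(_ isT); lia.
  apply/mpolyP => m; rewrite mcoeff0.
  have [ml|ml] := eqVneq (mdeg m) l; last first.
    by rewrite /wmax /= mcoeffN mcoeffZ mcoeff_hpart (negbTE ml) mulr0 oppr0.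
  apply: high; rewrite ltnS /weight big_distrr /=; apply: leq_sum => i _.
  by rewrite leq_mul2r -ml mdegE (bigD1 i) //= leq_addr orbT.
- split=> l q; last first.
    by move: q; apply: finlin_sum => k; exact: (finlin_comp (finlin_iter k (finlin_F l)) (finlin_base l)).
  by apply: homog_sum => k _; apply: homog_iter.
- move=> l t q t0; pose rho i := t * r i.
  have rho0 i : 0 < rho i by apply: mulr_gt0.
  have rho0' i : 0 <= rho i by exact: ltW.
  have rhoa : 0 < rmon rho a by exact: rmon_gt0.
  have base_le x : wnorm rho (base l x) <= wnorm rho x / (normc c * rmon rho a).
    rewrite wnormZ ComplexField.Normc.normcV.
    rewrite invfM [leRHS]mulrCA ler_wpM2l ?invr_ge0 ?(ltW nc0) // ler_pdivlMr //.
    apply: le_trans (wnorm_shift a x rho0').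
    by rewrite ler_wpM2r ?(ltW rhoa) // wnorm_hpart.
  (* [D'] and the dominant monomial both scale like t^e, so the domination at [r] persists at
     [t * r] with the same constant. *)
  have D'le : wnorm rho D' <= normc c * rmon rho a / 2.
    have hD' : homog e D'.
      by apply: homogB => //; apply: homogZ; rewrite -ae; apply: homogX.
    rewrite /rho (wnorm_homogZ _ _ hD') rmonZ ae [leRHS](_ : _ = t ^+ e * (normc c * rmon r a / 2)); last by field.
    by rewrite ler_wpM2l // exprn_ge0 // (ltW t0).
  have F_le x : wnorm rho (F l x) <= wnorm rho x / 2.
    rewrite wnormN; apply: le_trans (base_le _) _.
    rewrite ler_pdivrMr ?mulr_gt0 //; apply: le_trans (wnormM rho0' _ _) _.
    rewrite [leRHS](_ : _ = normc c * rmon rho a / 2 * wnorm rho x); last by field.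
    by rewrite ler_wpM2r // wnorm_ge0.
  apply: le_trans (wnorm_sum rho0' _ _ _) _.
  apply: le_trans (geometric_iter _ _ (wnorm_ge0 rho0') F_le) _.
  rewrite [leRHS](_ : _ = 2 * (wnorm rho q / (normc c * rmon rho a))).
    by rewrite ler_wpM2l.
  rewrite /rho rmonZ ae; field; rewrite !lt0r_neq0 ?rmon_gt0 ?exprn_gt0 //.
Qed.

End Division.

(** * The recursion for the formal solution *)

Section Linearization.
Variables (K : numFieldType) (n k : nat).
Variables (S W V : 'I_n -> mpoly n K).
Hypothesis S_init : forall j, init 1 (var K j) (S j).
Hypothesis V_homog : forall j, homog k.+2 (V j).
Hypothesis W_V : forall j, low k.+3 (W j - V j).

Let SW j := S j + W j.
Let dV f := \sum_j mderiv j f * V j.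

(** Only the last clause is wanted. The others are carried along because the error of a product
    involves the factors and their differentials, see [linearize_product]. The index: [dV f] has
    order (d - 1) + (k + 2). *)
Definition linearizes d (f B : mpoly n K) :=
  [/\ init d f (msubst S B), init d f (msubst SW B),
      low (d + k.+1) (dV f) &
      low (d + k.+2) (msubst SW B - msubst S B - dV f)].

Lemma linearize_product (T : comPzRingType) (X Y D f X' Y' D' f' : T) :
  X * X' - Y * Y' - (D * f' + f * D') =
  ((X - Y - D) * X' + D * (X' - f')) + (Y * (X' - Y' - D') + (Y - f) * D').
Proof. ring. Qed.

Lemma linearize_sum (T : comPzRingType) (X Y D X' Y' D' : T) :
  X + X' - (Y + Y') - (D + D') = (X - Y - D) + (X' - Y' - D').
Proof. ring. Qed.

Lemma dVM f g : dV (f * g) = dV f * g + f * dV g.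
Proof.
rewrite /dV mulr_suml mulr_sumr -big_split; apply: eq_bigr => j _ /=.
by rewrite mderivM mulrDl mulrA mulrAC.
Qed.

Lemma dVD f g : dV (f + g) = dV f + dV g.
Proof.
by rewrite /dV -big_split; apply: eq_bigr => j _ /=; rewrite mderivD mulrDl.
Qed.

Lemma linearizesM d d' f f' B B' : linearizes d f B -> linearizes d' f' B' ->
  linearizes (d + d') (f * f') (B * B').
Proof.
move=> [iS iSW lV lE] [iS' iSW' lV' lE'].
have [_ lX'f'] := iSW'; have [_ lYf] := iS.
split; rewrite ?msubstM.
- exact: initM.
- exact: initM.
- rewrite dVM; apply: lowD.
    rewrite addnAC; apply: lowM; first exact: lV.
    by apply: homog_low; case: iS'.
  rewrite -addnA; apply: lowM; last exact: lV'.
  by apply: homog_low; case: iS.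
rewrite dVM linearize_product; apply: lowD; apply: lowD.
- rewrite addnAC; apply: lowM; first exact: lE.
  exact: init_low iSW'.
- rewrite (_ : (d + d' + k.+2 = d + k.+1 + d'.+1)%N); last by lia.
  apply: lowM; [exact: lV | exact: lX'f'].
- rewrite -addnA; apply: lowM; last exact: lE'.
  exact: init_low iS.
- rewrite (_ : (d + d' + k.+2 = d.+1 + (d' + k.+1))%N); last by lia.
  apply: lowM; [exact: lYf | exact: lV'].
Qed.

Lemma linearizesD d f f' B B' : linearizes d f B -> linearizes d f' B' ->
  linearizes d (f + f') (B + B').
Proof.
move=> [iS iSW lV lE] [iS' iSW' lV' lE']; split; rewrite ?msubstD ?dVD.
- exact: initD.
- exact: initD.
- exact: lowD.
- by rewrite linearize_sum; apply: lowD; [exact: lE | exact: lE'].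
Qed.

Lemma linearizesC c : linearizes 0 (mpolyC n c) (mpolyC n c).
Proof.
have dC : dV (mpolyC n c) = 0.
  by rewrite /dV big1 // => j _; rewrite mderivC mul0r.
split; rewrite ?msubstC ?dC ?subrr ?subr0.
- by apply: init_homog; apply: homogC.
- by apply: init_homog; apply: homogC.
- exact: low0.
- exact: low0.
Qed.

Lemma linearizes_var i : linearizes 1 (var K i) (var K i).
Proof.
have dvar : dV (var K i) = V i.
  rewrite /dV (bigD1 i) //= mderiv_var eqxx mul1r big1 ?addr0 // => j ji.
  by rewrite mderiv_var eq_sym (negbTE ji) mul0r.
have lV : low k.+2 (V i) by apply: homog_low; exact: V_homog.
split; rewrite ?msubst_var ?dvar.
- exact: S_init.
- rewrite /SW -[var K i]addr0; apply: initD; first exact: S_init.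
  apply: low_init0; rewrite -[W i](subrK (V i)); apply: lowD.
    exact: lowW (W_V i).
  exact: lowW lV.
- exact: lV.
- by rewrite /SW [S i + _]addrC addrK; exact: W_V.
Qed.

Lemma linearizes0 d : linearizes d 0 0.
Proof.
have d0 : dV 0 = 0 by rewrite /dV big1 // => j _; rewrite mderiv0 mul0r.
split; rewrite ?rmorph0 ?d0 ?subrr ?subr0.
- by apply: init_homog; apply: homog0.
- by apply: init_homog; apply: homog0.
- exact: low0.
- exact: low0.
Qed.

(** Terms of degree above [d] are absorbed in the error: their differential along [V] already has
    order [d + k.+2]. *)
Lemma linearizesW d d' f B : (d < d')%N -> linearizes d' f B -> linearizes d 0 B.
Proof.
move=> dd' [iS iSW lV lE].
have d0 : dV 0 = 0 by rewrite /dV big1 // => j _; rewrite mderiv0 mul0r.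
split; rewrite ?d0 ?subr0.
- by apply: low_init0; apply: lowW (init_low iS).
- by apply: low_init0; apply: lowW (init_low iSW).
- exact: low0.
- rewrite -[X in low _ X](subrK (dV f)); apply: lowD.
    by apply: lowW lE; rewrite leq_add2r ltnW.
  by apply: lowW lV; rewrite addnS -addSn leq_add2r.
Qed.

Lemma linearizesX m : linearizes (mdeg m) (mpolyX K m) (mpolyX K m).
Proof.
rewrite mpolyX_prod_var mdegE.
elim/big_rec2: _ => [|i d p _ IH].
  by rewrite -mpolyC1; apply: linearizesC.
apply: linearizesM => //; elim: (m i) => [|l IHl].
  by rewrite expr0 -mpolyC1; apply: linearizesC.
by rewrite exprS -add1n; apply: linearizesM IHl; apply: linearizes_var.
Qed.

Lemma linearizesP d f B : init d f B -> linearizes d f B.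
Proof.
move=> ifB; have fE : f = hpart d B.
  by apply: (init_uniq ifB); apply: init_hpart; apply: (init_low ifB).
rewrite fE.
have lB := init_low ifB.
rewrite [X in linearizes _ (hpart _ X)]mpolyE [X in linearizes _ _ X]mpolyE.
rewrite raddf_sum /= !big_seq.
apply: (big_ind2 (fun f B => linearizes d f B)).
- exact: linearizes0.
- by move=> *; apply: linearizesD.
move=> m mB; have dm : (d <= mdeg m)%N.
  by rewrite leqNgt; apply/negP => /lB Bm; move: mB; rewrite mcoeff_msupp Bm eqxx.
have lin c : linearizes (mdeg m) (c *: mpolyX K m) (c *: mpolyX K m).
  rewrite -mul_mpolyC -[X in linearizes X]add0n; apply: linearizesM.
    exact: linearizesC.
  exact: linearizesX.
have [dE|dm'] := eqVneq d (mdeg m).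
  rewrite hpart_homog ?dE //; apply: homogZ; exact: homogX.
rewrite (hpart_homog_neq (d := mdeg m)); last by rewrite eq_sym.
  by apply: linearizesW (lin _); rewrite ltn_neqAle dm'.
by apply: homogZ; apply: homogX.
Qed.

Lemma linearization d f B : init d f B ->
  low (d + k.+2) (msubst SW B - msubst S B - \sum_j mderiv j f * V j).
Proof. by case/linearizesP. Qed.

End Linearization.

Lemma hpartM_homog (K : idomainType) n d l (f p : mpoly n K) :
  homog d f -> hpart (d + l) (f * p) = f * hpart l p.
Proof.
move=> hf; apply/mpolyP => m; rewrite mcoeff_hpart; case: eqP => [mE|mE].
  rewrite !mcoeffM; apply: eq_bigr => -[k1 k2] /= /eqP E.
  rewrite mcoeff_hpart; have [k2l//|k2l] := eqVneq.
  rewrite [mcoeff k1 f]hf ?mul0r //; apply: contraNneq k2l => k1d.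
  by have := congr1 (@mdeg n) E; rewrite mdegD k1d; lia.
by rewrite (homogM hf (homog_hpart l p)) //; apply/eqP.
Qed.

Section Run.
Variables (K : numFieldType) (n : nat).
Variables (e : 'I_n -> nat) (f : 'I_n -> mpoly n K).
Variable T : nat -> mpoly n K -> mpoly n K.
Hypothesis f_homog : forall i, homog (e i).+1 (f i).
Hypothesis TK : forall l g, homog l g -> T l (\det (jac f) * g) = g.
Hypothesis T_homog : forall l q, homog l (T l q).

Section Solution.
Variables (B c : 'I_n -> mpoly n K).

(* The homogeneous part of degree k+2 of the formal solution S of
   B (S (z)) = c (z), S (z) = z + O(|z|^2), from the parts of lower degree. *)
Definition solve_step k (S : 'I_n -> mpoly n K) (j : 'I_n) : mpoly n K :=
  T k.+2 (\sum_i \adj (jac f) j i * hpart (e i + k.+2) (c i - msubst S (B i))).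

(** Stage [k] contains the parts of degree up to [k.+1]; stage 0 is the identity. *)
Fixpoint solve k : 'I_n -> mpoly n K :=
  if k is k'.+1 then fun j => solve k' j + solve_step k' (solve k') j
  else var K (n := n).

Lemma solve_sum k j :
  solve k j = var K j + \sum_(q < k) solve_step q (solve q) j.
Proof.
elim: k => [|k IH] /=; first by rewrite big_ord0 addr0.
by rewrite big_ord_recr /= IH addrA.
Qed.

Lemma homog_solve_step k S j : homog k.+2 (solve_step k S j).
Proof. exact: T_homog. Qed.
Arguments homog_solve_step : clear implicits.

Lemma solve_init k j : init 1 (var K j) (solve k j).
Proof.
split; first exact: homog_var.
rewrite solve_sum addrC addKr; apply: low_sum => q _.
by apply: (lowW _ (homog_low (homog_solve_step q _ j))).
Qed.

Lemma hpart_solve_ge k j d : (k.+2 <= d)%N -> hpart d (solve k j) = 0.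
Proof.
move=> kd; rewrite solve_sum raddfD raddf_sum /=.
rewrite (hpart_homog_neq (homog_var K j)) ?add0r; last by lia.
rewrite big1 // => q _; apply: (hpart_homog_neq (homog_solve_step q _ j)).
by have := ltn_ord q; lia.
Qed.

Lemma low_solveB k q j : (q <= k)%N -> low q.+2 (solve k j - solve q j).
Proof.
move=> /subnKC <-; elim: (k - q)%N => [|l IH].
  by rewrite addn0 subrr; apply: low0.
rewrite addnS /= addrAC; apply: lowD; first exact: IH.
by apply: (lowW _ (homog_low (homog_solve_step _ _ j))); rewrite !ltnS leq_addr.
Qed.

Hypothesis B_init : forall i, init (e i).+1 (f i) (B i).

(** The index: [f i] has degree [(e i).+1], so a derivative of it times a part of degree [k.+2] has
    degree [e i + k.+2]. *)
Lemma linearize_solve k (u : 'I_n -> mpoly n K) i :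
  (forall j, low k.+2 (u j - solve k j)) ->
  hpart (e i + k.+2) (msubst u (B i)) = hpart (e i + k.+2) (msubst (solve k) (B i))
   + \sum_j mderiv j (f i) * hpart k.+2 (u j - solve k j).
Proof.
move=> lu; pose W j := u j - solve k j; pose V j := hpart k.+2 (W j).
have := @linearization _ _ k (solve k) W V (solve_init k)
  (fun j => homog_hpart _ _) (fun j => low_hpart (lu j)) _ _ _ (B_init i).
rewrite (eq_msubst (t := u)); last by move=> j; rewrite /W subrKC.
rewrite addSnnS => lE; apply/eqP; rewrite -subr_eq0 opprD addrA -raddfB /=.
rewrite -[X in _ - X](hpart_homog (d := (e i + k.+2)%N)).
  by rewrite -raddfB /= (hpart_low _ lE) // ltn_add2l.
apply: homog_sum => j _; apply: homogM; last exact: homog_hpart.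
exact: homog_deriv.
Qed.

(** The residual of stage [k] is the matrix [jac f] applied to the next part [V] of [u]. Multiplying
    by the adjugate leaves [\det (jac f) * V j], from which [T] recovers [V j]. *)
Lemma solve_unique l (u : 'I_n -> mpoly n K) :
  (forall j, low 2 (u j - var K j)) ->
  (forall i, low (e i + l.+1) (msubst u (B i) - c i)) ->
  forall k j, (k < l)%N -> low k.+2 (u j - solve k j).
Proof.
move=> u_init uc; elim=> [|k IH] j kl; first exact: u_init.
have {}IH j' : low k.+2 (u j' - solve k j') by apply: IH; exact: ltnW.
pose V j := hpart k.+2 (u j - solve k j).
suff stepE : solve_step k (solve k) j = V j.
  by rewrite /= stepE opprD addrA; apply: low_hpart; exact: IH.
rewrite /solve_step.
have rhsE i : hpart (e i + k.+2) (c i - msubst (solve k) (B i)) =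
    \sum_j mderiv j (f i) * V j.
  have := linearize_solve i IH.
  rewrite -[X in hpart _ X = _](subrK (c i)) raddfD /= (hpart_low _ (uc i)).
    by rewrite add0r raddfB /= => ->; rewrite addrC addKr.
  by rewrite ltn_add2l.
rewrite (eq_bigr (fun i => \sum_j' (\adj (jac f) j i * jac f i j') * V j')).
  rewrite exchange_big /= (bigD1 j) //= [X in _ + X]big1 ?addr0 => [|j' jj'].
    rewrite -mulr_suml.
    have /matrixP/(_ j j) := mul_adj_mx (jac f); rewrite !mxE eqxx mulr1n => ->.
    by apply: TK; exact: homog_hpart.
  rewrite -mulr_suml.
  have /matrixP/(_ j j') := mul_adj_mx (jac f).
  by rewrite !mxE eq_sym (negbTE jj') mulr0n => ->; rewrite mul0r.
by move=> i _; rewrite rhsE mulr_sumr; apply: eq_bigr => j' _; rewrite !mxE mulrA.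
Qed.

(* All residuals met up to stage k are parts of one and the same polynomial,
   the remainder of second order of B at z. *)
Lemma residual_part k q i : (q <= k)%N ->
  hpart (e i + q.+2) (msubst (solve q) (B i)) =
  hpart (e i + q.+2) (msubst (solve k) (B i) - f i
    - \sum_j mderiv j (f i) * (solve k j - var K j)).
Proof.
move=> qk; have lS j := low_solveB j qk.
have {lS} := linearize_solve i lS; rewrite !raddfB /= => ->.
rewrite (hpart_homog_neq (@f_homog i)) ?subr0; last by lia.
rewrite -[LHS]addr0 -addrA; congr (_ + _).
apply/esym/eqP; rewrite subr_eq0; apply/eqP; rewrite raddf_sum /=; apply: eq_bigr => j _.
rewrite hpartM_homog; last by apply: homog_deriv.
rewrite !raddfB /= [X in _ * (_ - X)]hpart_solve_ge // subr0.
by rewrite (hpart_homog_neq (homog_var K j)) ?subr0.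
Qed.

End Solution.
End Run.

(** * Estimates for the recursion *)

Section SecondOrder.
Variables (R : realType) (n : nat) (r : 'I_n -> R).
Hypothesis r_gt0 : forall i, 0 < r i.
Local Notation C := R[i].
Local Notation N t := (wnorm (fun i => t * r i)).

Lemma wnormD_le (rho : 'I_n -> R) (p q : mpoly n C) a b :
  (forall i, 0 <= rho i) -> wnorm rho p <= a -> wnorm rho q <= b ->
  wnorm rho (p + q) <= a + b.
Proof. by move=> r0 pa qb; apply: le_trans (wnormD r0 p q) (lerD pa qb). Qed.

Lemma wnormM_le (rho : 'I_n -> R) (p q : mpoly n C) a b :
  (forall i, 0 <= rho i) -> wnorm rho p <= a -> wnorm rho q <= b ->
  wnorm rho (p * q) <= a * b.
Proof.
move=> r0 pa qb; apply: le_trans (wnormM r0 p q) _.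
by apply: ler_pM => //; exact: wnorm_ge0.
Qed.

Definition shifted (V : 'I_n -> mpoly n C) p :=
  msubst (fun j => var C j + V j) p.

Definition directional (V : 'I_n -> mpoly n C) (p : mpoly n C) :=
  \sum_j mderiv j p * V j.

(** Taylor's formula with a remainder quadratic in the relative size [y] of the displacement [V],
    uniformly in the radius [t]. As in [linearizes], the other bounds are there to pass to
    products. *)
Definition second_order_bound d (p : mpoly n C) := exists2 c : R, 0 <= c &
  forall (t y : R) V, 0 < t -> 0 <= y <= 1 -> (forall j, N t (V j) <= t * y) ->
  [/\ N t (shifted V p) <= c * t ^+ d, N t p <= c * t ^+ d,
      N t (directional V p) <= c * t ^+ d * y
    & N t (shifted V p - p - directional V p) <= c * t ^+ d * y ^+ 2].

Lemma second_order_product (T : comPzRingType) (X p D X' p' D' : T) :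
  X * X' - p * p' - (D * p' + p * D') =
  (X - p - D) * X' + p * (X' - p' - D') + D * ((X' - p' - D') + D').
Proof. ring. Qed.

Lemma directionalM V p q :
  directional V (p * q) = directional V p * q + p * directional V q.
Proof.
rewrite /directional mulr_suml mulr_sumr -big_split; apply: eq_bigr => j _ /=.
by rewrite mderivM mulrDl mulrA mulrAC.
Qed.

Lemma second_order_boundM d d' p q :
  second_order_bound d p -> second_order_bound d' q ->
  second_order_bound (d + d') (p * q).
Proof.
move=> [c c0 pc] [c' c'0 qc']; exists (4 * (c * c')); first by rewrite !mulr_ge0.
move=> t y V t0 y01 Vy.
have [X1 p1 D1 E1] := pc t y V t0 y01 Vy; have [X2 p2 D2 E2] := qc' t y V t0 y01 Vy.
have {y01} [y0 y1] := andP y01.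
have tr0 i : 0 <= t * r i by apply: mulr_ge0; apply: ltW.
rewrite exprD; set a := c * t ^+ d; set b := c' * t ^+ d'.
have a0 : 0 <= a by rewrite mulr_ge0 // exprn_ge0 // (ltW t0).
have b0 : 0 <= b by rewrite mulr_ge0 // exprn_ge0 // (ltW t0).
have ab0 : 0 <= a * b by exact: mulr_ge0.
have -> : 4 * (c * c') * (t ^+ d * t ^+ d') = 4 * (a * b) by rewrite /a /b; ring.
rewrite -/a in X1 p1 D1 E1; rewrite -/b in X2 p2 D2 E2.
clearbody a b.
have aby : 0 <= a * b * y by exact: mulr_ge0.
have aby2 : 0 <= a * b * y ^+ 2 by rewrite mulr_ge0 // exprn_ge0.
split.
- rewrite /shifted msubstM; apply: le_trans (wnormM_le tr0 X1 X2) _.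
  by rewrite ler_peMl // ler1n.
- by apply: le_trans (wnormM_le tr0 p1 p2) _; rewrite ler_peMl // ler1n.
- rewrite directionalM.
  apply: le_trans (wnormD_le tr0 (wnormM_le tr0 D1 p2) (wnormM_le tr0 p1 D2)) _.
  rewrite (_ : _ + _ = 2 * (a * b * y)); last by ring.
  by rewrite -[leRHS]mulrA ler_wpM2r // ler_nat.
- rewrite directionalM /shifted msubstM second_order_product.
  apply: le_trans (wnormD_le tr0 (wnormD_le tr0 (wnormM_le tr0 E1 X2)
    (wnormM_le tr0 p1 E2)) (wnormM_le tr0 D1 (wnormD_le tr0 E2 D2))) _.
  rewrite (_ : _ + _ = (3 + y) * (a * b * y ^+ 2)); last by ring.
  by rewrite -[leRHS]mulrA ler_wpM2r //; clear -y1; lra.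
Qed.

Lemma second_order_boundD d p q :
  second_order_bound d p -> second_order_bound d q ->
  second_order_bound d (p + q).
Proof.
move=> [c c0 pc] [c' c'0 qc']; exists (c + c'); first by rewrite addr_ge0.
move=> t y V t0 y01 Vy.
have [X1 p1 D1 E1] := pc t y V t0 y01 Vy; have [X2 p2 D2 E2] := qc' t y V t0 y01 Vy.
have tr0 i : 0 <= t * r i by apply: mulr_ge0; apply: ltW.
have DD : directional V (p + q) = directional V p + directional V q.
  by rewrite /directional -big_split; apply: eq_bigr => j _ /=; rewrite mderivD mulrDl.
rewrite /shifted msubstD DD linearize_sum !mulrDl.
by split; apply: wnormD_le.
Qed.

Lemma second_order_boundC c : second_order_bound 0 (mpolyC n c).
Proof.
have wC rho : wnorm rho (mpolyC n c : mpoly n C) <= normc c.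
  rewrite -[mpolyC n c]mulr1 mul_mpolyC wnormZ.
  suff -> : wnorm rho 1 = 1 :> R by rewrite mulr1.
  rewrite -(mpolyX0 n C) wnormX /rmon big1 // => i _; by rewrite mnm0E.
exists (normc c); first exact: normc_ge0.
move=> t y V t0 /andP[y0 y1] Vy.
have D0 : directional V (mpolyC n c) = 0.
  by rewrite /directional big1 // => j _; rewrite mderivC mul0r.
rewrite /shifted msubstC D0 subrr subr0 expr0 mulr1 wnorm0.
by split; rewrite ?wC // mulr_ge0 ?exprn_ge0 ?normc_ge0.
Qed.

Lemma second_order_bound_var i : second_order_bound 1 (var C i).
Proof.
exists (r i + 1); first by rewrite addr_ge0 // ltW.
move=> t y V t0 /andP[y0 y1] Vy.
have tr0 j : 0 <= t * r j by apply: mulr_ge0; apply: ltW.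
have Di : directional V (var C i) = V i.
  rewrite /directional (bigD1 i) //= mderiv_var eqxx mul1r big1 ?addr0 // => j ji.
  by rewrite mderiv_var eq_sym (negbTE ji) mul0r.
have ri := r_gt0 i.
have ty : t * y <= t by rewrite ler_piMr // ltW.
have rty : 0 <= r i * (t * y) by rewrite mulr_ge0 ?(ltW ri) // mulr_ge0 // ltW.
have Ni : N t (var C i) <= t * r i by rewrite wnorm_var.
rewrite /shifted msubst_var Di [_ - var C i]addrC addKr subrr wnorm0 expr1.
split.
- apply: le_trans (wnormD_le tr0 Ni (Vy i)) _.
  by rewrite mulrDl mul1r [r i * t]mulrC lerD2l.
- by apply: le_trans Ni _; rewrite mulrDl mul1r [r i * t]mulrC lerDl ltW.
- by apply: le_trans (Vy i) _; rewrite -mulrA mulrDl mul1r lerDr.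
- by rewrite mulr_ge0 ?exprn_ge0 // mulr_ge0 ?ltW // addr_gt0.
Qed.

Lemma second_order_boundX m : second_order_bound (mdeg m) (mpolyX C m).
Proof.
rewrite mpolyX_prod_var mdegE.
elim/big_rec2: _ => [|i d p _ IH].
  by rewrite -mpolyC1; apply: second_order_boundC.
apply: second_order_boundM => //; elim: (m i) => [|l IHl].
  by rewrite expr0 -mpolyC1; apply: second_order_boundC.
by rewrite exprS -add1n; apply: second_order_boundM IHl; apply: second_order_bound_var.
Qed.

Lemma second_order_bound0 d : second_order_bound d 0.
Proof.
exists 0 => // t y V t0 _ _.
have D0 : directional V 0 = 0.
  by rewrite /directional big1 // => j _; rewrite mderiv0 mul0r.
by rewrite /shifted rmorph0 D0 !subr0 !mul0r wnorm0.
Qed.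

Lemma second_order_homog d p : homog d p -> second_order_bound d p.
Proof.
move=> hp; rewrite (mpolyE p) big_seq; apply: big_ind.
- exact: second_order_bound0.
- exact: second_order_boundD.
move=> m; rewrite mcoeff_msupp => pm.
have -> : d = mdeg m by apply/eqP; apply: contraNT pm; rewrite eq_sym => /hp ->.
rewrite -mul_mpolyC -[mdeg m]add0n; apply: second_order_boundM.
  exact: second_order_boundC.
exact: second_order_boundX.
Qed.

End SecondOrder.

Lemma wnorm_hpart_sum_from (R : realType) n (r : 'I_n -> R) a b (p : mpoly n R[i]) :
  (forall i, 0 <= r i) -> \sum_(k < b) wnorm r (hpart (a + k) p) <= wnorm r p.
Proof.
move=> r0; apply: le_trans (wnorm_hpart_sum r0 (a + b) p).
rewrite big_split_ord /= lerDr; apply: sumr_ge0 => i _; exact: wnorm_ge0.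
Qed.

Lemma addr_telescope (V : zmodType) (x y p d : V) :
  x - p - d = (y - p - d) + (x - y).
Proof. by rewrite [RHS]addrC !addrA subrK. Qed.

Lemma homog_sign (K : idomainType) n k : homog 0 ((-1) ^+ k : mpoly n K).
Proof.
rewrite -[X in homog X](mul0n k).
by apply: homog_exp; apply: homogN; apply: homog1.
Qed.

Lemma homog_det (K : idomainType) n m (A : 'M[mpoly n K]_m) (d : 'I_m -> nat) :
  (forall x y, homog (d x) (A x y)) -> homog (\sum_x d x)%N (\det A).
Proof.
move=> hA; apply: homog_sum => s _.
rewrite -[X in homog X]add0n; apply: homogM; first exact: homog_sign.
by apply: homog_prod => x _; apply: hA.
Qed.

(** A cofactor along row [i] omits the row of degree [e i]. *)
Lemma homog_adj_jac (K : numFieldType) n (f : 'I_n -> mpoly n K) (e : 'I_n -> nat)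
    i j : (forall i, homog (e i).+1 (f i)) ->
  homog (\sum_k e k - e i)%N (\adj (jac f) j i).
Proof.
move=> hf; rewrite mxE /cofactor (bigD1_ord i) //= addKn -[X in homog X]add0n.
apply: homogM; first exact: homog_sign.
apply: (homog_det (d := fun x => e (lift i x))) => x y; rewrite !mxE.
by apply: homog_deriv; apply: hf.
Qed.

Lemma small_scalar (R : realFieldType) (k : R) : 0 <= k ->
  exists y : R, [/\ 0 < y, y <= 1 & k * y <= 1 / 2].
Proof.
move=> k0; exists (1 + 2 * k)^-1; have k1 : 0 < 1 + 2 * k by lra.
split; rewrite ?invr_gt0 ?invf_le1 //; first by lra.
by rewrite ler_pdivrMr //; lra.
Qed.

(** Bookkeeping of the powers of [t]: division costs t^-E, the adjugate gives t^(E-e), the quadratic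
    remainder t^(e+1) and the higher terms t^(e+2). What remains is [t] times a sum of a term linear
    in [t] and a term quadratic in [y]. *)
Lemma solve_scalar_identity (R : realFieldType) (t t0 rho : R) (A M Q H c y : R)
    (E e : nat) : 0 < t -> 0 < t0 -> 0 < rho -> (e <= E)%N ->
  M / t ^+ E * (t ^+ (E - e) * Q * ((t / t0) ^+ e.+2 * H +
    (c * t ^+ e.+1 * y ^+ 2 + (t * A / rho) ^+ e.+2 * (2 * H)))) =
  t * (t * (M * Q * (H / t0 ^+ e.+2 + 2 * H * (A / rho) ^+ e.+2)) +
    y ^+ 2 * (M * Q * c)).
Proof.
move=> tgt0 t0gt0 rho0 eE; rewrite -[in t ^+ E](subnK eE) exprD.
rewrite !expr_div_n !exprMn !exprS.
have nz x k : 0 < x -> x ^+ k != 0 by move=> x0; rewrite expf_neq0 // gt_eqF.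
by field; rewrite !nz // !gt_eqF.
Qed.

Section SolveBound.
Variables (R : realType) (n : nat).
Local Notation C := R[i].
Variables (e : 'I_n -> nat) (f : 'I_n -> mpoly n C).
Variables (r : 'I_n -> R) (T : nat -> mpoly n C -> mpoly n C) (M : R).
Hypothesis f_homog : forall i, homog (e i).+1 (f i).
Hypothesis T_homog : forall l q, homog l (T l q).
Hypothesis r_gt0 : forall i, 0 < r i.
Hypothesis M_gt0 : 0 < M.
Local Notation N t := (wnorm (fun i => t * r i)).
Hypothesis T_bound : forall l t q, 0 < t ->
  N t (T l q) <= M / t ^+ (\sum_i e i) * N t q.

(** Displacements [V] of norm at most [t] keep every component of z + V within [t * A]. *)
Let A := 1 + \sum_i r i.

Let A_gt0 : 0 < A.
Proof. by rewrite ltr_pwDl // sumr_ge0 // => i _; apply: ltW. Qed.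

Let rA i : r i + 1 <= A.
Proof.
rewrite addrC /A lerD2l (bigD1 i) //= lerDl sumr_ge0 // => j _; exact: ltW.
Qed.

Let tr0 t : 0 < t -> forall i, 0 <= t * r i.
Proof. by move=> t0 i; apply: mulr_ge0; apply: ltW. Qed.

(** [B] is split into its initial form [p], which has a quadratic remainder, and the rest [B - p],
    whose higher order gains from the small radius; [2 * H] bounds the norm of this rest. *)
Lemma residual_bound d (p B : mpoly n C) (V : 'I_n -> mpoly n C)
    (rho H c t y : R) :
  0 < rho -> 0 < t -> 0 <= y <= 1 -> t * A <= rho ->
  init d p B -> wnorm (fun=> rho) B <= H ->
  N t (shifted V p - p - directional V p) <= c * t ^+ d * y ^+ 2 ->
  (forall j, N t (V j) <= t * y) ->
  N t (shifted V B - p - directional V p) <=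
    c * t ^+ d * y ^+ 2 + (t * A / rho) ^+ d.+1 * (2 * H).
Proof.
move=> rho0 t0 /andP[y0 y1] tA ipB BH Ep Vy.
have [hp lBp] := ipB.
have -> : shifted V B - p - directional V p =
    (shifted V p - p - directional V p) + shifted V (B - p).
  by rewrite /shifted msubstB; apply: addr_telescope.
apply: wnormD_le (tr0 t0) Ep _.
have tA1 : 0 <= t * A / rho <= 1.
  rewrite divr_ge0 ?mulr_ge0 ?(ltW t0) ?(ltW A_gt0) ?(ltW rho0) //=.
  by rewrite ler_pdivrMr // mul1r.
apply: le_trans (wnorm_msubst (rho := fun=> t * A / rho * rho) _ (tr0 t0) _) _.
  move=> j; rewrite divfK ?gt_eqF //.
  apply: le_trans (wnormD_le (tr0 t0) _ (Vy j)) _; first by rewrite wnorm_var.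
  rewrite -mulrDr ler_pM2l //; apply: le_trans (rA j); rewrite lerD2l //.
apply: le_trans (wnorm_low (r := fun=> rho) _ tA1 lBp) _; first by move=> _; apply: ltW.
have [tA0 _] := andP tA1.
rewrite ler_wpM2l ?exprn_ge0 //.
have rho0' (j : 'I_n) : 0 <= rho by exact: ltW.
apply: le_trans (wnormB rho0' _ _) _; rewrite mulrDl mul1r lerD //.
have -> : p = hpart d B.
  by apply: (init_uniq ipB); apply: init_hpart; apply: (init_low ipB).
exact: le_trans (wnorm_hpart rho0' _ _) BH.
Qed.

Lemma solve_step_bound B c q j t (x y : 'I_n -> R) : 0 < t ->
  (forall i, N t (hpart (e i + q.+2) (c i)) <= x i) ->
  (forall i, N t (hpart (e i + q.+2) (msubst (solve e f T B c q) (B i))) <= y i) ->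
  N t (solve_step e f T B c q (solve e f T B c q) j) <=
  M / t ^+ (\sum_i e i) * \sum_i N t (\adj (jac f) j i) * (x i + y i).
Proof.
move=> t0 cx By; apply: le_trans (T_bound _ _ t0) _.
rewrite ler_wpM2l ?divr_ge0 ?(ltW M_gt0) ?exprn_ge0 ?(ltW t0) //.
apply: le_trans (wnorm_sum (tr0 t0) _ _ _) _; apply: ler_sum => i _.
apply: le_trans (wnormM (tr0 t0) _ _) _.
rewrite ler_wpM2l ?(wnorm_ge0 (tr0 t0)) // raddfB /=.
exact: le_trans (wnormB (tr0 t0) _ _) (lerD (cx i) (By i)).
Qed.

(** All these parts have degree at least [d], so shrinking the radius from [t0] to [t] gains (t /
    t0)^d, and together they cost one norm. *)
Lemma tail_bound d t t0 k H (p : mpoly n C) : 0 < t -> t <= t0 ->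
  N t0 p <= H ->
  \sum_(q < k) N t (hpart (d + q) p) <= (t / t0) ^+ d * H.
Proof.
move=> tgt0 tt0 pH; have t0gt0 : 0 < t0 by apply: lt_le_trans tt0.
have tt01 : 0 <= t / t0 <= 1.
  by rewrite divr_ge0 ?(ltW tgt0) ?(ltW t0gt0) //= ler_pdivrMr ?mul1r.
have [tt00 _] := andP tt01.
apply: le_trans (_ : (t / t0) ^+ d * \sum_(q < k) N t0 (hpart (d + q) p) <= _).
  rewrite mulr_sumr; apply: ler_sum => q _.
  have -> : (fun i => t * r i) = (fun i => t / t0 * (t0 * r i)).
    by apply/funext => i; rewrite mulrA divfK ?gt_eqF.
  apply: wnorm_low => //; first exact: tr0.
  by apply: (lowW _ (homog_low (homog_hpart (d + q) p))); rewrite leq_addr.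
rewrite ler_wpM2l ?exprn_ge0 //.
exact: le_trans (wnorm_hpart_sum_from _ _ _ (tr0 t0gt0)) pH.
Qed.

(** The invariant is that the norms of the components of S - id add up to at most [t * y]. It
    reproduces itself with fixed [t] and [y], because the next stage is estimated as a whole from
    the remainder of the current one and not by adding an increment. *)
Lemma solve_bound (rho t0 H : R) : 0 < rho -> 0 < t0 -> 0 <= H ->
  exists2 t : R, 0 < t <= 1 & forall B c : 'I_n -> mpoly n C,
    (forall i, init (e i).+1 (f i) (B i)) ->
    (forall i, wnorm (fun=> rho) (B i) <= H) ->
    (forall i, N t0 (c i) <= H) ->
    forall k j, N t (solve e f T B c k j - var C j) <= t.
Proof.
move=> rho0 t00 H0.
have /choice[c1 c1P] : forall i, exists c : R, 0 <= c /\
    forall (t y : R) V, 0 < t -> 0 <= y <= 1 -> (forall j, N t (V j) <= t * y) ->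
    N t (shifted V (f i) - f i - directional V (f i))
      <= c * t ^+ (e i).+1 * y ^+ 2.
  move=> i; have [c c0 cP] := second_order_homog r_gt0 (@f_homog i).
  by exists c; split=> // t y V tgt0 y01 Vy; have [] := cP t y V tgt0 y01 Vy.
pose Q j i := wnorm r (\adj (jac f) j i).
have Q0 j i : 0 <= Q j i by apply: wnorm_ge0 => l; exact: ltW.
pose k1 j i := M * Q j i * (H / t0 ^+ (e i).+2 + 2 * H * (A / rho) ^+ (e i).+2).
pose k2 j i := M * Q j i * c1 i.
pose kap1 := \sum_j \sum_i k1 j i; pose kap2 := \sum_j \sum_i k2 j i.
have kap1_ge0 : 0 <= kap1.
  apply: sumr_ge0 => j _; apply: sumr_ge0 => i _.
  apply: mulr_ge0; first by rewrite mulr_ge0 // (ltW M_gt0).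
  apply: addr_ge0; first by rewrite divr_ge0 // exprn_ge0 // (ltW t00).
  apply: mulr_ge0; first by rewrite mulr_ge0.
  by rewrite exprn_ge0 // divr_ge0 // ?(ltW A_gt0) ?(ltW rho0).
have kap2_ge0 : 0 <= kap2.
  apply: sumr_ge0 => j _; apply: sumr_ge0 => i _.
  have [c10 _] := c1P i; apply: mulr_ge0 => //.
  by rewrite mulr_ge0 // (ltW M_gt0).
(* [y * kap2 <= 1 / 2], and [t <= z * y] with [z * kap1 <= 1 / 2], together give
   [t * kap1 + y ^+ 2 * kap2 <= y], which closes the induction. *)
have [y [y0 y1 ky]] := small_scalar kap2_ge0.
have [z [z0 z1 kz]] := small_scalar kap1_ge0.
pose t := Num.min (Num.min 1 t0) (Num.min (rho / A) (z * y)).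
have tgt0 : 0 < t by rewrite !lt_min ltr01 t00 divr_gt0 ?mulr_gt0.
have t1 : t <= 1 by rewrite /t !ge_min lexx.
have tt0 : t <= t0 by rewrite /t !ge_min lexx orbT.
have tA : t * A <= rho.
  by rewrite -ler_pdivlMr // /t !ge_min lexx !orbT.
have tzy : t <= z * y by rewrite /t !ge_min lexx !orbT.
have total : t * kap1 + y ^+ 2 * kap2 <= y.
  have ktz : t * kap1 <= z * y * kap1 by rewrite ler_wpM2r.
  by clear -ktz ky kz y0 z0 kap1_ge0 kap2_ge0; nra.
clearbody t.
have y01 : 0 <= y <= 1 by rewrite (ltW y0).
have ty : t * y <= t by rewrite ler_piMr // ltW.
exists t; first by rewrite tgt0.
move=> B c B_init BH cH k j.
suff IH : \sum_j N t (solve e f T B c k j - var C j) <= t * y.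
  apply: le_trans ty; apply: le_trans IH; rewrite (bigD1 j) //= lerDl.
  by apply: sumr_ge0 => j' _; apply: wnorm_ge0; apply: tr0.
elim: k {j} => [|k IH].
  rewrite big1 => [|j _]; first by rewrite mulr_ge0 // ltW.
  by rewrite subrr wnorm0.
pose V j := solve e f T B c k j - var C j.
have Vy j : N t (V j) <= t * y.
  apply: le_trans IH; rewrite (bigD1 j) //= lerDl.
  by apply: sumr_ge0 => j' _; apply: wnorm_ge0; apply: tr0.
(* [G] is the remainder of stage [k]; by [residual_part] the residuals of all stages [q <= k] are
   homogeneous parts of it. *)
pose G i := shifted V (B i) - f i - directional V (f i).
have G_le i : N t (G i) <= c1 i * t ^+ (e i).+1 * y ^+ 2
    + (t * A / rho) ^+ (e i).+2 * (2 * H).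
  apply: residual_bound => //.
  by have [_] := c1P i; apply.
have GE q i : (q <= k)%N ->
    hpart (e i + q.+2) (msubst (solve e f T B c q) (B i)) =
    hpart (e i + q.+2) (G i).
  move=> qk; rewrite (residual_part f_homog T_homog _ B_init _ qk).
  have SE : msubst (solve e f T B c k) (B i) = shifted V (B i).
    by apply: eq_msubst => j; rewrite /V subrKC.
  by rewrite SE; reflexivity.
apply: le_trans (_ : \sum_j \sum_i t * (t * k1 j i + y ^+ 2 * k2 j i) <= _); last first.
  have -> : \sum_j \sum_i t * (t * k1 j i + y ^+ 2 * k2 j i) =
      t * (t * kap1 + y ^+ 2 * kap2).
    rewrite /kap1 /kap2 !mulr_sumr -big_split mulr_sumr; apply: eq_bigr => j _ /=.
    by rewrite !mulr_sumr -big_split mulr_sumr.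
  by rewrite ler_wpM2l // ltW.
apply: ler_sum => j _; rewrite solve_sum addrC addKr.
apply: le_trans (wnorm_sum (tr0 tgt0) _ _ _) _.
apply: le_trans (_ : \sum_(q < k.+1) M / t ^+ (\sum_i e i) *
    \sum_i N t (\adj (jac f) j i) * (N t (hpart ((e i).+2 + q) (c i)) +
      N t (hpart ((e i).+2 + q) (G i))) <= _).
  apply: ler_sum => q _; have qk : (q <= k)%N by rewrite -ltnS ltn_ord.
  have eq2 i : (e i + q.+2 = (e i).+2 + q)%N by rewrite !addSnnS.
  have H1 := @solve_step_bound B c q j t
    (fun i => N t (hpart ((e i).+2 + q) (c i)))
    (fun i => N t (hpart ((e i).+2 + q) (G i))) tgt0.
  apply: H1 => i.
    by rewrite -eq2; exact: lexx.
  by rewrite -eq2 (GE _ i qk); exact: lexx.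
rewrite -[leLHS]mulr_sumr [X in _ * X <= _]exchange_big /=.
rewrite [leLHS]mulr_sumr; apply: ler_sum => i _.
rewrite -mulr_sumr big_split /=.
have adjE : N t (\adj (jac f) j i) = t ^+ (\sum_k e k - e i)%N * Q j i.
  exact: (wnorm_homogZ r t (@homog_adj_jac _ _ f e i j f_homog)).
have ei : (e i <= \sum_k e k)%N by rewrite (bigD1 i) //= leq_addr.
rewrite /k1 /k2 -(solve_scalar_identity A M (Q j i) H (c1 i) y tgt0 t00 rho0 ei).
rewrite -adjE; apply: ler_wpM2l.
  by rewrite divr_ge0 ?exprn_ge0 ?(ltW M_gt0) ?(ltW tgt0).
apply: ler_wpM2l; first exact: wnorm_ge0 (tr0 tgt0) _.
apply: lerD; first exact: tail_bound.
exact: le_trans (wnorm_hpart_sum_from _ _ _ (tr0 tgt0)) (G_le i).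
Qed.

End SolveBound.

(** * Power series and their truncations *)

Section CauchyEstimate.
Variables (R : realType) (n : nat).
Local Notation C := R[i].

Lemma primitive_root_exists N : (0 < N)%N -> exists w : C, N.-primitive_root w.
Proof.
move=> N_gt0; have [s] := closed_field_poly_normal ('X^N - 1 : {poly C}).
rewrite (monicP (monicXnsubC 1 N_gt0)) scale1r => sE.
have s_root : all N.-unity_root s.
  by apply/allP => x; rewrite -root_prod_XsubC -sE.
have s_size : (N <= size s)%N.
  by rewrite -ltnS -(size_prod_XsubC s id) -sE size_XnsubC.
have s_uniq : uniq s.
  rewrite -separable.separable_prod_XsubC -sE cyclotomic.separable_Xn_sub_1 //.
  by rewrite pnatr_eq0 -lt0n.
by have /hasP[w _ ww] := cyclic.has_prim_root N_gt0 s_root s_uniq s_size; exists w.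
Qed.

Lemma root_of_unity_orthogonality N (w : C) k m : N.-primitive_root w ->
  (k < N)%N -> (m < N)%N ->
  \sum_(a < N) (w ^+ a) ^+ k / (w ^+ a) ^+ m = if k == m then N%:R else 0.
Proof.
move=> ww kN mN; have N_gt0 : (0 < N)%N by apply: leq_ltn_trans kN.
have w0 : w != 0.
  apply/eqP => w0; have := prim_expr_order ww.
  by rewrite w0 expr0n gtn_eqF // => /eqP; rewrite eq_sym oner_eq0.
pose v := w ^+ k / w ^+ m.
have vE (a : 'I_N) : (w ^+ a) ^+ k / (w ^+ a) ^+ m = v ^+ a.
  by rewrite expr_div_n -!exprM mulnC [(m * a)%N]mulnC.
under eq_bigr => a _ do rewrite vE.
case: eqVneq => [km|km].
  rewrite /v km divff ?expf_neq0 // (eq_bigr (fun=> 1)) => [|a _]; last exact: expr1n.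
  by rewrite sumr_const card_ord.
have : v ^+ N - 1 = 0.
  by rewrite expr_div_n -!exprM ![(_ * N)%N]mulnC !exprM (prim_expr_order ww) !expr1n divr1 subrr.
rewrite subrX1 => /eqP; rewrite mulf_eq0 subr_eq0 => /orP[|/eqP //].
rewrite -(inj_eq (mulIf (expf_neq0 m w0))) divfK ?expf_neq0 // mul1r.
by rewrite (eq_prim_root_expr ww) !modn_small // (negbTE km).
Qed.

(** The mean over a torus is replaced by a finite mean over [N]-th roots of unity. For [N] above the
    degrees involved it isolates the coefficient of [m] exactly. *)
Lemma cauchy_estimate (s : 'I_n -> R) (p : mpoly n C) (B : R) m :
  (forall i, 0 <= s i) ->
  (forall z : 'I_n -> C, (forall i, normc (z i) <= s i) -> normc (meval z p) <= B) ->
  normc (mcoeff m p) * rmon s m <= B.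
Proof.
move=> s0 pB; pose N := maxn (msize p) (mdeg m).+1.
have N_gt0 : (0 < N)%N by rewrite leq_max orbT.
have [w ww] := primitive_root_exists N_gt0.
have normw a : normc (w ^+ a) = 1.
  have nw : normc w = 1.
    have := congr1 (@normc R) (prim_expr_order ww).
    rewrite normcX ComplexField.Normc.normc1 => /eqP.
    by rewrite pexpr_eq1 ?normc_ge0 // => /eqP.
  by rewrite normcX nw expr1n.
pose node (a : {ffun 'I_n -> 'I_N}) i : C := (s i)%:C%C * w ^+ a i.
pose weightc (a : {ffun 'I_n -> 'I_N}) : C := \prod_i ((w ^+ a i) ^+ m i)^-1.
have normr_real x : 0 <= x -> normc (x%:C%C : C) = x.
  by move=> x0; rewrite /normc /= expr0n addr0 sqrtr_sqr ger0_norm.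
have expN (k : multinom n) i : (mdeg k < N)%N -> (k i < N)%N.
  by move=> kN; apply: leq_ltn_trans kN; rewrite mdegE (bigD1 i) //= leq_addr.
have orth (k : multinom n) : (mdeg k < N)%N ->
    \sum_a weightc a * \prod_i node a i ^+ k i =
    if k == m then \prod_i ((s i)%:C%C ^+ m i * N%:R) else 0.
  move=> kN.
  transitivity (\prod_(i < n) \sum_(a < N)
     (s i)%:C%C ^+ k i * ((w ^+ a) ^+ k i / (w ^+ a) ^+ m i)).
    rewrite bigA_distr_bigA; apply: eq_bigr => a _.
    rewrite /weightc -big_split; apply: eq_bigr => i _ /=.
    by rewrite /node exprMn mulrCA [X in _ * X = _]mulrC.
  have mN : (mdeg m < N)%N by rewrite leq_max ltnSn orbT.
  transitivity (\prod_(i < n)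
      ((s i)%:C%C ^+ k i * if k i == m i then N%:R else 0)).
    apply: eq_bigr => i _; rewrite -mulr_sumr.
    by rewrite (root_of_unity_orthogonality ww (expN k i kN) (expN m i mN)).
  case: eqVneq => [->|km]; first by apply: eq_bigr => i _; rewrite eqxx.
  have [i ki] : exists i, k i != m i.
    apply: contrapT => km'; move/eqP: km; apply; apply/mnmP => i.
    by apply/eqP/negPn/negP => ?; apply: km'; exists i.
  by rewrite (bigD1 i) //= (negbTE ki) mulr0 mul0r.
have total : \sum_a weightc a * meval (node a) p =
    mcoeff m p * \prod_i ((s i)%:C%C ^+ m i * N%:R).
  have evalE a : weightc a * meval (node a) p = \sum_(k <- msupp p)
      mcoeff k p * (weightc a * \prod_i node a i ^+ k i).
    by rewrite mevalE mulr_sumr; apply: eq_bigr => k _; rewrite mulrCA.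
  rewrite (eq_bigr _ (fun a _ => evalE a)) exchange_big /=.
  transitivity (\sum_(k <- msupp p) if k == m then
      mcoeff m p * \prod_i ((s i)%:C%C ^+ m i * N%:R) else 0).
    rewrite [LHS]big_seq [RHS]big_seq; apply: eq_bigr => k kp.
    rewrite -mulr_sumr orth; first by case: eqP => [->|_]; [reflexivity | rewrite mulr0].
    by apply: leq_trans (msize_mdeg_lt kp) _; rewrite leq_maxl.
  have [mp|mp] := boolP (m \in msupp p).
    rewrite (bigD1_seq m) ?msupp_uniq //= eqxx [X in _ + X]big1 ?addr0 // => k km.
    by rewrite (negbTE km).
  rewrite (memN_msupp_eq0 mp) mul0r big1_seq // => k /andP[_ kp].
  by case: eqP => // km; move: mp; rewrite -km kp.
have N0 : 0 < (N%:R : R) by rewrite ltr0n.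
have normN : normc (N%:R : C) = N%:R.
  by rewrite -[N%:R in LHS](rmorph_nat (@real_complex R)) normr_real.
have : normc (\sum_a weightc a * meval (node a) p) <= \sum_(a : {ffun 'I_n -> 'I_N}) B.
  apply: le_trans (ler_normc_sum _ _ _) _; apply: ler_sum => a _.
  rewrite ComplexField.Normc.normcM normc_prod big1 ?mul1r => [|i _].
    apply: pB => i; rewrite ComplexField.Normc.normcM normw mulr1 normr_real //.
  by rewrite ComplexField.Normc.normcV normcX normw expr1n invr1.
rewrite total ComplexField.Normc.normcM normc_prod sumr_const card_ffun !card_ord.
under eq_bigr => i _ do rewrite ComplexField.Normc.normcM normcX normr_real // normN.
rewrite big_split /= prodr_const card_ord mulrA -/(rmon s m).
by rewrite -[B *+ _]mulr_natr natrX ler_pM2r // exprn_gt0.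
Qed.

End CauchyEstimate.

(** * Convergence of complex matrices, entry by entry *)

Section EntrywiseTopology.
Variable R : realType.
Local Notation C := R[i].

Lemma normr_normc (x : C) : `|x| = ((normc x)%:C)%C.
Proof. by []. Qed.

Lemma gt0_complexE (e : C) : 0 < e -> exists2 d : R, 0 < d & e = (d%:C)%C.
Proof.
move=> e0; exists (complex.Re e); last by rewrite RRe_real // gtr0_real.
by move: e0; case: e => a b; rewrite ltcE /= => /andP[].
Qed.

Lemma mx_cvg_entry (T : Type) (F : set_system T) (FF : Filter F) m k
    (f : T -> 'M[C]_(m, k)) (l : 'M[C]_(m, k)) :
  f @ F --> l <-> forall i j (e : R), 0 < e ->
    \forall t \near F, normc (l i j - f t i j) < e.
Proof.
split=> [fl i j e e0|fl].
  have e0' : 0 < (e%:C)%C :> C by rewrite ltcR.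
  apply: filterS (cvg_ball fl e0') => t [_ /(_ i j)].
  by rewrite /ball /= normr_normc ltcR.
apply/cvg_ballP => _ /gt0_complexE[d d0 ->].
have : \forall t \near F, forall i j, normc (l i j - f t i j) < d.
  suff : \forall t \near F, forall x : 'I_m * 'I_k,
      normc (l x.1 x.2 - f t x.1 x.2) < d.
    by apply: filterS => t H i j; exact: (H (i, j)).
  by apply: filter_forall => x; exact: fl.
apply: filterS => t H; split=> [|i j]; first by rewrite ltcR.
by rewrite /ball /= normr_normc ltcR.
Qed.

Lemma near_polydisc m k (z : 'M[C]_(m, k)) (P : 'M[C]_(m, k) -> Prop) :
  (\forall x \near z, P x) <->
  exists2 s : R, 0 < s & forall x : 'M[C]_(m, k), (forall i j, normc (z i j - x i j) < s) -> P x.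
Proof.
split=> [/nbhs_ballP[_ /= /gt0_complexE[s s0 ->] sP]|[s s0 sP]].
  exists s => // x xs; apply: sP; split=> [|i j]; first by rewrite ltcR.
  by rewrite /ball /= normr_normc ltcR.
apply/nbhs_ballP; exists (s%:C)%C => /=; first by rewrite ltcR.
move=> x [_ xs]; apply: sP => i j.
by have := xs i j; rewrite /ball /= normr_normc ltcR.
Qed.

Lemma cvg_normc (T : Type) (F : set_system T) (FF : Filter F)
    (f : T -> C) (l : C) :
  f @ F --> l <-> forall e : R, 0 < e -> \forall t \near F, normc (l - f t) < e.
Proof.
split=> [fl e e0|fl].
  have e0' : 0 < (e%:C)%C :> C by rewrite ltcR.
  apply: filterS (cvg_ball fl e0') => t.
  by rewrite /ball /= normr_normc ltcR.
apply/cvg_ballP => _ /gt0_complexE[d d0 ->].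
by apply: filterS (fl d d0) => t H; rewrite /ball /= normr_normc ltcR.
Qed.

Lemma derive_entrywise n (f : 'cV[C]_n -> 'cV[C]_n) (z v g : 'cV[C]_n) :
  (forall i (e : R), 0 < e -> exists2 d : R, 0 < d & forall h : C,
     h != 0 -> normc h < d ->
     normc (g i 0 - h^-1 * (f (h *: v + z) i 0 - f z i 0)) < e) ->
  'D_v f z = g.
Proof.
move=> H; apply: cvg_lim => //.
apply/mx_cvg_entry => i j e e0; rewrite (ord1 j).
have [d d0 dH] := H i e e0.
apply/nbhs_ballP; exists (d%:C)%C => /=; first by rewrite ltcR.
move=> h hd h0; rewrite !mxE; apply: dH => //.
by move: hd; rewrite /ball /= sub0r normrN normr_normc ltcR.
Qed.

End EntrywiseTopology.

(** * Truncations as jets of germs *)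

Section Truncation.
Variables (R : realType) (n : nat).
Local Notation C := R[i].
Local Notation V := 'cV[C]_n.
Implicit Types (a : multinom n -> V) (f : V -> V).

Definition trunc a N (i : 'I_n) : mpoly n C :=
  \sum_(m : bmultinom n N.+1) a m i 0 *: mpolyX C m.

Definition pt (z : V) : 'I_n -> C := fun j => z j 0.

Lemma mcoeff_trunc a N i m :
  mcoeff m (trunc a N i) = if (mdeg m <= N)%N then a m i 0 else 0.
Proof.
case: leqP => mN; first exact: (mcoeff_mpoly (fun m => a m i 0)).
rewrite raddf_sum /= big1 // => k _; rewrite mcoeffZ mcoeffX.
case: eqP => [km|]; last by rewrite mulr0.
by have := bmdeg k; rewrite km ltnNge mN.
Qed.

Lemma msize_trunc a N i : (msize (trunc a N i) <= N.+1)%N.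
Proof.
rewrite msizeE; apply/bigmax_leqP_seq => m; rewrite mcoeff_msupp mcoeff_trunc.
by have [mN|_] := leqP (mdeg m) N; [rewrite ltnS mN | rewrite eqxx].
Qed.

Lemma trunc_compat a N M i : (N <= M)%N -> low N.+1 (trunc a M i - trunc a N i).
Proof.
move=> NM m; rewrite ltnS => mN.
by rewrite mcoeffB !mcoeff_trunc mN (leq_trans mN NM) subrr.
Qed.

Lemma homog_part_meval a N k z i : (k <= N)%N ->
  homog_part a k z i 0 = meval (pt z) (hpart k (trunc a N i)).
Proof.
move=> kN; rewrite /homog_part summxE.
have -> : hpart k (trunc a N i) =
    \sum_(m : bmultinom n k.+1 | mdeg m == k) a m i 0 *: mpolyX C m.
  apply/mpolyP => m; rewrite mcoeff_hpart mcoeff_trunc big_mkcond /=.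
  rewrite (eq_bigr (fun m : bmultinom n k.+1 =>
    (if mdeg m == k then a m i 0 else 0) *: mpolyX C m)) => [|l _]; last first.
    by case: ifP => // _; rewrite scale0r.
  case: (leqP (mdeg m) k) => [mk|km].
    rewrite (mcoeff_mpoly (fun m => if mdeg m == k then a m i 0 else 0)) //.
    by rewrite (leq_trans mk kN).
  rewrite (gtn_eqF km) raddf_sum /= big1 // => l _; rewrite mcoeffZ mcoeffX.
  case: (bmnm l =P m) => [lm|]; last by rewrite mulr0.
  by have := bmdeg l; rewrite lm ltnS leqNgt km.
rewrite raddf_sum /=; apply: eq_bigr => m _.
by rewrite mxE mevalZ mevalX mulrC.
Qed.

Lemma series_meval a N z i :
  series (fun k => homog_part a k z) N.+1 i 0 = meval (pt z) (trunc a N i).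
Proof.
rewrite /series /= big_mkord summxE (hpart_sum (msize_trunc a N i)) raddf_sum /=.
by apply: eq_bigr => k _; apply: homog_part_meval; rewrite -ltnS.
Qed.

Lemma rmon_const (rho : R) (m : multinom n) : rmon (fun=> rho) m = rho ^+ mdeg m.
Proof. by rewrite /rmon mdegE -prodrXr. Qed.

(** The form of [has_power_series] used below: one bound [H] for all truncations in the weighted
    norm, and convergence of the truncations in each entry. *)
Definition power_series_on (f : V -> V) a (rho H : R) :=
  [/\ 0 < rho, 0 <= H,
      forall N i, wnorm (fun=> rho) (trunc a N i) <= H
    & forall z : V, (forall j, normc (z j 0) < rho) -> forall i (e : R), 0 < e ->
        \forall N \near \oo, normc (f z i 0 - meval (pt z) (trunc a N i)) < e].

Lemma has_power_series_on f a : has_power_series f a ->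
  exists rho H, power_series_on f a rho H.
Proof.
move=> [rho rho0 [/choice[M MP] fP]]; exists rho, (\sum_i `|M i|); split=> //.
- by apply: sumr_ge0.
- move=> N i; rewrite (bigD1 i) //= ler_wpDr ?sumr_ge0 //.
  apply: le_trans (ler_norm _); rewrite (wnormE _ (msize_trunc a N i)).
  apply: le_trans (MP i N.+1); apply: ler_sum => m _.
  by rewrite rmon_const mcoeff_trunc -ltnS bmdeg.
- move=> z zrho i e e0; have /mx_cvg_entry/(_ i 0 e e0) := fP z zrho.
  move=> [N0 _ N0P]; exists N0 => // N /= N0N.
  by rewrite -series_meval; apply: N0P => /=; exact: leq_trans (leqnSn N).
Qed.

Lemma trunc_tail f a rho H : power_series_on f a rho H ->
  forall (s : R) (z : V) N i, 0 <= s -> s < rho -> (forall j, normc (z j 0) <= s) ->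
  normc (f z i 0 - meval (pt z) (trunc a N i)) <= H * (s / rho) ^+ N.+1.
Proof.
move=> [rho0 H0 aH fP] s z N i s0 srho zs; apply/ler_addgt0Pl => e e0.
have zrho j : normc (z j 0) < rho by exact: le_lt_trans srho.
have [N1 _ N1P] := fP z zrho i e e0.
pose M := maxn N N1; have NM : (N <= M)%N by rewrite leq_maxl.
have := N1P M (leq_maxr _ _) => /= fM.
rewrite -[f z i 0](subrK (meval (pt z) (trunc a M i))) -addrA -mevalB.
apply: le_trans (ler_normcD _ _) _; apply: lerD; first exact: ltW.
apply: le_trans (@normc_meval _ _ (fun=> s) (fun=> s0) (pt z) _ zs) _.
have srho1 : 0 <= s / rho <= 1.
  by rewrite divr_ge0 ?(ltW rho0) //= ler_pdivrMr // mul1r ltW.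
have -> : (fun=> s) = (fun _ : 'I_n => s / rho * rho).
  by apply/funext => j; rewrite divfK // gt_eqF.
apply: le_trans (wnorm_low (r := fun=> rho) _ srho1 (trunc_compat a i NM)) _.
  by move=> _; exact: ltW.
rewrite mulrC ler_wpM2r ?exprn_ge0 //; first by have [] := andP srho1.
apply: le_trans (aH M i); apply: wnorm_dominated => [_|m]; first exact: ltW.
rewrite mcoeffB !mcoeff_trunc; have [mN|Nm] := leqP (mdeg m) N.
  by rewrite (leq_trans mN NM) subrr ComplexField.Normc.normc0 normc_ge0.
by rewrite subr0.
Qed.

(** Agreement up to O(|z|^(N+1)). It is stable under sums, products and substitution, and by
    [approx_uniq] it determines [p] up to degree [N], so that the power series of a composite is
    never formed. *)
Definition approx N (g : V -> C) (p : mpoly n C) :=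
  exists (K s0 : R), [/\ 0 <= K, 0 < s0 & forall (s : R) (z : V), 0 < s -> s <= s0 ->
    (forall j, normc (z j 0) <= s) -> normc (g z - meval (pt z) p) <= K * s ^+ N.+1].

Lemma approx_trunc f a rho H N i : power_series_on f a rho H ->
  approx N (fun z => f z i 0) (trunc a N i).
Proof.
move=> psf; have [rho0 H0 aH fP] := psf.
exists (H / rho ^+ N.+1), (rho / 2); split.
- by rewrite divr_ge0 // exprn_ge0 // ltW.
- by rewrite divr_gt0.
- move=> s z s0 srho zs; rewrite -mulrA [_^-1 * _]mulrC -expr_div_n.
  apply: trunc_tail => //; first exact: ltW.
  by apply: le_lt_trans srho _; rewrite gtr_pMr // invf_lt1 // ltr1n.
Qed.

Lemma approx_meval N p : approx N (fun z => meval (pt z) p) p.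
Proof.
exists 0, 1; split=> // s z _ _ _.
by rewrite subrr ComplexField.Normc.normc0 mul0r.
Qed.

Lemma approx_bounded N g p : approx N g p ->
  exists (B s0 : R), [/\ 0 <= B, 0 < s0 & forall (s : R) (z : V), 0 < s -> s <= s0 ->
    (forall j, normc (z j 0) <= s) -> normc (g z) <= B /\ normc (meval (pt z) p) <= B].
Proof.
move=> [K [s0 [K0 s00 gp]]]; pose w := wnorm (fun=> 1) p.
have w0 : 0 <= w by exact: wnorm_ge0.
exists (K + w), (Num.min s0 1); split; first by rewrite addr_ge0.
  by rewrite lt_min s00 ltr01.
move=> s z sgt0; rewrite le_min => /andP[ss0 s1] zs.
have pw : normc (meval (pt z) p) <= w.
  by apply: normc_meval => // j; exact: le_trans (zs j) s1.
split; last by rewrite ler_wpDl.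
rewrite -[g z](subrK (meval (pt z) p)).
apply: le_trans (ler_normcD _ _) (lerD _ pw).
apply: le_trans (gp s z sgt0 ss0 zs) _.
by rewrite ler_piMr // exprn_ile1 // ltW.
Qed.

Lemma approxD N g h p q : approx N g p -> approx N h q ->
  approx N (fun z => g z + h z) (p + q).
Proof.
move=> [K [s0 [K0 s00 gp]]] [K' [s0' [K'0 s0'0 hq]]].
exists (K + K'), (Num.min s0 s0'); split; first by rewrite addr_ge0.
  by rewrite lt_min s00.
move=> s z sgt0; rewrite le_min => /andP[ss0 ss0'] zs.
rewrite mevalD opprD addrACA mulrDl.
exact: le_trans (ler_normcD _ _) (lerD (gp s z sgt0 ss0 zs) (hq s z sgt0 ss0' zs)).
Qed.

Lemma approxM N g h p q : approx N g p -> approx N h q ->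
  approx N (fun z => g z * h z) (p * q).
Proof.
move=> gp hq; have [B [s1 [B0 s10 gB]]] := approx_bounded gp.
have [B' [s1' [B'0 s1'0 hB]]] := approx_bounded hq.
have [K [s0 [K0 s00 {}gp]]] := gp; have [K' [s0' [K'0 s0'0 {}hq]]] := hq.
exists (K * B' + B * K'), (Num.min (Num.min s0 s0') (Num.min s1 s1')).
split; first by rewrite addr_ge0 ?mulr_ge0.
  by rewrite !lt_min s00 s0'0 s10.
move=> s z sgt0; rewrite !le_min => /andP[/andP[ss0 ss0'] /andP[ss1 ss1']] zs.
rewrite mevalM mulrB_telescope [leRHS]mulrDl; apply: le_trans (ler_normcD _ _) _.
rewrite !ComplexField.Normc.normcM; apply: lerD.
  rewrite mulrAC; apply: ler_pM; rewrite ?normc_ge0 //; first exact: gp.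
  by have [] := hB s z sgt0 ss1' zs.
rewrite -mulrA; apply: ler_pM; rewrite ?normc_ge0 //; last exact: hq.
by have [] := gB s z sgt0 ss1 zs.
Qed.

Lemma approx_msubst N (u : V -> V) (q : 'I_n -> mpoly n C) p :
  (forall i, approx N (fun z => u z i 0) (q i)) ->
  approx N (fun z => meval (pt (u z)) p) (msubst q p).
Proof.
move=> uq; elim/mpoly_ring_ind: p => [c|i|p p' IHp IHp'|p p' IHp IHp'].
- rewrite msubstC; have := approx_meval N (mpolyC n c).
  by congr approx; apply/funext => z; rewrite !mevalC.
- rewrite msubst_var; have := uq i.
  by congr approx; apply/funext => z; rewrite mevalXU.
- rewrite msubstD; have := approxD IHp IHp'.
  by congr approx; apply/funext => z; rewrite mevalD.
- rewrite msubstM; have := approxM IHp IHp'.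
  by congr approx; apply/funext => z; rewrite mevalM.
Qed.

Lemma approx_near N g h p : (\forall z \near (0 : V), g z = h z) ->
  approx N g p -> approx N h p.
Proof.
move=> /near_polydisc[s1 s10 gh] [K [s0 [K0 s00 gp]]].
exists K, (Num.min s0 (s1 / 2)); split=> //.
  by rewrite lt_min s00 divr_gt0.
move=> s z sgt0; rewrite le_min => /andP[ss0 ss1] zs.
rewrite -gh; first exact: gp.
move=> i j; rewrite (ord1 j) mxE sub0r normcNE.
apply: le_lt_trans (zs i) _; apply: le_lt_trans ss1 _.
by rewrite gtr_pMr // invf_lt1 // ltr1n.
Qed.

Lemma le0_small (x K s0 : R) : 0 <= K -> 0 < s0 ->
  (forall s, 0 < s -> s <= s0 -> x <= K * s) -> x <= 0.
Proof.
move=> K0 s00 xK; apply/ler_addgt0Pl => e e0; rewrite addr0.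
pose s := Num.min s0 (e / (K + 1)).
have K1 : 0 < K + 1 by rewrite ltr_wpDl.
have sgt0 : 0 < s by rewrite lt_min s00 divr_gt0.
apply: le_trans (xK s sgt0 _) _; first by rewrite ge_min lexx.
apply: le_trans (_ : K * (e / (K + 1)) <= _).
  by rewrite ler_wpM2l // ge_min lexx orbT.
by rewrite mulrCA ler_piMr ?(ltW e0) // ler_pdivrMr // mul1r lerDl.
Qed.

(** On the polydisc of radius s, [p - q] is O(s^(N+1)). By Cauchy's estimate its coefficients of
    degree at most [N] are therefore O(s) as s tends to 0. *)
Lemma approx_uniq N g p q : approx N g p -> approx N g q -> low N.+1 (p - q).
Proof.
move=> [K [s0 [K0 s00 gp]]] [K' [s0' [K'0 s0'0 gq]]] m; rewrite ltnS => mN.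
apply: ComplexField.Normc.eq0_normc; apply: le_anti; rewrite normc_ge0 andbT.
apply: (@le0_small _ (K + K') (Num.min 1 (Num.min s0 s0'))).
- by rewrite addr_ge0.
- by rewrite !lt_min ltr01 s00.
move=> s sgt0; rewrite !le_min => /and3P[s1 ss0 ss0'].
have := @cauchy_estimate _ _ (fun=> s) (p - q) ((K + K') * s ^+ N.+1) m
  (fun=> ltW sgt0).
rewrite rmon_const -ler_pdivlMr ?exprn_gt0 // => /(_ _)/le_trans; apply.
  move=> z zs; pose v : V := \col_j z j.
  have ptv : pt v = z by apply/funext => j; rewrite /pt mxE.
  have vs j : normc (v j 0) <= s by rewrite mxE.
  rewrite mevalB -ptv -[meval _ p - _](subrKA (g v)) mulrDl.
  apply: le_trans (ler_normcD _ _) (lerD _ _); last exact: gq.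
  by rewrite -normcNE opprB; exact: gp.
rewrite -mulrA ler_wpM2l ?addr_ge0 //.
rewrite ler_pdivrMr ?exprn_gt0 // -exprS; apply: ler_wiXn2l => //.
exact: ltW.
Qed.

End Truncation.

(** * Truncations of a composite *)

Section Composition.
Variables (R : realType) (n : nat).
Local Notation C := R[i].
Local Notation V := 'cV[C]_n.

Lemma meval0_mcoeff (p : mpoly n C) : meval (fun=> 0) p = mcoeff mnm0 p.
Proof.
elim/mpoly_ring_ind: p => [c|i|p q IHp IHq|p q IHp IHq].
- by rewrite mevalC mcoeffC eqxx mulr1.
- by rewrite mevalXU mcoeffX mnm1_eq0.
- by rewrite mevalD mcoeffD IHp IHq.
- by rewrite mevalM rmorphM /= IHp IHq.
Qed.

Lemma pt0 : pt (0 : V) = fun=> 0.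
Proof. by apply/funext => j; rewrite /pt mxE. Qed.

Lemma power_series_at0 (f : V -> V) a rho H i :
  power_series_on f a rho H -> f 0 i 0 = a mnm0 i 0.
Proof.
move=> psf; have [rho0 H0 _ _] := psf.
have z0 j : normc ((0 : V) j 0) <= 0.
  by rewrite mxE ComplexField.Normc.normc0.
have := trunc_tail psf 0 i (lexx 0) rho0 z0; rewrite mul0r expr1 mulr0 => h.
have /ComplexField.Normc.eq0_normc/eqP :
    normc (f 0 i 0 - meval (pt 0) (trunc a 0 i)) = 0.
  by apply/le_anti; rewrite h normc_ge0.
by rewrite subr_eq0 => /eqP ->; rewrite pt0 meval0_mcoeff mcoeff_trunc mdeg0.
Qed.

(** As [u 0 = 0], u(z) = O(|z|), so that the tail of [f] beyond degree [N], evaluated at u(z), is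
    O(|z|^(N+1)). *)
Lemma trunc_comp (f u b : V -> V) af au rf Hf ru Hu N i q :
  power_series_on f af rf Hf -> power_series_on u au ru Hu ->
  approx N (fun z => b z i 0) q -> u 0 = 0 ->
  (\forall z \near (0 : V), f (u z) = b z) ->
  low N.+1 (msubst (trunc au N) (trunc af N i) - q).
Proof.
move=> psf psu apb u0 fub; have [rf0 Hf0 _ _] := psf.
apply: (@approx_uniq _ _ N (fun z => f (u z) i 0)); last first.
  apply: approx_near apb.
  by apply: filterS fub => z ->.
(* The truncation at degree 0 is the constant term of [u], which is 0, so [approx_trunc] at degree 0
   is a linear bound on [u]. *)
have uP : forall j, exists Ks : R * R, [/\ 0 <= Ks.1, 0 < Ks.2 &
    forall (s : R) (z : V), 0 < s -> s <= Ks.2 ->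
    (forall j, normc (z j 0) <= s) -> normc (u z j 0) <= Ks.1 * s].
  move=> j; have [K [s0 [K0 s00 ap]]] := approx_trunc 0 j psu.
  exists (K, s0); split=> // s z sgt0 ss0 zs; have := ap s z sgt0 ss0 zs.
  rewrite expr1; congr (normc _ <= _).
  rewrite [X in _ - X](_ : _ = 0) ?subr0 //.
  rewrite (_ : trunc au 0 j = 0) ?meval0 //; apply/mpolyP => m.
  rewrite mcoeff_trunc mcoeff0 leqn0 mdeg_eq0; case: eqP => // ->.
  by rewrite -(power_series_at0 j psu) u0 mxE.
have [Ks KsP] := choice uP.
pose K := \sum_j (Ks j).1; pose s0 := \big[Num.min/1]_j (Ks j).2.
have K0 : 0 <= K by apply: sumr_ge0 => j _; have [] := KsP j.
have s00 : 0 < s0 by apply/bigmin_gtP; split=> // j _; have [] := KsP j.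
have uK (s : R) (z : V) : 0 < s -> s <= s0 -> (forall j, normc (z j 0) <= s) ->
    forall j, normc (u z j 0) <= K * s.
  move=> sgt0 ss0 zs j; have [Kj0 _ /(_ s z sgt0 _ zs)] := KsP j.
  have sj : s <= (Ks j).2 by apply: le_trans ss0 _; exact: bigmin_le.
  move=> /(_ sj)/le_trans; apply; rewrite ler_wpM2r ?(ltW sgt0) //.
  by rewrite /K (bigD1 j) //= lerDl sumr_ge0 // => j' _; have [] := KsP j'.
suff err : approx N (fun z => f (u z) i 0 - meval (pt (u z)) (trunc af N i)) 0.
  have := approxD (approx_msubst (trunc af N i) (fun j => approx_trunc N j psu)) err.
  by rewrite addr0; congr approx; apply/funext => z; rewrite subrKC.
(* The second bound on the radius keeps [K * s] below [rf], where the tail of [f] is controlled. *)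
exists (Hf * (K / rf) ^+ N.+1), (Num.min s0 (rf / (2 * (K + 1)))).
have K1 : 0 < K + 1 by rewrite ltr_wpDl.
split.
- by rewrite mulr_ge0 // exprn_ge0 // divr_ge0 // ltW.
- by rewrite lt_min s00 divr_gt0 // mulr_gt0.
move=> s z sgt0; rewrite le_min => /andP[ss0 srf] zs; rewrite meval0 subr0.
have Ks0 : 0 <= K * s by rewrite mulr_ge0 // ltW.
rewrite -mulrA -exprMn mulrAC.
apply: trunc_tail => //; last exact: uK.
apply: le_lt_trans (_ : K * (rf / (2 * (K + 1))) < _); first by rewrite ler_wpM2l.
rewrite mulrCA gtr_pMr // ltr_pdivrMr ?mulr_gt0 // mul1r.
by clear -K0; lra.
Qed.

End Composition.

Section RealLimits.
Variable R : realType.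
Local Notation C := R[i].

(** The limit is the supremum of the lower bounds [u N - K / 2 ^+ N], all of which lie below every
    [u M + K / 2 ^+ M]; the rate of convergence comes with it. *)
Lemma geometric_limit (u : nat -> R) (K : R) :
  (forall N M, (N <= M)%N -> `|u M - u N| <= K / 2 ^+ N) ->
  exists l, forall N, `|l - u N| <= K / 2 ^+ N.
Proof.
move=> uK; pose S := [set x | exists N, x = u N - K / 2 ^+ N].
have K0 : 0 <= K.
  by have := uK 0%N 0%N (leqnn _); rewrite subrr normr0 expr0 divr1.
have SM M : ubound S (u M + K / 2 ^+ M).
  move=> _ [N ->].
  have kN k : 0 <= K / 2 ^+ k by rewrite divr_ge0 // exprn_ge0.
  have [NM|/ltnW MN] := leqP N M.
    by have := uK N M NM; rewrite ler_distl => /andP[+ _]; have := kN M; lra.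
  by have := uK M N MN; rewrite ler_distl => /andP[_]; have := kN N; lra.
have Ssup : has_sup S.
  by split; [exists (u 0%N - K / 2 ^+ 0), 0%N | exists (u 0%N + K / 2 ^+ 0); apply: SM].
exists (sup S) => N; rewrite ler_distl; apply/andP; split.
  by apply: ub_le_sup; [case: Ssup | exists N].
by apply: ge_sup; [case: Ssup | apply: SM].
Qed.

Lemma normc_Re_Im (z : C) : normc z <= `|complex.Re z| + `|complex.Im z|.
Proof.
case: z => a b; have E : (a +i* b)%C = (a +i* 0)%C + (0 +i* b)%C by simpc.
rewrite {1}E; apply: le_trans (ler_normcD _ _) _.
by rewrite /normc /= expr0n /= addr0 add0r !sqrtr_sqr.
Qed.

Lemma Re_le_normc (z : C) : `|complex.Re z| <= normc z.
Proof.
by case: z => a b /=; rewrite -[leLHS]sqrtr_sqr ler_sqrt ?addr_ge0 ?sqr_ge0 // lerDl sqr_ge0.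
Qed.

Lemma Im_le_normc (z : C) : `|complex.Im z| <= normc z.
Proof.
by case: z => a b /=; rewrite -[leLHS]sqrtr_sqr ler_sqrt ?addr_ge0 ?sqr_ge0 // lerDr sqr_ge0.
Qed.

Lemma geometric_limitC (u : nat -> C) (K : R) :
  (forall N M, (N <= M)%N -> normc (u M - u N) <= K / 2 ^+ N) ->
  exists l, forall N, normc (l - u N) <= 2 * K / 2 ^+ N.
Proof.
move=> uK.
have [a aP] : exists a, forall N, `|a - complex.Re (u N)| <= K / 2 ^+ N.
  apply: geometric_limit => N M /uK; apply: le_trans.
  by apply: le_trans (Re_le_normc _); rewrite raddfB.
have [b bP] : exists b, forall N, `|b - complex.Im (u N)| <= K / 2 ^+ N.
  apply: geometric_limit => N M /uK; apply: le_trans.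
  by apply: le_trans (Im_le_normc _); rewrite raddfB.
exists (a +i* b)%C => N; apply: le_trans (normc_Re_Im _) _.
rewrite !raddfB /= -mulrA mulr_natl mulr2n; exact: lerD.
Qed.

End RealLimits.

(** * Termwise differentiation *)

Section Differentiation.
Variables (R : realType) (n : nat).
Local Notation C := R[i].
Local Notation V := 'cV[C]_n.

Lemma normc_natr k : normc (k%:R : C) = k%:R.
Proof.
rewrite -[k%:R in LHS](rmorph_nat (@real_complex R)) /normc /= expr0n addr0.
by rewrite sqrtr_sqr ger0_norm.
Qed.

Lemma power_second_order (sigma : R) (x h : C) k : 0 < sigma ->
  normc x <= sigma -> normc h <= sigma ->
  normc ((x + h) ^+ k - x ^+ k - h * (k%:R * x ^+ k.-1)) <=
    (normc h / sigma) ^+ 2 * (2 * sigma) ^+ k.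
Proof.
move=> s0 xs hs; pose q := (normc h / sigma) ^+ 2.
have q0 : 0 <= q by rewrite exprn_ge0 // divr_ge0 ?normc_ge0 // ltW.
pose E k := (x + h) ^+ k - x ^+ k - h * (k%:R * x ^+ k.-1).
(* [2 ^+ k - 1 - k%:R] is the sum of the binomial coefficients of index at least 2; unlike the
   weaker bound it passes through the induction. *)
suff IH : normc (E k) <= q * ((2 ^+ k - 1 - k%:R) * sigma ^+ k).
  apply: le_trans IH _; rewrite -/q [(2 * sigma) ^+ k]exprMn; apply: ler_wpM2l => //.
  rewrite ler_wpM2r ?exprn_ge0 ?(ltW s0) //.
  by rewrite -addrA gerDl -opprD oppr_le0 addr_ge0 // ler0n.
elim: k => [|k IH].
  rewrite /E !expr0 mul0r mulr0 !subrr ComplexField.Normc.normc0.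
  by rewrite !mul0r mulr0.
have -> : E k.+1 = (x + h) * E k + h ^+ 2 * (k%:R * x ^+ k.-1).
  rewrite /E !exprS -natr1 /=; case: (k) => [|l] /=.
    by rewrite !expr0; ring.
  by rewrite !exprS; ring.
apply: le_trans (ler_normcD _ _) _.
rewrite !ComplexField.Normc.normcM normc_natr !normcX.
have b1 : normc (x + h) * normc (E k) <=
    2 * sigma * (q * ((2 ^+ k - 1 - k%:R) * sigma ^+ k)).
  apply: ler_pM; rewrite ?normc_ge0 //.
  by apply: le_trans (ler_normcD _ _) _; rewrite mulr_natl mulr2n; exact: lerD.
have b2 : normc h ^+ 2 * (k%:R * normc x ^+ k.-1) <= q * (k%:R * sigma ^+ k.+1).
  have -> : normc h ^+ 2 = q * sigma ^+ 2.
    by rewrite /q expr_div_n divfK // expf_neq0 // gt_eqF.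
  case: (k) => [|l]; first by rewrite !mul0r !mulr0.
  rewrite -mulrA; apply: ler_wpM2l => //; rewrite mulrCA; apply: ler_wpM2l => //.
  rewrite (_ : sigma ^+ l.+2 = sigma ^+ 2 * sigma ^+ l); last by rewrite -exprD.
  apply: ler_wpM2l; first by rewrite exprn_ge0 // ltW.
  by rewrite lerXn2r ?nnegrE ?normc_ge0 ?(ltW s0).
apply: le_trans (lerD b1 b2) _; rewrite -natr1 !exprS.
by rewrite le_eqVlt; apply/orP; left; apply/eqP; ring.
Qed.

Definition shift_pt (z : 'I_n -> C) k (h : C) : 'I_n -> C :=
  fun j => if j == k then z k + h else z j.

Lemma meval_second_order (sigma : R) (z : 'I_n -> C) k h (p : mpoly n C) :
  0 < sigma -> (forall j, normc (z j) <= sigma) -> normc h <= sigma ->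
  normc (meval (shift_pt z k h) p - meval z p - h * meval z (mderiv k p)) <=
    (normc h / sigma) ^+ 2 * wnorm (fun=> 2 * sigma) p.
Proof.
move=> s0 zs hs.
have -> : meval (shift_pt z k h) p - meval z p - h * meval z (mderiv k p) =
    \sum_(m <- msupp p) mcoeff m p * (meval (shift_pt z k h) (mpolyX C m)
      - meval z (mpolyX C m) - h * meval z (mderiv k (mpolyX C m))).
  have evalE y : meval y p = \sum_(m <- msupp p) mcoeff m p * meval y (mpolyX C m).
    rewrite {1}(mpolyE p) raddf_sum /=; apply: eq_bigr => m _; exact: mevalZ.
  have derivE : mderiv k p = \sum_(m <- msupp p) mcoeff m p *: mderiv k (mpolyX C m).
    by rewrite {1}(mpolyE p) raddf_sum /=; apply: eq_bigr => m _; exact: mderivZ.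
  have dE : meval z (mderiv k p) =
      \sum_(m <- msupp p) mcoeff m p * meval z (mderiv k (mpolyX C m)).
    by rewrite derivE raddf_sum /=; apply: eq_bigr => m _; exact: mevalZ.
  rewrite !evalE dE mulr_sumr -!sumrB.
  by apply: eq_bigr => m _; rewrite !mulrBr [h * _]mulrCA.
rewrite /wnorm mulr_sumr.
apply: le_trans (ler_normc_sum _ _ _) _; apply: ler_sum => m _.
rewrite mderivX mevalZ !mevalX.
pose P := \prod_(j | j != k) z j ^+ m j.
have E1 : \prod_j shift_pt z k h j ^+ m j = (z k + h) ^+ m k * P.
  rewrite (bigD1 k) //= /shift_pt eqxx; congr (_ * _).
  by apply: eq_bigr => j /negbTE ->.
have E2 : \prod_j z j ^+ m j = z k ^+ m k * P by rewrite (bigD1 k).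
have E3 : \prod_j z j ^+ (mnm_sub m (mnm1 k)) j = z k ^+ (m k).-1 * P.
  rewrite (bigD1 k) //= mnmBE mnm1E eqxx subn1; congr (_ * _).
  by apply: eq_bigr => j jk; rewrite mnmBE mnm1E eq_sym (negbTE jk) subn0.
rewrite E1 E2 E3.
have -> : (z k + h) ^+ m k * P - z k ^+ m k * P
    - h * ((m k)%:R * (z k ^+ (m k).-1 * P)) =
    ((z k + h) ^+ m k - z k ^+ m k - h * ((m k)%:R * z k ^+ (m k).-1)) * P.
  by ring.
rewrite ComplexField.Normc.normcM [leRHS]mulrCA.
apply: ler_wpM2l; first exact: normc_ge0.
rewrite ComplexField.Normc.normcM /rmon (bigD1 k) //= [leRHS]mulrA; apply: ler_pM; rewrite ?normc_ge0 //.
  exact: power_second_order.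
rewrite normc_prod; apply: ler_prod => j _; rewrite normc_ge0 normcX /=.
rewrite lerXn2r ?nnegrE ?normc_ge0 ?mulr_ge0 ?(ltW s0) //.
by apply: le_trans (zs j) _; rewrite ler_peMl ?(ltW s0) // ler1n.
Qed.

(** The factor [m k] of the derivative is at most 2^(mdeg m), which doubling the radius absorbs. *)
Lemma wnorm_deriv (sigma : R) k (p : mpoly n C) : 0 < sigma ->
  wnorm (fun=> sigma) (mderiv k p) <= sigma^-1 * wnorm (fun=> 2 * sigma) p.
Proof.
move=> s0; have s0' (j : 'I_n) : 0 <= sigma by exact: ltW.
rewrite [in mderiv k p](mpolyE p) raddf_sum /=.
apply: le_trans (wnorm_sum s0' _ _ _) _; rewrite [in leRHS]/wnorm mulr_sumr.
apply: ler_sum => m _; rewrite mderivZ mderivX !wnormZ wnormX.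
rewrite [leRHS]mulrCA; apply: ler_wpM2l; first exact: normc_ge0.
rewrite normc_natr !rmon_const; have [->|mk] := eqVneq (m k) 0%N.
  rewrite mul0r mulr_ge0 ?invr_ge0 ?(ltW s0) //.
  by rewrite exprn_ge0 // mulr_ge0 // ltW.
have mkm : (m k <= mdeg m)%N by rewrite mdegE (bigD1 k) //= leq_addr.
have dm : mdeg m = (mdeg (mnm_sub m (mnm1 k))).+1.
  by rewrite -[in LHS](submK (_ : lem (mnm1 k) m)) ?lep1mP // mdegD mdeg1 addn1.
have -> : sigma^-1 * (2 * sigma) ^+ mdeg m =
    2 ^+ mdeg m * sigma ^+ mdeg (mnm_sub m (mnm1 k)).
  by rewrite exprMn mulrCA dm [sigma ^+ _.+1]exprS mulKf // gt_eqF.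
apply: ler_wpM2r; first by rewrite exprn_ge0 // ltW.
by rewrite -natrX ler_nat; apply: leq_trans mkm _; apply: ltnW; exact: ltn_expl.
Qed.

End Differentiation.

Lemma geometric_small (R : realType) (K e : R) : 0 <= K -> 0 < e ->
  exists N0, forall N, (N0 <= N)%N -> K / 2 ^+ N <= e.
Proof.
move=> K0 e0; exists (Num.bound (K / e)) => N N0N.
rewrite ler_pdivrMr ?exprn_gt0 // mulrC -ler_pdivrMr //.
apply: le_trans (ltW (archi_boundP _)) _; first by rewrite divr_ge0 // ltW.
by rewrite -natrX ler_nat; apply: leq_trans N0N _; apply: ltnW; exact: ltn_expl.
Qed.

Section Jacobian.
Variables (R : realType) (n : nat).
Local Notation C := R[i].
Local Notation V := 'cV[C]_n.
Variables (f : V -> V) (a : multinom n -> V) (rho H : R).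
Hypothesis psf : power_series_on f a rho H.

(** A point and an increment bounded by [sigma] add up to at most [2 * sigma = rho / 2], and at this
    radius the truncations converge like 2^-N. *)
Let sigma := rho / 4.

Let rho0 : 0 < rho. Proof. by case: psf. Qed.
Let H0 : 0 <= H. Proof. by case: psf. Qed.
Let s0 : 0 < sigma. Proof. exact: divr_gt0. Qed.

Let rho_half : (fun=> 2 * sigma) = (fun _ : 'I_n => 2^-1 * rho).
Proof. by apply/funext => j; rewrite /sigma; field. Qed.

Let half01 : 0 <= (2^-1 : R) <= 1.
Proof. by rewrite invr_ge0 ler0n invf_le1 // ler1n. Qed.

Lemma wnorm_trunc_diff N M i : (N <= M)%N ->
  wnorm (fun=> 2 * sigma) (trunc a M i - trunc a N i) <= H / 2 ^+ N.
Proof.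
move=> NM; have [_ _ aH _] := psf.
have rho0' (j : 'I_n) : 0 <= rho by exact: ltW.
rewrite rho_half.
apply: le_trans (wnorm_low (r := fun=> rho) rho0' half01 (trunc_compat a i NM)) _.
rewrite exprVn mulrC; apply: ler_pM.
- exact: wnorm_ge0.
- by rewrite invr_ge0 exprn_ge0.
- apply: le_trans (aH M i); apply: wnorm_dominated => // m.
  rewrite mcoeffB !mcoeff_trunc; have [mN|Nm] := leqP (mdeg m) N.
    by rewrite (leq_trans mN NM) subrr ComplexField.Normc.normc0 normc_ge0.
  by rewrite subr0.
- by rewrite lef_pV2 ?posrE ?exprn_gt0 // exprS ler_peMl ?exprn_ge0 // ler1n.
Qed.

Lemma derivative_limit (z : V) k : (forall j, normc (z j 0) <= sigma) ->
  exists g : V, 'D_(delta_mx k 0) f z = g /\ forall i N,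
    normc (g i 0 - meval (pt z) (mderiv k (trunc a N i)))
      <= 2 * (H / sigma) / 2 ^+ N.
Proof.
move=> zs; have [_ _ aH fP] := psf.
have s0' (j : 'I_n) : 0 <= sigma by exact: ltW.
have /choice[g gP] : forall i, exists l : C, forall N,
    normc (l - meval (pt z) (mderiv k (trunc a N i))) <= 2 * (H / sigma) / 2 ^+ N.
  move=> i; apply: geometric_limitC => N M NM.
  rewrite -mevalB -mderivB.
  apply: le_trans (@normc_meval _ _ (fun=> sigma) s0' (pt z) _ zs) _.
  apply: le_trans (wnorm_deriv _ _ s0) _.
  rewrite mulrC [leRHS]mulrAC ler_wpM2r ?invr_ge0 ?(ltW s0) //.
  exact: wnorm_trunc_diff.
exists (\col_i g i); split; last by move=> i N; rewrite mxE.
apply: derive_entrywise => i e e0; rewrite mxE.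
pose B := H / sigma ^+ 2.
have B0 : 0 <= B by rewrite divr_ge0 // exprn_ge0 // ltW.
have B1 : 0 < B + 1 by rewrite ltr_wpDl.
exists (Num.min sigma (e / (B + 1))); first by rewrite lt_min s0 divr_gt0.
move=> h h0; rewrite lt_min => /andP[hs he].
pose z' := h *: delta_mx k 0 + z.
have ptz' : pt z' = shift_pt (pt z) k h.
  apply/funext => j; rewrite /pt /shift_pt !mxE eqxx andbT.
  by case: eqP => [->|_]; rewrite ?mulr1 ?mulr0 ?add0r // addrC.
have srho : sigma + sigma < rho.
  rewrite (_ : sigma + sigma = rho / 2); last by rewrite /sigma; field.
  by rewrite gtr_pMr // invf_lt1 // ltr1n.
have z'rho j : normc (z' j 0) < rho.
  apply: le_lt_trans srho; rewrite -[z' j 0]/(pt z' j) ptz' /shift_pt.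
  case: eqP => _; last by apply: le_trans (zs j) _; rewrite lerDl ltW.
  by apply: le_trans (ler_normcD _ _) (lerD (zs k) (ltW hs)).
have zrho j : normc (z j 0) < rho.
  by apply: le_lt_trans (zs j) _; apply: lt_trans srho; rewrite ltrDl.
have nh0 : 0 < normc h.
  rewrite lt0r normc_ge0 andbT; apply: contraNneq h0.
  by move/ComplexField.Normc.eq0_normc ->.
apply: le_lt_trans (_ : normc h * B < _); last first.
  apply: le_lt_trans (_ : normc h * (B + 1) < _).
    by rewrite ler_wpM2l ?(ltW nh0) // lerDl.
  by rewrite -ltr_pdivlMr.
apply/ler_addgt0Pl => e1 e10.
(* The truncation [N] may depend on [h]: the errors of [f] at the two points get divided by [h],
   whereas the bound [normc h * B] does not depend on [N]. *)
have e20 : 0 < e1 * normc h / 4 by rewrite divr_gt0 // mulr_gt0.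
have [N1 N1P] := geometric_small (mulr_ge0 (ler0n _ 2) (divr_ge0 H0 (ltW s0)))
  (divr_gt0 e10 (ltr0n _ 2)).
have [N2 _ N2P] := fP z zrho i _ e20; have [N3 _ N3P] := fP z' z'rho i _ e20.
pose N := maxn N1 (maxn N2 N3).
have := N1P N (leq_maxl _ _); have /= := N2P N _; have /= := N3P N _.
rewrite !leq_max !leqnn !orbT => /(_ isT) e3 /(_ isT) e2 e4.
have := gP i N; set dT := meval _ (mderiv _ _) => gN.
pose T x := meval (pt x) (trunc a N i).
have e5 : normc (T z' - T z - h * dT) <= normc h * (normc h * B).
  rewrite /T ptz'.
  apply: le_trans (meval_second_order _ _ s0 zs (ltW hs)) _.
  have -> : normc h * (normc h * B) = (normc h / sigma) ^+ 2 * H.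
    by rewrite /B; field; rewrite gt_eqF.
  apply: ler_wpM2l; first by rewrite exprn_ge0 // divr_ge0 ?(ltW nh0) ?(ltW s0).
  apply: le_trans (aH N i); rewrite rho_half; apply: ler_wnorm => j.
  have [h00 h1] := andP half01.
  by rewrite mulr_ge0 ?(ltW rho0) //= ler_piMl ?(ltW rho0).
have -> : g i - h^-1 * (f z' i 0 - f z i 0) = (g i - dT)
   - h^-1 * ((T z' - T z - h * dT) + ((f z' i 0 - T z') - (f z i 0 - T z))).
  by field.
rewrite -normcNE opprD opprK; apply: le_trans (ler_normcD _ _) _.
rewrite normcNE ComplexField.Normc.normcM ComplexField.Normc.normcV.
apply: le_trans (lerD (le_trans gN e4) (lexx _)) _.
have e6 : normc (T z' - T z - h * dT + (f z' i 0 - T z' - (f z i 0 - T z)))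
    <= normc h * (normc h * B) + (e1 * normc h / 4 + e1 * normc h / 4).
  apply: le_trans (ler_normcD _ _) (lerD e5 _).
  apply: le_trans (ler_normcD _ _) (lerD (ltW e3) _).
  by rewrite normcNE ltW.
have -> : e1 + normc h * B = e1 / 2 + (normc h)^-1 *
    (normc h * (normc h * B) + (e1 * normc h / 4 + e1 * normc h / 4)).
  by field; rewrite gt_eqF.
by rewrite lerD2l ler_wpM2l // invr_ge0 ltW.
Qed.

End Jacobian.

(** * The Jacobian matrix at generic points *)

Section GenericRank.
Variables (R : realType) (n : nat).
Local Notation C := R[i].
Local Notation V := 'cV[C]_n.

Lemma jacobian_limit (f : V -> V) a rho H (z : V) i j N :
  power_series_on f a rho H -> (forall j, normc (z j 0) <= rho / 4) ->
  normc (jacobian_mx f z i j - meval (pt z) (jac (trunc a N) i j))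
    <= 2 * (H / (rho / 4)) / 2 ^+ N.
Proof.
move=> psf zs; have [g [gE gP]] := derivative_limit psf j zs.
by rewrite !mxE gE.
Qed.

Lemma jacobian_at0 (f : V -> V) a rho H i j :
  power_series_on f a rho H -> jacobian_mx f 0 i j = a (mnm1 j) i 0.
Proof.
move=> psf; have [rho0 H0 _ _] := psf; apply/eqP; rewrite -subr_eq0; apply/eqP.
apply: ComplexField.Normc.eq0_normc; apply: le_anti; rewrite normc_ge0 andbT.
apply/ler_addgt0Pl => e e0; rewrite addr0.
have K0 : 0 <= 2 * (H / (rho / 4)).
  by rewrite mulr_ge0 // divr_ge0 // divr_ge0 // ltW.
have [N0 /(_ N0.+1 (leqnSn _))] := geometric_small K0 e0; apply: le_trans.
have z0 k : normc ((0 : V) k 0) <= rho / 4.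
  by rewrite mxE ComplexField.Normc.normc0 divr_ge0 // ltW.
have := jacobian_limit i j N0.+1 psf z0.
rewrite pt0 [jac _ i j]mxE meval0_mcoeff mcoeff_deriv mcoeff_trunc add0m mdeg1 mnm0E.
exact.
Qed.

Lemma cvg_det (T : Type) (F : set_system T) (FF : Filter F) m
    (A : T -> 'M[C]_m) (L : 'M[C]_m) :
  (forall i j, A t i j @[t --> F] --> L i j) -> \det (A t) @[t --> F] --> \det L.
Proof.
move=> AL; rewrite /determinant.
apply: cvg_big => [|s _]; first exact: add_continuous.
apply: cvgM; first exact: cvg_cst.
by apply: cvg_big => [|i _]; [exact: mul_continuous | exact: AL].
Qed.

Lemma low_det_congr (K : idomainType) k d (A B : 'M[mpoly n K]_k) :
  (forall i j, low d (A i j - B i j)) -> low d (\det A - \det B).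
Proof.
move=> AB; rewrite /determinant -sumrB; apply: low_sum => s _.
rewrite -mulrBr; apply: lowMl.
elim/big_rec2: _ => [|i p q _ IH]; first by rewrite subrr; apply: low0.
rewrite mulrB_telescope; apply: lowD; first by apply: lowMr; exact: AB.
by apply: lowMl; exact: IH.
Qed.

Lemma wnorm_det (r : 'I_n -> R) k (A : 'M[mpoly n C]_k) (K : R) :
  (forall i, 0 <= r i) -> (forall i j, wnorm r (A i j) <= K) ->
  wnorm r (\det A) <= #|{: 'S_k}|%:R * K ^+ k.
Proof.
move=> r0 AK; apply: le_trans (wnorm_sum r0 _ _ _) _.
rewrite mulr_natl -sumr_const; apply: ler_sum => s _.
apply: le_trans (wnormM r0 _ _) _.
rewrite -[K ^+ k]mul1r; apply: ler_pM; rewrite ?wnorm_ge0 //.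
  apply: le_trans (wnorm_exp r0 _ _) _.
  by rewrite wnormN wnorm1 expr1n.
apply: le_trans (wnorm_prod r0 _ _ _) _.
rewrite -[k in K ^+ k]card_ord -prodr_const; apply: ler_prod => i _.
by rewrite wnorm_ge0 //= AK.
Qed.

Lemma meval_det (z : 'I_n -> C) k (A : 'M[mpoly n C]_k) :
  meval z (\det A) = \det (map_mx (meval z) A).
Proof. by rewrite det_map_mx. Qed.

(** If the order of the determinants grew without bound, the determinant of [jacobian_mx f] would
    vanish at all points near 0, against generic rank [n]. *)
Lemma generic_rank_order (f : V -> V) a rho H :
  power_series_on f a rho H -> generic_rank f n ->
  exists E N0, forall N, (N0 <= N)%N ->
     exists2 g, g != 0 & init E g (\det (jac (trunc a N))).
Proof.
move=> psf [_ gr]; have [rho0 H0 aH _] := psf.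
pose q N := \det (jac (trunc a N)).
have compat N M : (N <= M)%N -> low N (q M - q N).
  move=> NM; apply: low_det_congr => i j; rewrite !mxE -mderivB.
  by apply: low_deriv; apply: trunc_compat.
(* Differentiation costs one degree, whence [low N] and not [low N.+1]. If some [q N1] has order
   below [N1], its lowest part is that of all later [q N]. *)
have [[N1 qN1]|all_low] := pselect (exists N, ~ low N (q N)).
  have /init_exists[E [lE gE]] : q N1 != 0.
    by apply/eqP => q0; apply: qN1; rewrite q0; apply: low0.
  exists E, N1 => N N1N; exists (hpart E (q N1)) => //.
  rewrite -/(q N) -[q N](subrKC (q N1)) -[hpart _ _]addr0; apply: initD.
    exact: init_hpart.
  apply: low_init0; apply: lowW (compat _ _ N1N).
  by rewrite leqNgt; apply/negP => N1E; apply: qN1; apply: (lowW _ lE).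
have qlow N : low N (q N) by apply: contrapT => qN; apply: all_low; exists N.
pose sigma := rho / 4; have s0 : 0 < sigma by rewrite divr_gt0.
have [z zU zrank] : exists2 z : V, (forall j, normc (z j 0) < sigma / 2) &
    \rank (jacobian_mx f z) = n.
  have nb : nbhs (0 : V) [set z : V | forall j, normc (z j 0) < sigma / 2].
    apply/near_polydisc; exists (sigma / 2); first by rewrite divr_gt0.
    move=> x xs j; have := xs j 0; by rewrite mxE sub0r normcNE.
  by have [z zU zr] := gr _ nb; exists z.
have half_le : sigma / 2 <= sigma by rewrite ler_piMr ?(ltW s0) // invf_le1 // ler1n.
have zs j : normc (z j 0) <= sigma by apply: le_trans half_le; apply: ltW.
have det0 : \det (jacobian_mx f z) != 0.
  by rewrite -unitfE -unitmxE -row_free_unit /row_free zrank.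
have cvg1 : meval (pt z) (q N) @[N --> \oo] --> \det (jacobian_mx f z).
  rewrite (_ : (fun N => _) = fun N => \det (map_mx (meval (pt z)) (jac (trunc a N)))).
    apply: cvg_det => i j; apply/cvg_normc => e e0.
    have K0 : 0 <= 2 * (H / sigma) by rewrite mulr_ge0 // divr_ge0 // ltW.
    have [N0 N0P] := geometric_small K0 (divr_gt0 e0 (ltr0n R 2)).
    exists N0 => // N /= N0N; rewrite [X in _ - X]mxE.
    apply: le_lt_trans (jacobian_limit i j N psf zs) _.
    apply: le_lt_trans (N0P N N0N) _.
    by rewrite gtr_pMr // invf_lt1 // ltr1n.
  by apply/funext => N; rewrite meval_det.
have s0' (j : 'I_n) : 0 <= sigma by exact: ltW.
pose K := #|{: 'S_n}|%:R * (sigma^-1 * H) ^+ n.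
have K0 : 0 <= K.
  by rewrite mulr_ge0 ?ler0n // exprn_ge0 // mulr_ge0 // invr_ge0 ltW.
have wq N : wnorm (fun=> sigma) (q N) <= K.
  apply: wnorm_det => // i j; rewrite mxE; apply: le_trans (wnorm_deriv _ _ s0) _.
  apply: ler_wpM2l; first by rewrite invr_ge0 ltW.
  apply: le_trans (aH N i); apply: ler_wnorm => _.
  rewrite mulr_ge0 ?(ltW s0) //= (_ : 2 * sigma = rho / 2); last by rewrite /sigma; field.
  by rewrite ler_piMr ?(ltW rho0) // invf_le1 // ler1n.
(* [q N] has order at least [N] and norm at most [K] at radius [sigma], so it is at most K / 2^N at
   half this radius, where [z] was chosen. *)
have small N : normc (meval (pt z) (q N)) <= K / 2 ^+ N.
  apply: le_trans (@normc_meval _ _ (fun=> sigma / 2) _ (pt z) _ _) _.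
  - by move=> _; rewrite divr_ge0 // ltW.
  - by move=> j; apply: ltW; exact: zU.
  have h01 : 0 <= (2^-1 : R) <= 1 by rewrite invr_ge0 ler0n invf_le1 // ler1n.
  rewrite (_ : (fun=> sigma / 2) = fun _ : 'I_n => 2^-1 * sigma); last first.
    by apply/funext => _; rewrite mulrC.
  apply: le_trans (wnorm_low s0' h01 (qlow N)) _.
  by rewrite exprVn mulrC ler_wpM2r // invr_ge0 exprn_ge0.
case/eqP: det0; apply: ComplexField.Normc.eq0_normc.
apply: le_anti; rewrite normc_ge0 andbT; apply/ler_addgt0Pl => e e0; rewrite addr0.
have e20 : 0 < e / 2 by rewrite divr_gt0.
have [N0 N0P] := geometric_small K0 e20.
have /cvg_normc/(_ _ e20)[N1 _ N1P] := cvg1.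
pose N := maxn N0 N1.
rewrite -[\det _](subrK (meval (pt z) (q N))).
apply: le_trans (ler_normcD _ _) _; rewrite [leRHS]splitr; apply: lerD.
  by apply: ltW; apply: N1P; rewrite /= leq_maxr.
by apply: le_trans (small N) (N0P N _); rewrite leq_maxl.
Qed.

End GenericRank.

(** * Rational dependence on the parameters *)

Lemma eq_fun3 (A B D E : Type) (F G : A -> B -> D -> E) :
  (forall a b d, F a b d = G a b d) ->
  (fun a b d => F a b d) = (fun a b d => G a b d).
Proof. by move=> FG; do 3!apply/funext => ?; exact: FG. Qed.

Section RationalFunctions.
Variables (R : realType) (n k : nat).
Local Notation C := R[i].
Local Notation V := 'cV[C]_n.
Local Notation M := 'M[C]_n.
Local Notation J := (jet R n k).
Local Notation I := (coord_idx n k).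
Local Notation ev p z l j := (meval (fun x => Defs.coord z l j (enum_val x)) p).

(* Regular functions of (z, lambda, j) on C^n x GL_n(C) x J_0^k. *)
Definition regular (F : V -> M -> J -> C) :=
  exists (d : nat) (p : mpoly #|{: I}| C), forall z l j, l \in unitmx ->
    F z l j = (\det l ^+ d)^-1 * ev p z l j.

Lemma regular_polynomial F (p : mpoly #|{: I}| C) :
  (forall z l j, F z l j = ev p z l j) -> regular F.
Proof. by move=> Fp; exists 0%N, p => z l j _; rewrite expr0 invr1 mul1r. Qed.

Lemma regular_coord (x : I) : regular (fun z l j => Defs.coord z l j x).
Proof.
apply: (@regular_polynomial _ (mpolyX C (mnm1 (enum_rank x)))) => z l j.
by rewrite mevalXU enum_rankK.
Qed.

Lemma regularC c : regular (fun _ _ _ => c).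
Proof. by apply: (@regular_polynomial _ (mpolyC _ c)) => z l j; rewrite mevalC. Qed.

Lemma regularM F G : regular F -> regular G ->
  regular (fun z l j => F z l j * G z l j).
Proof.
move=> [d [p Fp]] [e [q Gq]]; exists (d + e)%N, (p * q) => z l j lu.
by rewrite Fp // Gq // mevalM exprD invfM mulrACA.
Qed.

Definition det_poly : mpoly #|{: I}| C :=
  \det (\matrix_(i < n, i' < n)
    mpolyX C (mnm1 (enum_rank (inl (inr (i, i')) : I)))).

Lemma ev_det_poly z l j : ev det_poly z l j = \det l.
Proof.
rewrite /det_poly -det_map_mx; congr (\det _); apply/matrixP => i i'.
by rewrite !mxE /= mevalXU enum_rankK.
Qed.

(** Exponents of the denominator can be raised, which provides common denominators. *)
Lemma regular_le F : regular F -> exists d0, forall d, (d0 <= d)%N ->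
  exists p : mpoly #|{: I}| C, forall z l j, l \in unitmx ->
    F z l j = (\det l ^+ d)^-1 * ev p z l j.
Proof.
move=> [d0 [p Fp]]; exists d0 => d d0d; exists (det_poly ^+ (d - d0) * p) => z l j lu.
have dl : \det l != 0 by rewrite -unitfE -unitmxE.
have dE : \det l ^+ d = \det l ^+ (d - d0) * \det l ^+ d0 by rewrite -exprD subnK.
rewrite Fp // mevalM rmorphXn /= ev_det_poly dE invfM.
by rewrite [RHS]mulrACA mulVf ?expf_neq0 // mul1r.
Qed.

Lemma regularD F G : regular F -> regular G ->
  regular (fun z l j => F z l j + G z l j).
Proof.
move=> /regular_le[d FP] /regular_le[e GP].
have [p Fp] := FP _ (leq_addr e d); have [q Gq] := GP _ (leq_addl d e).
by exists (d + e)%N, (p + q) => z l j lu; rewrite Fp // Gq // mevalD mulrDr.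
Qed.

Lemma regular_sum (T : Type) (r : seq T) (Q : pred T) (F : T -> V -> M -> J -> C) :
  (forall t, regular (F t)) ->
  regular (fun z l j => \sum_(t <- r | Q t) F t z l j).
Proof.
move=> FP; elim: r => [|t r IH].
  by under eq_fun3 do rewrite big_nil; exact: regularC.
under eq_fun3 do rewrite big_cons.
by case: (Q t) => //; apply: regularD.
Qed.

Lemma regular_prod (T : Type) (r : seq T) (Q : pred T) (F : T -> V -> M -> J -> C) :
  (forall t, regular (F t)) ->
  regular (fun z l j => \prod_(t <- r | Q t) F t z l j).
Proof.
move=> FP; elim: r => [|t r IH].
  by under eq_fun3 do rewrite big_nil; exact: regularC.
under eq_fun3 do rewrite big_cons.
by case: (Q t) => //; apply: regularM.
Qed.

Lemma regularX F m : regular F -> regular (fun z l j => F z l j ^+ m).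
Proof.
move=> FP; elim: m => [|m IH].
  by under eq_fun3 do rewrite expr0; exact: regularC.
by under eq_fun3 do rewrite exprS; apply: regularM.
Qed.

Lemma regular_matrix i i' : regular (fun _ l _ => l i i').
Proof. exact: (regular_coord (inl (inr (i, i')))). Qed.

Lemma regular_vector i : regular (fun z _ _ => z i 0).
Proof. exact: (regular_coord (inl (inl i))). Qed.

Lemma regular_jet m i : regular (fun _ _ j => j m i 0).
Proof. exact: (regular_coord (inr (m, i))). Qed.

Lemma regular_det m (A : V -> M -> J -> 'M[C]_m) :
  (forall i i', regular (fun z l j => A z l j i i')) ->
  regular (fun z l j => \det (A z l j)).
Proof.
move=> AP; apply: regular_sum => s; apply: regularM; first exact: regularC.
exact: regular_prod.
Qed.

Lemma regular_eq F G : (forall z l j, l \in unitmx -> F z l j = G z l j) ->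
  regular F -> regular G.
Proof. by move=> FG [d [p Fp]]; exists d, p => z l j lu; rewrite -FG // Fp. Qed.

Lemma regular_invmx i i' : regular (fun _ l _ => invmx l i i').
Proof.
apply: (@regular_eq (fun _ l _ => (\det l)^-1 * \adj l i i')) => [z l j lu|].
  by rewrite /invmx lu !mxE.
apply: regularM; first by exists 1%N, 1 => z l j _; rewrite expr1 meval1 mulr1.
under eq_fun3 do rewrite mxE; apply: regularM; first exact: regularC.
apply: (regular_det (A := fun _ l _ => row' i' (col' i l))) => x y.
by under eq_fun3 do rewrite !mxE; exact: regular_matrix.
Qed.

Definition regular_mpoly m (F : V -> M -> J -> mpoly m C) :=
  forall x, regular (fun z l j => mcoeff x (F z l j)).

Section RegularMpoly.
Variable m : nat.
Implicit Types F G : V -> M -> J -> mpoly m C.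

Lemma regular_mpolyD F G : regular_mpoly F -> regular_mpoly G ->
  regular_mpoly (fun z l j => F z l j + G z l j).
Proof. by move=> FP GP x; under eq_fun3 do rewrite mcoeffD; apply: regularD. Qed.

Lemma regular_mpolyB F G : regular_mpoly F -> regular_mpoly G ->
  regular_mpoly (fun z l j => F z l j - G z l j).
Proof.
move=> FP GP x; apply: (@regular_eq
  (fun z l j => mcoeff x (F z l j) + (-1) * mcoeff x (G z l j))) => [z l j _|].
  by rewrite mcoeffB mulN1r.
by apply: regularD => //; apply: regularM => //; exact: regularC.
Qed.

Lemma regular_mpolyC (p : mpoly m C) : regular_mpoly (fun _ _ _ => p).
Proof. by move=> x; exact: regularC. Qed.

Lemma regular_mpolyM F G : regular_mpoly F -> regular_mpoly G ->
  regular_mpoly (fun z l j => F z l j * G z l j).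
Proof.
move=> FP GP x; under eq_fun3 do rewrite mcoeffM.
by apply: regular_sum => -[y1 y2]; apply: regularM.
Qed.

Lemma regular_mpolyZ (c : V -> M -> J -> C) F : regular c -> regular_mpoly F ->
  regular_mpoly (fun z l j => c z l j *: F z l j).
Proof. by move=> cP FP x; under eq_fun3 do rewrite mcoeffZ; apply: regularM. Qed.

Lemma regular_mpoly_sum (T : Type) (r : seq T) (F : T -> V -> M -> J -> mpoly m C) :
  (forall t, regular_mpoly (F t)) ->
  regular_mpoly (fun z l j => \sum_(t <- r) F t z l j).
Proof.
move=> FP x; under eq_fun3 do rewrite raddf_sum /=.
by apply: regular_sum => t; exact: FP.
Qed.

Lemma regular_mpolyX F e : regular_mpoly F -> regular_mpoly (fun z l j => F z l j ^+ e).
Proof.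
move=> FP; elim: e => [|e IH].
  by under eq_fun3 do rewrite expr0; exact: regular_mpolyC.
by under eq_fun3 do rewrite exprS; apply: regular_mpolyM.
Qed.

Lemma regular_mpoly_prod (T : Type) (r : seq T) (F : T -> V -> M -> J -> mpoly m C) :
  (forall t, regular_mpoly (F t)) ->
  regular_mpoly (fun z l j => \prod_(t <- r) F t z l j).
Proof.
move=> FP; elim: r => [|t r IH].
  by under eq_fun3 do rewrite big_nil; exact: regular_mpolyC.
by under eq_fun3 do rewrite big_cons; apply: regular_mpolyM.
Qed.

(** The reason for asking [finlin] of the division operator: under mere linearity a coefficient of
    the image could depend on infinitely many coefficients, and the sum would not stay regular. *)
Lemma regular_finlin T F : finlin T -> regular_mpoly F ->
  regular_mpoly (fun z l j => T (F z l j)).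
Proof.
move=> Tlin FP x; have [s Ts] := Tlin x; under eq_fun3 do rewrite Ts.
by apply: regular_sum => y; apply: regularM; [exact: regularC | exact: FP].
Qed.

End RegularMpoly.

Lemma regular_msubst m m' (s : 'I_m -> V -> M -> J -> mpoly m' C) (p : mpoly m C) :
  (forall i, regular_mpoly (s i)) ->
  regular_mpoly (fun z l j => msubst (fun i => s i z l j) p).
Proof.
move=> sP; elim/mpoly_ring_ind: p => [c|i|p q IHp IHq|p q IHp IHq].
- by under eq_fun3 do rewrite msubstC; exact: regular_mpolyC.
- by under eq_fun3 do rewrite msubst_var; exact: sP.
- by under eq_fun3 do rewrite msubstD; apply: regular_mpolyD.
- by under eq_fun3 do rewrite msubstM; apply: regular_mpolyM.
Qed.

Lemma regular_solve (e : 'I_n -> nat) (f B : 'I_n -> mpoly n C)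
    (T : nat -> mpoly n C -> mpoly n C) (c : V -> M -> J -> 'I_n -> mpoly n C) :
  (forall l, finlin (T l)) -> (forall i, regular_mpoly (fun z l j => c z l j i)) ->
  forall q i, regular_mpoly (fun z l j => solve e f T B (c z l j) q i) /\
    regular_mpoly (fun z l j =>
      solve_step e f T B (c z l j) q (solve e f T B (c z l j) q) i).
Proof.
move=> Tlin cP.
have step q i : (forall i, regular_mpoly (fun z l j => solve e f T B (c z l j) q i)) ->
    regular_mpoly (fun z l j =>
      solve_step e f T B (c z l j) q (solve e f T B (c z l j) q) i).
  move=> IH; apply: regular_finlin => //; apply: regular_mpoly_sum => i'.
  apply: regular_mpolyM; first exact: regular_mpolyC.
  apply: regular_finlin; first exact: finlin_hpart.
  apply: regular_mpolyB; first exact: cP.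
  exact: (regular_msubst (s := fun i z l j => solve e f T B (c z l j) q i)).
have sol q : forall i, regular_mpoly (fun z l j => solve e f T B (c z l j) q i).
  elim: q => [|q IH] i; first exact: regular_mpolyC.
  by apply: regular_mpolyD; [exact: IH | exact: step].
by move=> q i; split; [exact: sol | apply: step; exact: sol].
Qed.

(** A fixed degree confines the support of [F z l j] to one finite set of monomials for all
    parameters, so that the value is a finite sum of regular functions. *)
Lemma regular_meval d (w : 'I_n -> V -> M -> J -> C) (F : V -> M -> J -> mpoly n C) :
  (forall i, regular (w i)) -> regular_mpoly F ->
  (forall z l j, homog d (F z l j)) ->
  regular (fun z l j => meval (fun i => w i z l j) (F z l j)).
Proof.
move=> wP FP hF.
apply: (@regular_eq (fun z l j => \sum_(m : bmultinom n d.+1)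
    mcoeff m (F z l j) * \prod_i w i z l j ^+ m i)) => [z l j _|].
  have sz : (msize (F z l j) <= d.+1)%N.
    rewrite msizeE; apply/bigmax_leqP_seq => m; rewrite mcoeff_msupp => Fm _.
    rewrite ltnS leqNgt; apply: contraNN Fm => dm; apply/eqP; apply: hF.
    by rewrite gtn_eqF.
  rewrite [in RHS](mpolywE sz) raddf_sum /=; apply: eq_bigr => m _.
  by rewrite mevalZ mevalX.
apply: regular_sum => m; apply: regularM; first exact: FP.
by apply: regular_prod => i; apply: regularX.
Qed.

End RationalFunctions.

(** * Linear changes of variables *)

Section LinearSubstitution.
Variables (K : comNzRingType) (n : nat).

Definition linear_form (l : 'M[K]_n) (i : 'I_n) : mpoly n K :=
  \sum_i' l i i' *: var K i'.

Lemma meval_msubst m k (v : 'I_k -> K) (s : 'I_m -> mpoly k K) p :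
  meval v (msubst s p) = meval (fun i => meval v (s i)) p.
Proof.
elim/mpoly_ring_ind: p => [c|i|p q IHp IHq|p q IHp IHq].
- by rewrite msubstC !mevalC.
- by rewrite msubst_var mevalXU.
- by rewrite msubstD !mevalD IHp IHq.
- by rewrite msubstM !mevalM IHp IHq.
Qed.

Lemma meval_linear_form (l : 'M[K]_n) (z : 'cV[K]_n) i :
  meval (fun j => z j 0) (linear_form l i) = (l *m z) i 0.
Proof.
rewrite raddf_sum mxE /=; apply: eq_bigr => i' _.
by rewrite mevalZ mevalXU.
Qed.

Lemma linear_form_comp (l l' : 'M[K]_n) i :
  msubst (linear_form l) (linear_form l' i) = linear_form (l' *m l) i.
Proof.
rewrite /linear_form raddf_sum /=.
under eq_bigr => j _ do rewrite msubstZ msubst_var scaler_sumr.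
rewrite exchange_big /=; apply: eq_bigr => k _.
by rewrite mxE scaler_suml; apply: eq_bigr => j _; rewrite scalerA.
Qed.

Lemma linear_form1 i : linear_form 1%:M i = var K i.
Proof.
rewrite /linear_form (bigD1 i) //= mxE eqxx scale1r big1 ?addr0 // => j ji.
by rewrite mxE eq_sym (negbTE ji) scale0r.
Qed.

End LinearSubstitution.

Section SubstitutionDegree.
Variables (K : idomainType) (n : nat).

Lemma homog_linear_form (l : 'M[K]_n) i : homog 1 (linear_form l i).
Proof. by apply: homog_sum => j _; apply: homogZ; apply: homog_var. Qed.

Lemma low_msubst d (s : 'I_n -> mpoly n K) (p : mpoly n K) :
  (forall i, low 1 (s i)) -> low d p -> low d (msubst s p).
Proof.
move=> s1 lp; rewrite (mpolyE p) raddf_sum /= big_seq; apply: low_sum => m mp.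
rewrite msubstZ msubstX; apply: lowZ.
have dm : (d <= mdeg m)%N.
  by rewrite leqNgt; apply/negP => /lp pm; move: mp; rewrite mcoeff_msupp pm eqxx.
apply: lowW dm _; rewrite mdegE; apply: low_prod => i _.
by rewrite -[X in low X _]mul1n; exact: (low_exp (s1 i)).
Qed.

Lemma homog_msubst d (s : 'I_n -> mpoly n K) (p : mpoly n K) :
  (forall i, homog 1 (s i)) -> homog d p -> homog d (msubst s p).
Proof.
move=> s1 hp; rewrite (mpolyE p) raddf_sum /= big_seq; apply: homog_sum => m mp.
rewrite msubstZ msubstX; apply: homogZ.
have -> : d = mdeg m.
  apply/eqP; apply: contraTT mp; rewrite eq_sym => /hp pm.
  by rewrite mcoeff_msupp pm eqxx.
rewrite mdegE; apply: homog_prod => i _.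
by rewrite -[X in homog X _]mul1n; exact: (homog_exp (s1 i)).
Qed.

Lemma hpart_msubst d (s : 'I_n -> mpoly n K) (p : mpoly n K) :
  (forall i, homog 1 (s i)) -> hpart d (msubst s p) = msubst s (hpart d p).
Proof.
move=> s1; have pE := hpart_sum (leq_maxl (msize p) d.+1).
move: (maxn _ _) (leq_maxr (msize p) d.+1) pE => N dN pE.
have -> : hpart d (msubst s p) = \sum_(k < N) hpart d (msubst s (hpart k p)).
  by rewrite {1}pE (raddf_sum (msubst s)) (raddf_sum (hpart d)).
rewrite (bigD1 (Ordinal dN)) //= big1 ?addr0 => [|k kd].
  exact: (hpart_homog (homog_msubst s1 (homog_hpart d p))).
apply: (hpart_homog_neq (homog_msubst s1 (homog_hpart k p))).
by apply: contraNneq kd => kd; apply/eqP/val_inj.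
Qed.

Lemma meval_homogZ d t (w : 'I_n -> K) (p : mpoly n K) : homog d p ->
  meval (fun i => t * w i) p = t ^+ d * meval w p.
Proof.
move=> hp; rewrite !mevalE mulr_sumr; apply: eq_big_seq => m mp.
have <- : mdeg m = d.
  by apply/eqP; apply: contraTT mp => /hp pm; rewrite mcoeff_msupp pm eqxx.
rewrite mulrCA; congr (_ * _); rewrite mdegE -prodrXr -big_split.
by apply: eq_bigr => i _; rewrite exprMn.
Qed.

End SubstitutionDegree.

(** * Suprema on polydiscs and compact sets of matrices *)

Section Bounds.
Variables (R : realType) (n : nat).
Local Notation C := R[i].
Local Notation V := 'cV[C]_n.

(** The bound [B] excludes the default value that [sup] takes on unbounded sets. *)
Lemma supnorm_ge (F : set V) (g : V -> V) (B : R) z i :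
  (forall z i, F z -> normc (g z i 0) <= B) -> F z ->
  normc (g z i 0) <= supnorm F g.
Proof.
move=> gB Fz; apply: le_trans (le_bigmax _ _ i).
apply: ub_le_sup; last by exists z.
by exists B => _ [x Fx <-]; exact: gB.
Qed.

Lemma supnorm_le (F : set V) (g : V -> V) (B : R) : 0 <= B -> F !=set0 ->
  (forall z i, F z -> normc (g z i 0) <= B) -> supnorm F g <= B.
Proof.
move=> B0 [z0 Fz0] gB; apply: bigmax_le => // i _.
apply: ge_sup; first by exists (normc (g z0 i 0)), z0.
by move=> _ [z Fz <-]; exact: gB.
Qed.

(** The multi-indices are embedded in a box, over which the sum factors into [n] geometric sums,
    each at most 2. *)
Lemma half_power_sum N : \sum_(m : bmultinom n N.+1) (1 / 2 : R) ^+ mdeg m <= 2 ^+ n.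
Proof.
have mN (m : bmultinom n N.+1) i : (m i < N.+1)%N.
  apply: leq_ltn_trans (bmdeg m); by rewrite mdegE (bigD1 i) //= leq_addr.
pose phi (m : bmultinom n N.+1) : {ffun 'I_n -> 'I_N.+1} := [ffun i => Ordinal (mN m i)].
have phi_inj : injective phi.
  move=> m1 m2 /ffunP E; apply: val_inj; apply/mnmP => i.
  by have := congr1 val (E i); rewrite !ffunE.
apply: le_trans (_ : \sum_(g : {ffun 'I_n -> 'I_N.+1}) \prod_i (1 / 2 : R) ^+ g i <= _).
  pose S := [set phi m | m in [set: bmultinom n N.+1]]%SET.
  apply: le_trans (_ : \sum_(g in S) \prod_i (1 / 2 : R) ^+ g i <= _).
    rewrite big_imset /=; last by move=> m1 m2 _ _; exact: phi_inj.
    rewrite le_eqVlt; apply/orP; left; apply/eqP.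
    apply: eq_big => [m|m _]; first by rewrite finset.in_setT.
    by rewrite mdegE -prodrXr; apply: eq_bigr => i _; rewrite ffunE.
  rewrite big_mkcond; apply: ler_sum => g _; case: ifP => // _.
  by apply: prodr_ge0 => i _; rewrite exprn_ge0 // divr_ge0.
rewrite -(bigA_distr_bigA (fun (_ : 'I_n) (k : 'I_N.+1) => (1 / 2 : R) ^+ k)).
rewrite -[n in 2 ^+ n]card_ord -prodr_const; apply: ler_prod => i _.
rewrite sumr_ge0 => [|k _]; last by rewrite exprn_ge0 // divr_ge0.
have : (1 / 2 : R) ^+ N.+1 - 1 = (1 / 2 - 1) * \sum_(k < N.+1) (1 / 2) ^+ k.
  exact: subrX1.
have : 0 <= (1 / 2 : R) ^+ N.+1 by rewrite exprn_ge0 // divr_ge0.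
by move: (_ ^+ N.+1) (\sum_(k < N.+1) _) => x y; lra.
Qed.

Lemma ler_dist_normc (x y : C) : `|normc x - normc y| <= normc (x - y).
Proof.
rewrite ler_distl; apply/andP; split.
  rewrite lerBlDr -[normc (x - y)]normcNE opprB.
  by rewrite -{1}[y](subrK x) addrC [leRHS]addrC; apply: le_trans (ler_normcD _ _) _; rewrite addrC.
by rewrite -{1}[x](subrK y) addrC; apply: ler_normcD.
Qed.

Lemma compact_normc_bounded m k (L : set 'M[C]_(m, k)) (g : 'M[C]_(m, k) -> C) :
  compact L -> (forall x, L x -> g y @[y --> x] --> g x) ->
  exists B : R, forall x, L x -> normc (g x) <= B.
Proof.
move=> Lc gc; have ng x : L x -> normc (g y) @[y --> x] --> normc (g x).
  have Fx : Filter (nbhs x) := nbhs_filter x.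
  move=> /gc /cvg_normc gx; apply/(cvgrPdist_lt (V := R^o) (FF := Fx)) => e e0.
  by apply: filterS (gx e e0) => y; apply: le_lt_trans (ler_dist_normc _ _).
have : compact ((fun x => normc (g x) : R^o) @` L).
  apply: continuous_compact => //; apply: continuous_in_subspaceT => x.
  by rewrite inE; exact: ng.
move/compact_bounded => [B [_ /(_ (B + 1))]]; rewrite ltrDl ltr01 => /(_ isT) BP.
exists (B + 1) => x Lx; apply: le_trans (ler_norm _) _.
by apply: BP; exists x.
Qed.

Lemma entry_cvg m k (x : 'M[C]_(m, k)) i j : y i j @[y --> x] --> x i j.
Proof. exact: coord_continuous. Qed.

Lemma compact_matrix_bounds (L : set 'M[C]_n) : compact L ->
  L `<=` [set l | l \in unitmx] ->
  exists2 B : R, 0 < B & forall l, L l ->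
    forall i j, normc (l i j) <= B /\ normc (invmx l i j) <= B.
Proof.
move=> Lc Lu.
have ex1 (x : 'I_n * 'I_n) : exists B : R, forall l, L l -> normc (l x.1 x.2) <= B.
  by apply: compact_normc_bounded => // l _; exact: entry_cvg.
have ex2 (x : 'I_n * 'I_n) : exists B : R, forall l, L l -> normc (invmx l x.1 x.2) <= B.
  (* On invertible matrices the inverse is the adjugate divided by the determinant, a continuous
     expression without case distinction. *)
  have [B BP] : exists B : R, forall l, L l ->
      normc ((\det l)^-1 * \adj l x.1 x.2) <= B.
    apply: compact_normc_bounded => // l /Lu /= lu.
    have Fl : Filter (nbhs l) := nbhs_filter l.
    have dl : \det l != 0 by rewrite -unitfE -unitmxE.
    have det_cvg : \det y @[y --> l] --> \det l.
      by apply: cvg_det => i j; exact: entry_cvg.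
    apply: (cvgM (cvgV dl det_cvg)).
    rewrite /= mxE /cofactor; under eq_fun do rewrite mxE /cofactor.
    apply: cvgM; first exact: cvg_cst.
    apply: cvg_det => i j; rewrite !mxE; under eq_fun do rewrite !mxE.
    exact: entry_cvg.
  exists B => l Ll; have lu : l \in unitmx := Lu _ Ll.
  by rewrite /invmx lu mxE; exact: BP.
have [B1 B1P] := choice ex1; have [B2 B2P] := choice ex2.
exists (1 + \sum_x `|B1 x| + \sum_x `|B2 x|).
  by rewrite -addrA ltr_pwDl // addr_ge0 ?sumr_ge0.
move=> l Ll i j; have := B1P (i, j) l Ll; have := B2P (i, j) l Ll => /= h2 h1.
have g1 : `|B1 (i, j)| <= \sum_x `|B1 x| by rewrite (bigD1 (i, j)) //= lerDl sumr_ge0.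
have g2 : `|B2 (i, j)| <= \sum_x `|B2 x| by rewrite (bigD1 (i, j)) //= lerDl sumr_ge0.
have n1 := ler_norm (B1 (i, j)); have n2 := ler_norm (B2 (i, j)).
have s1 : 0 <= \sum_x `|B1 x| by rewrite sumr_ge0.
have s2 : 0 <= \sum_x `|B2 x| by rewrite sumr_ge0.
move: h1 h2 g1 g2 n1 n2 s1 s2.
move: (normc (l i j)) (normc (invmx l i j)) (B1 (i, j)) (B2 (i, j))
  (\sum_x `|B1 x|) (\sum_x `|B2 x|).
by clear; move=> x y b1 b2 S1 S2 *; split; lra.
Qed.

End Bounds.

(** * Solutions of the equation A o u = b *)

Lemma subr_telescope (V : zmodType) (x y z t : V) :
  x - y - (x - z) - (z - t) = t - y.
Proof. by rewrite opprB [x - y + _]addrC subrKA opprB addrC subrKA. Qed.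

Section LinearParts.
Variables (R : realType) (n : nat).
Local Notation C := R[i].
Local Notation V := 'cV[C]_n.

Lemma mcoeff_linear_form (l : 'M[C]_n) i j : mcoeff (mnm1 j) (linear_form l i) = l i j.
Proof.
rewrite /linear_form raddf_sum (bigD1 j) //= mcoeffZ mcoeffX eqxx mulr1.
rewrite big1 ?addr0 // => k kj; rewrite mcoeffZ mcoeffX.
by rewrite eq_mnm1 (negbTE kj) mulr0.
Qed.

Lemma taylor_coefP (f : V -> V) : holomorphic_germ f ->
  exists rho H, power_series_on f (taylor_coef f) rho H.
Proof. by move=> /getPex /has_power_series_on. Qed.

Lemma trunc_linear (f : V -> V) a rho H N i : (0 < N)%N ->
  power_series_on f a rho H -> f 0 = 0 ->
  low 2 (trunc a N i - linear_form (jacobian_mx f 0) i).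
Proof.
move=> N0 psf f0 m; rewrite mcoeffB mcoeff_trunc.
case E : (mdeg m) => [|[|//]] _.
  have -> : m = mnm0 by apply/eqP; rewrite -mdeg_eq0 E.
  rewrite leq0n -(power_series_at0 i psf) f0 mxE.
  by rewrite (homog_linear_form (jacobian_mx f 0) i) ?subrr // mdeg0.
have /eqP/mdeg1P[j /eqP jm] := E.
by rewrite N0 jm mcoeff_linear_form (jacobian_at0 _ _ psf) subrr.
Qed.

(** The chain rule at 0 is read off from truncations at degree 1: modulo order 2, v o u = id is an
    identity between linear forms. *)
Lemma jacobian_unitmx (u : V -> V) : biholomorphic_germ u -> jacobian_mx u 0 \in unitmx.
Proof.
move=> [/taylor_coefP[ru [Hu psu]] u0 [v [/taylor_coefP[rv [Hv psv]] v0 vu _]]].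
suff E : jacobian_mx v 0 *m jacobian_mx u 0 = 1%:M by have [] := mulmx1_unit E.
apply/matrixP => i j.
have uL k := trunc_linear k (ltnSn 0) psu u0.
have vL := trunc_linear i (ltnSn 0) psv v0.
have u1 k : low 1 (trunc (taylor_coef u) 1 k).
  rewrite -[trunc _ _ _](subrK (linear_form (jacobian_mx u 0) k)).
  apply: lowD; first exact: (lowW _ (uL k)).
  exact: (homog_low (homog_linear_form _ _)).
have idP : approx 1 (fun z : V => z i 0) (var C i).
  rewrite (_ : (fun z : V => z i 0) = fun z => meval (pt z) (var C i)).
    exact: approx_meval.
  by apply/funext => z; rewrite mevalXU.
have h3 : low 2 (msubst (trunc (taylor_coef u) 1) (trunc (taylor_coef v) 1 i) - var C i).
  exact: (trunc_comp psv psu idP u0 vu).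
have h1 : low 2 (msubst (trunc (taylor_coef u) 1) (trunc (taylor_coef v) 1 i)
    - msubst (trunc (taylor_coef u) 1) (linear_form (jacobian_mx v 0) i)).
  by rewrite -msubstB; apply: low_msubst.
have h2 := low_msubst_congr (linear_form (jacobian_mx v 0) i) uL.
have := lowB (lowB h3 h1) h2; rewrite subr_telescope.
rewrite linear_form_comp => /(_ (mnm1 j)); rewrite mdeg1 => /(_ isT).
rewrite mcoeffB mcoeff_linear_form -(linear_form1 C i) mcoeff_linear_form.
exact: subr0_eq.
Qed.

End LinearParts.

Section Solutions.
Variables (R : realType) (n : nat).
Local Notation C := R[i].
Local Notation V := 'cV[C]_n.
Local Notation M := 'M[C]_n.
Variables (a : multinom n -> V) (P : 'I_n -> mpoly n C).
Variables (e : 'I_n -> nat) (f : 'I_n -> mpoly n C) (T : nat -> mpoly n C -> mpoly n C).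

Definition jet_poly N (j : jet R n N) (i : 'I_n) : mpoly n C :=
  \sum_(m : bmultinom n N.+1) j m i 0 *: mpolyX C m.

Lemma jet_poly_at0 N (b : V -> V) i :
  jet_poly (jet_at0 N b) i = trunc (taylor_coef b) N i.
Proof. by apply: eq_bigr => m _; rewrite ffunE. Qed.

(** [source] and [target] are the two sides P o A and P o b o l^-1 of the equation, with A and b
    replaced by polynomials of degree at most [N]. *)
Definition source N (i : 'I_n) := msubst (trunc a N) (P i).

Definition target N (l : M) (j : jet R n N) (i : 'I_n) :=
  msubst (fun i' => msubst (linear_form (invmx l)) (jet_poly j i')) (P i).

(* The homogeneous part of degree d of u (l^-1 z), where u'(0) = l. *)
Definition solution_part N d (l : M) (j : jet R n N) (i : 'I_n) :=
  hpart d (solve e f T (source N) (target l j) d.-1 i).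

Lemma solution_part1 N (l : M) (j : jet R n N) i : solution_part 1 l j i = var C i.
Proof. exact: (hpart_homog (homog_var C i)). Qed.

Lemma regular_solution_part N d i : (forall l, finlin (T l)) ->
  regular (fun (z : V) l (j : jet R n N) =>
    meval (pt (l *m z)) (solution_part d l j i)).
Proof.
move=> Tlin.
apply: (@regular_meval _ _ _ d (fun i' z l _ => (l *m z) i' 0)).
- move=> i'; under eq_fun3 do rewrite mxE; apply: regular_sum => k.
  by apply: regularM; [exact: regular_matrix | exact: regular_vector].
- apply: regular_finlin; first exact: finlin_hpart.
  apply: proj1 (regular_solve _ _ _ Tlin _ _ _) => i'.
  apply: (regular_msubst (s := fun i' (_ : V) l (j : jet R n N) =>
    msubst (linear_form (invmx l)) (jet_poly j i'))) => k.
  under eq_fun3 do rewrite /jet_poly (raddf_sum (msubst _)) /=.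
  apply: regular_mpoly_sum => m; under eq_fun3 do rewrite msubstZ msubstX.
  apply: regular_mpolyZ; first exact: regular_jet.
  apply: regular_mpoly_prod => k'; apply: regular_mpolyX.
  apply: regular_mpoly_sum => k''; apply: regular_mpolyZ; first exact: regular_invmx.
  exact: regular_mpolyC.
- by move=> z l j; exact: homog_hpart.
Qed.

Lemma solution_polymap N d : (forall l, finlin (T l)) ->
  exists (p : polymap R n N) (k : nat), (d = 1%N -> k = 0%N) /\
    forall z l j, l \in unitmx -> polymap_eval p z l j =
      (\det l) ^+ k *: \col_i meval (pt (l *m z)) (solution_part d l j i).
Proof.
(* Degree 1 is treated apart, by a polynomial written down without denominator, because property (i)
   asks for kappa(1) = 0. *)
move=> Tlin; have [->|d1] := eqVneq d 1%N.
  exists (fun i => \sum_i' mpolyX C (mnm1 (enum_rank (inl (inr (i, i')) : coord_idx n N)))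
    * mpolyX C (mnm1 (enum_rank (inl (inl i') : coord_idx n N)))), 0%N.
  split=> // z l j _; rewrite expr0 scale1r; apply/colP => i.
  rewrite !mxE solution_part1 mevalXU /pt mxE raddf_sum; apply: eq_bigr => i' _.
  by rewrite /= mevalM !mevalXU !enum_rankK.
have /choice[d0 d0P] : forall i, exists d0, forall k, (d0 <= k)%N ->
    exists p : mpoly #|coord_idx n N| C, forall z l j, l \in unitmx ->
      meval (pt (l *m z)) (solution_part d l j i) =
      (\det l ^+ k)^-1 * meval (fun x => Defs.coord z l j (enum_val x)) p.
  by move=> i; apply: regular_le; exact: regular_solution_part.
pose k := (\sum_i d0 i)%N.
have /choice[p pP] : forall i, exists p : mpoly #|coord_idx n N| C,
    forall z l j, l \in unitmx ->
      meval (pt (l *m z)) (solution_part d l j i) =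
      (\det l ^+ k)^-1 * meval (fun x => Defs.coord z l j (enum_val x)) p.
  by move=> i; apply: d0P; rewrite /k (bigD1 i) //= leq_addr.
exists p, k; split=> [d1E|z l j lu]; first by rewrite d1E eqxx in d1.
by apply/colP => i; rewrite !mxE pP // mulVKf // expf_neq0.
Qed.

Variables (A : V -> V) (rho H : R) (N1 : nat).
Hypothesis psA : power_series_on A a rho H.
Hypothesis init_source : forall N, (N1 <= N)%N ->
  forall i, init (e i).+1 (f i) (source N i).
Hypothesis TK : forall l g, homog l g -> T l (\det (jac f) * g) = g.
Hypothesis T_homog : forall l q, homog l (T l q).

(** [w], the truncation of [u] composed with l^-1, satisfies the polynomial equation modulo order
    [N.+1]. By [e i + d <= N] this suffices to apply [solve_unique] up to degree [d]. *)
Lemma solution_part_uniq (b u : V -> V) N d z i : holomorphic_germ b ->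
  biholomorphic_germ u -> (\forall z \near (0 : V), A (u z) = b z) ->
  (N1 <= N)%N -> (0 < d)%N -> (forall i, (e i + d <= N)%N) ->
  homog_term u d z i 0 =
  meval (pt (jacobian_mx u 0 *m z)) (solution_part d (jacobian_mx u 0) (jet_at0 N b) i).
Proof.
move=> /taylor_coefP[rb [Hb psb]] ubi Aub N1N d0 edN.
have lu := jacobian_unitmx ubi; have [/taylor_coefP[ru [Hu psu]] u0 _] := ubi.
have dN : (d <= N)%N by apply: leq_trans (edN i); rewrite leq_addl.
set l := jacobian_mx u 0 in lu *; pose L := linear_form (invmx l).
have L1 k : homog 1 (L k) := homog_linear_form _ _.
have Llow k : low 1 (L k) := homog_low (L1 k).
pose w k := msubst L (trunc (taylor_coef u) N k).
have w_init k : low 2 (w k - var C k).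
  have E : msubst L (linear_form l k) = var C k.
    by rewrite linear_form_comp mulmxV // linear_form1.
  rewrite -E -msubstB; apply: (low_msubst Llow).
  exact: (trunc_linear k (leq_trans d0 dN) psu u0).
have w_sol k : low (e k + d.+1) (msubst w (source N k) - target l (jet_at0 N b) k).
  apply: (@lowW _ _ _ N.+1); first by rewrite addnS ltnS.
  rewrite /source msubst_comp; apply: low_msubst_congr => k'.
  rewrite jet_poly_at0 /w -msubst_comp -msubstB; apply: (low_msubst Llow).
  exact: (trunc_comp psA psu (approx_trunc _ _ psb) u0 Aub).
have sol : low d.-1.+2 (w i - solve e f T (source N) (target l (jet_at0 N b)) d.-1 i).
  have f_homog k := proj1 (init_source N1N k).
  have dd : (d.-1 < d)%N by rewrite prednK.
  exact: (solve_unique f_homog TK T_homog (init_source N1N) w_init w_sol i dd).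
have -> : solution_part d l (jet_at0 N b) i = hpart d (w i).
  apply/eqP; rewrite eq_sym -subr_eq0 /solution_part -raddfB /=; apply/eqP.
  by apply: (hpart_low (ltnSn d)); move: sol; rewrite prednK //; apply.
rewrite /homog_term (homog_part_meval _ z i dN) (hpart_msubst _ _ L1) meval_msubst.
apply: meval_eq => k; rewrite meval_linear_form.
by rewrite mulmxA mulVmx // mul1mx.
Qed.

End Solutions.

(** * From bounds on b to bounds on the solution *)

Section CoefficientBounds.
Variables (R : realType) (n : nat).
Local Notation C := R[i].
Local Notation V := 'cV[C]_n.

Lemma uniform_lower_bound (r : 'I_n -> R) : (forall i, 0 < r i) ->
  exists2 q : R, 0 < q & forall i, q <= r i.
Proof.
move=> r0; have S0 : 0 <= \sum_i (r i)^-1 by apply: sumr_ge0 => i _; rewrite invr_ge0 ltW.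
exists (1 + \sum_i (r i)^-1)^-1 => [|i]; first by rewrite invr_gt0 ltr_pwDl.
rewrite -[leRHS]invrK lef_pV2 ?posrE ?invr_gt0 ?ltr_pwDl //.
rewrite (bigD1 i) //= addrCA lerDl addr_ge0 //.
by apply: sumr_ge0 => k _; rewrite invr_ge0 ltW.
Qed.

(** [polydisc r] is open, so Cauchy's estimate is applied at half the radius; this produces the
    factor 2. *)
Lemma taylor_coef_bound (r : 'I_n -> R) (b : V -> V) (B : R) i m :
  (forall i, 0 < r i) ->
  (forall k, supnorm (polydisc r) (homog_term b k) <= B ^+ k) ->
  normc (taylor_coef b m i 0) * rmon r m <= (2 * B) ^+ mdeg m.
Proof.
move=> r0 bB; set k := mdeg m; have r0' j : 0 <= r j := ltW (r0 j).
pose p i := hpart k (trunc (taylor_coef b) k i).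
have bE z i' : homog_term b k z i' 0 = meval (pt z) (p i').
  exact: homog_part_meval.
have : normc (mcoeff m (p i)) * rmon (fun j => 1 / 2 * r j) m <= B ^+ k.
  apply: cauchy_estimate => [j|z zr]; first by rewrite mulr_ge0 // divr_ge0.
  apply: le_trans (bB k).
  have := @supnorm_ge _ _ (polydisc r) (homog_term b k) (\sum_i wnorm r (p i)) (\col_j z j) i.
  have -> : normc (homog_term b k (\col_j z j) i 0) = normc (meval z (p i)).
    by rewrite bE; congr normc; apply: meval_eq => j; rewrite /pt mxE.
  apply=> [z' i' z'r|j].
    have z'r' j : normc (pt z' j) <= r j := ltW (z'r j).
    rewrite bE; apply: le_trans (normc_meval r0' _ z'r') _.
    rewrite (bigD1 i') //= lerDl; apply: sumr_ge0 => j _; exact: wnorm_ge0.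
  rewrite mxE; apply: le_lt_trans (zr j) _.
  by rewrite gtr_pMl // ltr_pdivrMr // mul1r ltr1n.
rewrite rmonZ mcoeff_hpart mcoeff_trunc -/k eqxx leqnn mulrCA => h.
rewrite exprMn -ler_pdivrMl ?exprn_gt0 // -exprVn.
by move: h; rewrite div1r.
Qed.

Lemma wnorm_linear_form (r : 'I_n -> R) (l : 'M[C]_n) (B : R) i :
  (forall i, 0 <= r i) -> (forall i j, normc (l i j) <= B) ->
  wnorm r (linear_form l i) <= B * \sum_j r j.
Proof.
move=> r0 lB; apply: le_trans (wnorm_sum r0 _ _ _) _; rewrite mulr_sumr.
apply: ler_sum => j _; rewrite wnormZ // wnorm_var.
exact: ler_wpM2r.
Qed.

Lemma normc_mulmx (r : 'I_n -> R) (l : 'M[C]_n) (B : R) (z : V) i :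
  (forall i j, normc (l i j) <= B) -> (forall j, normc (z j 0) <= r j) ->
  normc ((l *m z) i 0) <= B * \sum_j r j.
Proof.
move=> lB zr; rewrite mxE; apply: le_trans (ler_normc_sum _ _ _) _.
rewrite mulr_sumr; apply: ler_sum => j _; rewrite ComplexField.Normc.normcM.
by apply: ler_pM => //; exact: normc_ge0.
Qed.

(** At polyradius [r] the terms of degree k are at most (2B)^k, so at radius [q / (4 * B)] they are
    at most 2^-k. *)
Lemma wnorm_trunc_le (r : 'I_n -> R) (b : V -> V) (B q : R) N i :
  (forall i, 0 < r i) -> 0 < B -> 0 < q -> (forall i, q <= r i) ->
  (forall k, supnorm (polydisc r) (homog_term b k) <= B ^+ k) ->
  wnorm (fun=> q / (4 * B)) (trunc (taylor_coef b) N i) <= 2 ^+ n.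
Proof.
move=> r0 B0 q0 qr bB; apply: le_trans (half_power_sum R n N).
rewrite (wnormE _ (msize_trunc _ N i)); apply: ler_sum => m _.
rewrite mcoeff_trunc -ltnS bmdeg.
have c0 : 0 < (4 * B)^-1 by rewrite invr_gt0 mulr_gt0.
apply: le_trans (_ : normc (taylor_coef b m i 0) *
    rmon (fun j => (4 * B)^-1 * r j) m <= _).
  apply: ler_wpM2l; first exact: normc_ge0.
  apply: ler_rmon => j; rewrite mulrC; apply/andP; split.
    by rewrite mulr_ge0 // ltW.
  by rewrite ler_pM2l.
rewrite rmonZ mulrCA.
apply: le_trans (_ : (4 * B)^-1 ^+ mdeg m * (2 * B) ^+ mdeg m <= _).
  by rewrite ler_pM2l ?exprn_gt0 //; exact: taylor_coef_bound.
rewrite -exprMn le_eqVlt; apply/orP; left; apply/eqP; congr (_ ^+ _).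
by field; rewrite gt_eqF.
Qed.

End CoefficientBounds.

Section SolutionBound.
Variables (R : realType) (n : nat).
Local Notation C := R[i].
Local Notation V := 'cV[C]_n.
Local Notation M := 'M[C]_n.
Variables (a : multinom n -> V) (P : 'I_n -> mpoly n C).
Variables (e : 'I_n -> nat) (f : 'I_n -> mpoly n C) (T : nat -> mpoly n C -> mpoly n C).
Variables (A : V -> V) (rho H : R) (N1 : nat) (r : 'I_n -> R) (K : R).
Hypothesis psA : power_series_on A a rho H.
Hypothesis init_source : forall N, (N1 <= N)%N ->
  forall i, init (e i).+1 (f i) (source a P N i).
Hypothesis T_homog : forall l q, homog l (T l q).
Hypothesis r_gt0 : forall i, 0 < r i.
Hypothesis K_gt0 : 0 < K.
Hypothesis T_bound : forall l t q, 0 < t ->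
  wnorm (fun i => t * r i) (T l q) <=
    K / t ^+ (\sum_i e i) * wnorm (fun i => t * r i) q.

(** [solve_bound] gives a polydisc on which S - id is bounded independently of [N], [d], [l] and
    [b]. Homogeneity of degree [d] then carries the bound to the image of [polydisc r] under [l], at
    the price of a factor k^d. *)
Lemma solution_part_bound (B B' : R) : 0 < B -> 0 < B' ->
  exists2 Q : R, 0 < Q & forall N d (l : M) (b : V -> V),
    (N1 <= N)%N -> (0 < d)%N ->
    (forall i j, normc (l i j) <= B' /\ normc (invmx l i j) <= B') ->
    (forall k, supnorm (polydisc r) (homog_term b k) <= B ^+ k) ->
    forall z i, polydisc r z ->
    normc (meval (pt (l *m z)) (solution_part a P e f T d l (jet_at0 N b) i)) <= Q ^+ d.
Proof.
move=> B0 B'0; have [q q0 qr] := uniform_lower_bound r_gt0.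
have r0 j : 0 <= r j := ltW (r_gt0 j).
pose S := 1 + \sum_j r j.
have rS : \sum_j r j <= S by rewrite lerDr.
have S1 : 1 <= S by rewrite lerDl sumr_ge0.
have S0 : 0 < S := lt_le_trans ltr01 S1.
pose sg := q / (4 * B); have sg0 : 0 < sg by rewrite divr_gt0 // mulr_gt0.
(* The matrix [invmx l] maps polyradius [t0 * r] into radius [sg], at which the truncations of [b]
   are bounded. *)
pose t0 := sg / (B' * S); have t00 : 0 < t0 by rewrite divr_gt0 // mulr_gt0.
have [rho0 H0 wA _] := psA.
pose H' := \sum_i wnorm (fun=> 2 ^+ n) (P i) + \sum_i wnorm (fun=> H) (P i).
have w20 i : 0 <= wnorm (fun=> 2 ^+ n) (P i) by apply: wnorm_ge0 => _; rewrite exprn_ge0.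
have wH0 i : 0 <= wnorm (fun=> H) (P i) by apply: wnorm_ge0.
have H'0 : 0 <= H' by rewrite addr_ge0 ?sumr_ge0.
have f_homog i : homog (e i).+1 (f i) := proj1 (init_source (leqnn N1) i).
have [t /andP[tgt0 t1] tP] :=
  solve_bound f_homog T_homog r_gt0 K_gt0 T_bound rho0 t00 H'0.
(* [k] dilates the polyradius [t * r] until it contains the image of [polydisc r] under [l]. *)
pose k := B' * S / (q * t).
have k0 : 0 < k by rewrite divr_gt0 // mulr_gt0.
exists (k * S) => [|N d l b N1N d0 lB bB z i zr]; first by rewrite mulr_gt0.
have tr0 j : 0 <= t * r j by rewrite mulr_ge0 // ltW.
have t0r0 j : 0 <= t0 * r j by rewrite mulr_ge0 // ltW.
have target_le i' : wnorm (fun j => t0 * r j) (target P l (jet_at0 N b) i') <= H'.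
  apply: le_trans (_ : wnorm (fun=> 2 ^+ n) (P i') <= _); last first.
    by rewrite /H' (bigD1 i') //= -!addrA lerDl !addr_ge0 ?sumr_ge0.
  apply: wnorm_msubst => // j; rewrite jet_poly_at0.
  apply: le_trans (wnorm_trunc_le N j r_gt0 B0 q0 qr bB).
  apply: wnorm_msubst => // j'.
  apply: le_trans (wnorm_linear_form (B := B') j' t0r0 _) _ => [x y|].
    by have [] := lB x y.
  rewrite -mulr_sumr mulrCA -/sg /t0 -mulrA ger_pMr //.
  by rewrite mulrC ler_pdivrMr ?mulr_gt0 // mul1r ler_pM2l.
have source_le i' : wnorm (fun=> rho) (source a P N i') <= H'.
  apply: le_trans (_ : wnorm (fun=> H) (P i') <= _).
    by apply: wnorm_msubst => [_|j]; [exact: ltW | exact: wA].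
  by rewrite /H' addrC (bigD1 i') //= -!addrA lerDl !addr_ge0 ?sumr_ge0.
have part_le : wnorm (fun j => t * r j)
    (solution_part a P e f T d l (jet_at0 N b) i) <= S.
  apply: le_trans (wnorm_hpart tr0 _ _) _.
  rewrite -[solve _ _ _ _ _ _ _](subrK (var C i)).
  apply: le_trans (wnormD tr0 _ _) _; apply: lerD.
    by apply: le_trans t1; apply: tP => //; exact: init_source.
  rewrite wnorm_var; apply: le_trans (_ : r i <= _); first by rewrite ger_pMl.
  by rewrite (bigD1 i) //= lerDl sumr_ge0.
have lz j : normc (pt (l *m z) j) <= k * (t * r j).
  apply: le_trans (normc_mulmx (B := B') (r := r) j _ _) _ => [x y|j'|].
  - by have [] := lB x y.
  - exact: ltW.
  apply: le_trans (_ : B' * S <= _); first by rewrite ler_pM2l.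
  have -> : k * (t * r j) = (B' * S) * (r j / q).
    by rewrite /k; field; rewrite !gt_eqF.
  by rewrite ler_pMr ?mulr_gt0 // ler_pdivlMr // mul1r.
have kr0 j : 0 <= k * (t * r j) by rewrite mulr_ge0 // ltW.
apply: le_trans (normc_meval kr0 _ lz) _.
rewrite (wnorm_homogZ _ _ (homog_hpart d _)) [leRHS]exprMn.
apply: ler_pM; [exact: exprn_ge0 (ltW k0) | exact: wnorm_ge0 | by [] |].
(* As [S >= 1] and [d > 0], the constant [S] is absorbed in S^d. *)
apply: le_trans part_le _.
by rewrite -[leLHS]expr1 ler_weXn2l.
Qed.

End SolutionBound.

Section Scaling.
Variables (R : realType) (n : nat).
Local Notation C := R[i].

Lemma pt_scale (t : C) (z : 'cV[C]_n) j : pt (t *: z) j = t * pt z j.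
Proof. by rewrite /pt mxE. Qed.

Lemma exprz_det_scaleK k (l : 'M[C]_n) (v : 'cV[C]_n) : l \in unitmx ->
  (\det l ^ Posz k)^-1 *: (\det l ^+ k *: v) = v.
Proof.
by move=> lu; rewrite exprnP scalerA mulVf ?scale1r // -exprnP expf_neq0 // -unitfE.
Qed.

End Scaling.

Theorem theorem3p1 (R : realType) (n : nat) (A : 'cV[R[i]]_n -> 'cV[R[i]]_n) :
  holomorphic_germ A -> generic_rank A n ->
  exists (l0 : nat) (p : forall l : nat, polymap R n (l0 + l))
         (kappa : nat -> int),
  [/\ forall l : nat, (0 < l)%N -> homogeneous_in_z l (p l),
      forall b u : 'cV[R[i]]_n -> 'cV[R[i]]_n,
        holomorphic_germ b -> biholomorphic_germ u ->
        (\forall z \near (0 : 'cV[R[i]]_n), A (u z) = b z) ->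
        forall (l : nat) (z : 'cV[R[i]]_n), (0 < l)%N ->
          homog_term u l z =
          ((\det (jacobian_mx u 0)) ^ (kappa l))^-1 *:
            polymap_eval (p l) z (jacobian_mx u 0) (jet_at0 (l0 + l) b),
      (forall (b : 'cV[R[i]]_n -> 'cV[R[i]]_n) (lambda : 'M[R[i]]_n)
              (z : 'cV[R[i]]_n),
         holomorphic_germ b -> lambda \in unitmx ->
         polymap_eval (p 1%N) z lambda (jet_at0 (l0 + 1) b) = lambda *m z) /\
      kappa 1%N = 0
    & exists2 r : 'I_n -> R, (forall i, 0 < r i) &
        forall (C : R) (L : set 'M[R[i]]_n),
          0 < C -> compact L -> L `<=` [set lambda | lambda \in unitmx] ->
          exists2 K : R, 0 < K &
            forall (lambda : 'M[R[i]]_n) (b : 'cV[R[i]]_n -> 'cV[R[i]]_n),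
              L lambda -> holomorphic_germ b ->
              (forall k : nat,
                 supnorm (polydisc r) (homog_term b k) <= C ^+ k) ->
              forall l : nat, (0 < l)%N ->
                supnorm (polydisc r)
                  (fun z => ((\det lambda) ^ (kappa l))^-1 *:
                     polymap_eval (p l) z lambda (jet_at0 (l0 + l) b))
                <= K ^+ l].
Proof.
move=> /taylor_coefP[rho [H psA]] rkA.
set a := taylor_coef A in psA.
have [P [e [f [N1 [init_src det_f]]]]] := independent_initial_forms
  (fun N M i => @trunc_compat R n a N M i) (generic_rank_order psA rkA).
have f_homog i : homog (e i).+1 (f i) := proj1 (init_src N1 (leqnn N1) i).
have det_homog : homog (\sum_i e i)%N (\det (jac f)).
  exact: proj1 (init_det_jac (fun i => init_homog (f_homog i))).
have [r [T [K [r0 K0 TK [T_homog Tlin] T_bound]]]] := bounded_division det_f det_homog.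
(* From [N1] on the initial forms of [source] no longer change. The sum bounds every [e i]: the part
   of degree [l] of u is read from the part of degree [e i + l] of the equation. *)
pose l0 := (N1 + \sum_i e i)%N.
have N1l l : (N1 <= l0 + l)%N by rewrite /l0 -addnA leq_addr.
have el l i : (e i + l <= l0 + l)%N.
  by rewrite leq_add2r /l0 (bigD1 i) //= addnCA leq_addr.
(* The polynomials and exponents are fixed here, from the data of [A] alone, before any [b] or [u]
   is given. *)
pose ex l := cid (@solution_polymap R n a P e f T (l0 + l) l Tlin).
pose p l := projT1 (ex l).
pose kp l := projT1 (cid (projT2 (ex l))).
have kp1 : kp 1%N = 0%N by apply: (proj1 (projT2 (cid (projT2 (ex 1%N))))).
have pP l z g (j : jet R n (l0 + l)) : g \in unitmx -> polymap_eval (p l) z g j =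
    \det g ^+ kp l *: \col_i meval (pt (g *m z)) (solution_part a P e f T l g j i).
  exact: (proj2 (projT2 (cid (projT2 (ex l))))).
exists l0, p, (fun l => Posz (kp l)); split.
- move=> l l_gt0 t z g j gu; rewrite !pP // -scalemxAr scalerA mulrC -scalerA.
  congr (_ *: _); apply/colP => i; rewrite !mxE.
  rewrite -(meval_homogZ _ _ (homog_hpart l _)).
  by apply: meval_eq => i'; rewrite pt_scale.
- move=> b u b_holo u_biholo Aub l z l_gt0.
  rewrite pP ?jacobian_unitmx // exprz_det_scaleK ?jacobian_unitmx //.
  apply/colP => i; rewrite mxE.
  exact: (solution_part_uniq psA init_src TK T_homog).
- split=> [b g z _ gu|]; last by rewrite kp1.
  rewrite pP // kp1 expr0 scale1r; apply/colP => i.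
  by rewrite mxE solution_part1 mevalXU.
(* The polyradius of the division operator serves as the polydisc; it was fixed before the constant
   and the compact set. *)
exists r => // B L B0 Lc Lu.
have [B' B'0 LB] := compact_matrix_bounds Lc Lu.
have [Q Q0 QP] := solution_part_bound psA init_src T_homog r0 K0 T_bound B0 B'0.
exists Q => // g b Lg _ bB l l_gt0; have gu : g \in unitmx := Lu _ Lg.
apply: supnorm_le => [||z i zr]; first exact: exprn_ge0 (ltW Q0).
  by exists 0 => i; rewrite mxE ComplexField.Normc.normc0.
rewrite pP // exprz_det_scaleK // mxE.
by apply: QP => //; exact: LB.
Qed.
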